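(* Let $\phi:(G\rightrightarrows M)\to(G'\rightrightarrows M')$ be a map of Lie groupoids. Then $\phi$ is a Morita map if and only if the following two conditions hold: (i) the induced map between the orbit spaces $\phi_*:M/G\to M'/G'$ is a homeomorphism; (ii) for every $x\in M$, writing $x'=\phi(x)$ and letting $O$ and $O'$ be the orbits of $x$ and $x'$, the induced morphism between the normal representations $$\phi_*:(G_x\curvearrowright N_xO)\to(G'_{x'}\curvearrowright N_{x'}O')$$ is an isomorphism (that is, $G_x\to G'_{x'}$ is an isomorphism of Lie groups and $N_xO\to N_{x'}O'$ is a linear isomorphism).
   Context: Manifolds are smooth, Hausdorff, second countable and without boundary. A Lie groupoid $G\rightrightarrows M$ has manifolds of objects $M$ and arrows $G$, submersions $s,t:G\to M$ (source, target), and smooth multiplication, unit and inverse. A map of Lie groupoids is a pair of smooth maps $G\to G'$, $M\to M'$ (both denoted $\phi$) preserving source, target and multiplication. The anchor of $G$ is $\rho=(t,s):G\to M\times M$. $G_x=s^{-1}(x)\cap t^{-1}(x)$ is the isotropy Lie group; the orbit of $x$ is $O=t(s^{-1}(x))$, an immersed submanifold identified with $s^{-1}(x)/G_x$; $M/G$ is the set of orbits with the quotient topology. Normal representation: with $NO=TM|_O/TO$, an arrow $g$ from $x$ to $y$ in $O$ gives the linear isomorphism $\eta_g:N_xO\to N_yO$, $\eta_g[w]=[dt(\xi)]$ for any $\xi\in T_gG$ with $ds(\xi)=w$; restricting to $G_x$ gives a representation $G_x\curvearrowright N_xO$. A groupoid map $\phi$ induces homomorphisms $G_x\to G'_{\phi(x)}$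 and (via $d\phi$) equivariant linear maps $N_xO\to N_{\phi(x)}O'$. A pullback of manifolds $M_1\times_M M_2$ of smooth maps $f_1,f_2$ is a good pullback if it is a pullback of the underlying topological spaces and induces pullbacks between tangent spaces, i.e. $0\to T_{(x_1,x_2)}(M_1\times_MM_2)\to T_{x_1}M_1\times T_{x_2}M_2\xrightarrow{df_1-df_2}T_xM$ is exact at all points. A map $\phi$ is fully faithful if the square formed by $\phi:G\to G'$, the anchors $\rho:G\to M\times M$ and $\rho':G'\to M'\times M'$, and $\phi\times\phi:M\times M\to M'\times M'$ is a good pullback. It is essentially surjective if $G'\times_{M'}M\to M'$, $(g',x)\mapsto t(g')$, is a surjective submersion, where $G'\times_{M'}M=\{(g',x): s(g')=\phi(x)\}$. It is a Morita map if it is both fully faithful and essentially surjective. *)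

(* Defs.v *)
From HB Require Import structures.
From mathcomp Require Import all_boot all_order all_algebra.
From mathcomp Require Import generic_quotient ring_quotient.
From mathcomp Require Import all_classical all_reals all_analysis.

Set Implicit Arguments.
Unset Strict Implicit.
Unset Printing Implicit Defensive.

Import Order.TTheory GRing.Theory Num.Theory.
Import numFieldNormedType.Exports.

Local Open Scope classical_set_scope.
Local Open Scope ring_scope.
Local Open Scope quotient_scope.

Definition homeomorphism (S T : topologicalType) (f : S -> T) : Prop :=
  continuous f /\
  exists2 g : T -> S, continuous g & cancel f g /\ cancel g f.

(* [Ck k U f]: [f] is of class C^k at the points of [U], which is open in all
   the uses below. *)
Fixpoint Ck (R : realType) (m n k : nat) (U : set 'rV[R]_m)
    (f : 'rV[R]_m -> 'rV[R]_n) : Prop :=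
  if k is k'.+1 then
    (forall x, U x -> differentiable f x) /\
    (forall v, Ck k' U (fun x => 'D_v f x))
  else forall x, U x -> {for x, continuous f}.

Definition Cinfty (R : realType) (m n : nat) (U : set 'rV[R]_m)
  (f : 'rV[R]_m -> 'rV[R]_n) : Prop := forall k, Ck k U f.

Section CkTheory.
Variable R : realType.

Lemma sub_Ck m n k (U V : set 'rV[R]_m) (f : 'rV[R]_m -> 'rV[R]_n) :
  V `<=` U -> Ck k U f -> Ck k V f.
Proof.
move=> VU; elim: k f => [|k IH] f /=; first by move=> h x /VU; exact: h.
by move=> [h1 h2]; split=> [x /VU|v]; [exact: h1|exact: IH].
Qed.

Lemma near_eq_differentiable (V W : normedModType R) (f g : V -> W) x :
  (\forall y \near x, f y = g y) -> differentiable f x -> differentiable g x.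
Proof.
move=> fg dfx; have fgx : f x = g x := nbhs_singleton fg.
have fg0 : \forall h \near (0 : V), f (h + x) = g (h + x).
  by have := fg; rewrite (near_shift 0) subr0.
have H : g \o shift x = cst (g x) + 'd f x +o_ (0 : V) id.
  apply/eqaddoP => e e0; have /eqaddoP /(_ e e0) := diff_locally dfx.
  apply: filterS2 fg0 => h fgh; rewrite -fgx /= !fctE /= in fgh *.
  by rewrite /= -fgh.
apply/diff_locallyP; have cd := diff_continuous dfx.
by rewrite (diff_unique cd H).
Qed.

Lemma eq_Ck m n k (U : set 'rV[R]_m) (f g : 'rV[R]_m -> 'rV[R]_n) :
  open U -> (forall x, U x -> f x = g x) -> Ck k U f -> Ck k U g.
Proof.
move=> oU; elim: k f g => [|k IH] f g fg /=.
  move=> cf x Ux; rewrite /prop_for /continuous_at -fg//.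
  have nfg : \forall y \near x, f y = g y.
    exact: (@filterS _ (nbhs x) _ U _ fg (open_nbhs_nbhs (conj oU Ux))).
  apply: cvg_trans (cf x Ux); exact: (@near_eq_cvg _ _ (nbhs x) _ f g nfg).
have nfg x : U x -> \forall y \near x, f y = g y.
  move=> Ux.
  exact: (@filterS _ (nbhs x) _ U _ fg (open_nbhs_nbhs (conj oU Ux))).
move=> [df Df]; split=> [x Ux|v].
  exact: near_eq_differentiable (nfg x Ux) (df x Ux).
by apply: IH (Df v) => x Ux; apply: near_eq_derive; exact: nfg.
Qed.

Lemma continuous_row_mx m n (T : topologicalType) (f : T -> 'rV[R]_m)
    (g : T -> 'rV[R]_n) x :
  {for x, continuous f} -> {for x, continuous g} ->
  {for x, continuous (fun y => row_mx (f y) (g y))}.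
Proof.
move=> cf cg A /nbhs_ballP[e /= e0 eA].
have /= Hg : nbhs x (g @^-1` ball (g x) e) := cg _ (nbhsx_ballx _ _ e0).
have /= Hf : nbhs x (f @^-1` ball (f x) e) := cf _ (nbhsx_ballx _ _ e0).
apply: (@filterS2 _ (nbhs x) _ _ _ _ _ Hf Hg) => y [_ fy] [_ gy].
apply: eA; split=> // i j.
rewrite !mxE; case: (fintype.split j) => k; [exact: fy|exact: gy].
Qed.

Let inl_mx m n (a : 'rV[R]_m) : 'rV[R]_(m + n) := row_mx a 0.
Let inr_mx m n (b : 'rV[R]_n) : 'rV[R]_(m + n) := row_mx 0 b.

Fact inl_mx_linear m n : linear (@inl_mx m n).
Proof. by move=> a u v; rewrite /inl_mx scale_row_mx add_row_mx scaler0 addr0. Qed.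
Fact inr_mx_linear m n : linear (@inr_mx m n).
Proof. by move=> a u v; rewrite /inr_mx scale_row_mx add_row_mx scaler0 addr0. Qed.
HB.instance Definition _ m n :=
  GRing.isLinear.Build R 'rV[R]_m 'rV[R]_(m + n) _ (@inl_mx m n)
    (@inl_mx_linear m n).
HB.instance Definition _ m n :=
  GRing.isLinear.Build R 'rV[R]_n 'rV[R]_(m + n) _ (@inr_mx m n)
    (@inr_mx_linear m n).

Lemma inl_mx_continuous m n : continuous (@inl_mx m n).
Proof.
move=> x; apply: (@continuous_row_mx m n _ id (fun=> 0) x) => //.
exact: cst_continuous.
Qed.
Lemma inr_mx_continuous m n : continuous (@inr_mx m n).
Proof.
move=> x; apply: (@continuous_row_mx m n _ (fun=> 0) id x) => //.
exact: cst_continuous.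
Qed.

Section prod_map.
Variables (m n p q : nat).
Implicit Types (f : 'rV[R]_m -> 'rV[R]_p) (g : 'rV[R]_n -> 'rV[R]_q).

Definition prod_map f g (w : 'rV[R]_(m + n)) : 'rV[R]_(p + q) :=
  row_mx (f (lsubmx w)) (g (rsubmx w)).

Lemma prod_mapE f g : prod_map f g =
  ((@inl_mx p q \o (f \o lsubmx)) \+ (@inr_mx p q \o (g \o rsubmx)))%R.
Proof. by apply/funext => w /=; rewrite add_row_mx addr0 add0r. Qed.

Lemma differentiable_prod_map f g w :
  differentiable f (lsubmx w) -> differentiable g (rsubmx w) ->
  differentiable (prod_map f g) w.
Proof.
move=> df dg; rewrite prod_mapE; apply: differentiableD.
  apply: differentiable_comp; last exact/linear_differentiable/inl_mx_continuous.
  by apply: differentiable_comp => //; exact: differentiable_lsubmx.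
apply: differentiable_comp; last exact/linear_differentiable/inr_mx_continuous.
by apply: differentiable_comp => //; exact: differentiable_rsubmx.
Qed.

Lemma derive_prod_map f g w v :
  differentiable f (lsubmx w) -> differentiable g (rsubmx w) ->
  'D_v (prod_map f g) w = prod_map ('D_(lsubmx v) f) ('D_(rsubmx v) g) w.
Proof.
move=> df dg; rewrite deriveE; last exact: differentiable_prod_map.
have dl := @differentiable_lsubmx R 1 m n w.
have dr := @differentiable_rsubmx R 1 m n w.
have dfl : differentiable (f \o lsubmx) w by exact: differentiable_comp.
have dgr : differentiable (g \o rsubmx) w by exact: differentiable_comp.
have il u := @linear_differentiable R _ _ (@inl_mx p q) u (@inl_mx_continuous _ _).
have ir u := @linear_differentiable R _ _ (@inr_mx p q) u (@inr_mx_continuous _ _).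
have Ef : 'd (@inl_mx p q \o (f \o lsubmx)) w v =
    inl_mx q ('d f (lsubmx w) (lsubmx v)).
  have -> : 'd (@inl_mx p q \o (f \o lsubmx)) w =
      'd (@inl_mx p q) (f (lsubmx w)) \o ('d (f \o lsubmx) w) :> (_ -> _).
    exact: (diff_comp dfl (il _)).
  have -> : 'd (f \o lsubmx) w =
      'd f (lsubmx w) \o 'd (@lsubmx R 1 m n) w :> (_ -> _).
    exact: (diff_comp dl df).
  by rewrite [LHS]/= (diff_lin _ (@inl_mx_continuous _ _))
    (diff_lin _ (@continuous_lsubmx _ _ _ _)).
have Eg : 'd (@inr_mx p q \o (g \o rsubmx)) w v =
    inr_mx p ('d g (rsubmx w) (rsubmx v)).
  have -> : 'd (@inr_mx p q \o (g \o rsubmx)) w =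
      'd (@inr_mx p q) (g (rsubmx w)) \o ('d (g \o rsubmx) w) :> (_ -> _).
    exact: (diff_comp dgr (ir _)).
  have -> : 'd (g \o rsubmx) w =
      'd g (rsubmx w) \o 'd (@rsubmx R 1 m n) w :> (_ -> _).
    exact: (diff_comp dr dg).
  by rewrite [LHS]/= (diff_lin _ (@inr_mx_continuous _ _))
    (diff_lin _ (@continuous_rsubmx _ _ _ _)).
rewrite prod_mapE diffD; [|exact: (differentiable_comp dfl (il _))|
  exact: (differentiable_comp dgr (ir _))].
apply: etrans (congr2 +%R Ef Eg) _.
by rewrite -(deriveE _ df) -(deriveE _ dg) add_row_mx addr0 add0r.
Qed.

Lemma open_prod_mx (U : set 'rV[R]_m) (V : set 'rV[R]_n) : open U -> open V ->
  open [set w : 'rV[R]_(m + n) | U (lsubmx w) /\ V (rsubmx w)].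
Proof.
move=> oU oV.
have cl := @continuous_lsubmx R 1 m n.
have cr := @continuous_rsubmx R 1 m n.
have ol : open ((@lsubmx R 1 m n) @^-1` U).
  by move/continuousP : cl; exact.
have or : open ((@rsubmx R 1 m n) @^-1` V).
  by move/continuousP : cr; exact.
exact: openI ol or.
Qed.

Lemma Ck_prod_map k (U : set 'rV[R]_m) (V : set 'rV[R]_n) f g :
  open U -> open V -> Ck k U f -> Ck k V g ->
  Ck k [set w | U (lsubmx w) /\ V (rsubmx w)] (prod_map f g).
Proof.
move=> oU oV.
have oW := open_prod_mx oU oV.
elim: k f g => [|k IH] f g /=.
  move=> cf cg w [Uw Vw]; apply: continuous_row_mx.
    by apply: continuous_comp; [exact: continuous_lsubmx|exact: cf].
  by apply: continuous_comp; [exact: continuous_rsubmx|exact: cg].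
move=> [df Df] [dg Dg]; split=> [w [Uw Vw]|v].
  by apply: differentiable_prod_map; [exact: df|exact: dg].
apply: eq_Ck (IH _ _ (Df (lsubmx v)) (Dg (rsubmx v))) => // w [Uw Vw].
by rewrite derive_prod_map//; [exact: df|exact: dg].
Qed.

End prod_map.
End CkTheory.

Record chart (R : realType) (T : topologicalType) (n : nat) := Chart {
  chart_fun :> T -> 'rV[R]_n;
  chart_inv : 'rV[R]_n -> T;
  chart_dom : set T;
  chart_dom_open : open chart_dom;
  chart_cod_open : open (chart_fun @` chart_dom);
  chart_funK : forall x, chart_dom x -> chart_inv (chart_fun x) = x;
  chart_fun_cont : forall x, chart_dom x -> {for x, continuous chart_fun};
  chart_inv_cont : forall y, (chart_fun @` chart_dom) y ->
    {for y, continuous chart_inv}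
}.

(* Manifolds of dimension [n]. The atlas need not be maximal; [chart_at x] is
   a preferred chart around [x], used only to give coordinates to tangent
   vectors at [x]. *)
Record manifold (R : realType) (n : nat) := Manifold {
  carrier :> topologicalType;
  atlas : Type;
  atlas_chart : atlas -> chart R carrier n;
  chart_at : carrier -> atlas;
  chart_atP : forall x, chart_dom (atlas_chart (chart_at x)) x;
  transition_smooth : forall a b,
    Cinfty (atlas_chart a @`
             (chart_dom (atlas_chart a) `&` chart_dom (atlas_chart b)))
      (atlas_chart b \o chart_inv (atlas_chart a));
  manifold_hausdorff : hausdorff_space carrier;
  manifold_second_countable : @second_countable carrier
}.

Section smooth_maps.
Variables (R : realType) (m n : nat) (M : manifold R m) (N : manifold R n).

Definition smooth_in (U : set M) (f : M -> N) : Prop :=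
  (forall x, U x -> {for x, continuous f}) /\
  forall (a : atlas M) (b : atlas N),
    Cinfty (atlas_chart a @` (chart_dom (atlas_chart a) `&` U `&` f @^-1` chart_dom (atlas_chart b)))
      (atlas_chart b \o f \o chart_inv (atlas_chart a)).

Definition smooth (f : M -> N) : Prop := smooth_in setT f.

(* Smoothness of the restriction of [f] to an embedded submanifold [A]. *)
Definition smooth_on (A : set M) (f : M -> N) : Prop :=
  forall x, A x -> exists (U : set M) (F : M -> N),
    [/\ open U, U x, smooth_in U F & forall y, (A `&` U) y -> F y = f y].

End smooth_maps.

(* The tangent space at [x], read in the preferred chart around [x]. *)
Definition tangent (R : realType) (n : nat) (M : manifold R n) (x : M) :=
  'rV[R]_n.

HB.instance Definition _ (R : realType) n (M : manifold R n) (x : M) :=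
  NormedModule.on (tangent x).
HB.instance Definition _ (R : realType) n (M : manifold R n) (x : M) :=
  Vector.on (tangent x).

Definition mdiff (R : realType) (m n : nat) (M : manifold R m)
    (N : manifold R n) (f : M -> N) (x : M) :
    {linear tangent x -> tangent (f x)} :=
  'd (atlas_chart (chart_at (f x)) \o f \o chart_inv (atlas_chart (chart_at x)))
     (atlas_chart (chart_at x) x).

Definition submersion (R : realType) (m n : nat) (M : manifold R m)
    (N : manifold R n) (f : M -> N) : Prop :=
  smooth f /\ forall x (w : tangent (f x)), exists v, mdiff f x v = w.

Section prod_manifold.
Variables (R : realType) (m n : nat).

Section prod_chart.
Variables (S T : topologicalType) (c : chart R S m) (d : chart R T n).

Definition prod_chart_fun (p : S * T) : 'rV[R]_(m + n) :=
  row_mx (c p.1) (d p.2).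
Definition prod_chart_inv (w : 'rV[R]_(m + n)) : S * T :=
  (chart_inv c (lsubmx w), chart_inv d (rsubmx w)).
Definition prod_chart_dom : set (S * T) := chart_dom c `*` chart_dom d.

Lemma image_prod_chart (A : set S) (B : set T) :
  prod_chart_fun @` (A `*` B) =
  [set w | (c @` A) (lsubmx w) /\ (d @` B) (rsubmx w)].
Proof.
apply/seteqP; split=> [_ [[x y] [/= Ax By] <-]|w [[x Ax xw] [y By yw]]] /=.
  by rewrite row_mxKl row_mxKr; split; [exists x|exists y].
by exists (x, y) => //; rewrite /prod_chart_fun /= xw yw hsubmxK.
Qed.

Fact prod_chart_dom_open : open prod_chart_dom.
Proof.
rewrite openE => -[x y] [/= cx dy]; exists (chart_dom c, chart_dom d) => //=.
by split; apply: open_nbhs_nbhs; split => //; exact: chart_dom_open.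
Qed.

Fact prod_chart_cod_open : open (prod_chart_fun @` prod_chart_dom).
Proof. by rewrite image_prod_chart; apply: open_prod_mx; exact: chart_cod_open. Qed.

Fact prod_chart_funK p :
  prod_chart_dom p -> prod_chart_inv (prod_chart_fun p) = p.
Proof.
case: p => x y [/= cx dy]; rewrite /prod_chart_inv row_mxKl row_mxKr.
by rewrite !chart_funK.
Qed.

Fact prod_chart_fun_cont p :
  prod_chart_dom p -> {for p, continuous prod_chart_fun}.
Proof.
case: p => x y [/= cx dy].
apply: (@continuous_row_mx R m n _ (c \o fst) (d \o snd)).
  by apply: continuous_comp; [exact: cvg_fst|exact: chart_fun_cont].
by apply: continuous_comp; [exact: cvg_snd|exact: chart_fun_cont].
Qed.

Fact prod_chart_inv_cont w : (prod_chart_fun @` prod_chart_dom) w ->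
  {for w, continuous prod_chart_inv}.
Proof.
rewrite image_prod_chart => -[cw dw].
have c1 : {for w, continuous (chart_inv c \o lsubmx)}.
  by apply: continuous_comp; [exact: continuous_lsubmx|exact: chart_inv_cont].
have c2 : {for w, continuous (chart_inv d \o rsubmx)}.
  by apply: continuous_comp; [exact: continuous_rsubmx|exact: chart_inv_cont].
exact: cvg_pair c1 c2.
Qed.

Definition prod_chart : chart R (S * T)%type (m + n) :=
  Chart prod_chart_dom_open prod_chart_cod_open prod_chart_funK
    prod_chart_fun_cont prod_chart_inv_cont.

End prod_chart.

Lemma hausdorff_prod (S T : topologicalType) :
  hausdorff_space S -> hausdorff_space T -> hausdorff_space (S * T)%type.
Proof.
move=> hS hT [x y] [x' y'] cl; congr pair.
  apply: hS => A B nA nB.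
  have [] := cl (A `*` setT) (B `*` setT).
  - by exists (A, setT) => //; split => //; exact: filterT.
  - by exists (B, setT) => //; split => //; exact: filterT.
  by move=> [u v] [[/= Au _] [/= Bu _]]; exists u.
apply: hT => A B nA nB.
have [] := cl (setT `*` A) (setT `*` B).
- by exists (setT, A) => //; split => //; exact: filterT.
- by exists (setT, B) => //; split => //; exact: filterT.
by move=> [u v] [[/= _ Av] [/= _ Bv]]; exists v.
Qed.

Lemma second_countable_prod (S T : topologicalType) :
  @second_countable S -> @second_countable T ->
  @second_countable (S * T)%type.
Proof.
move=> [A cA [oA bA]] [B cB [oB bB]].
exists ((fun P => P.1 `*` P.2) @` (A `*` B)).
  exact: sub_countable (card_image_le _ _) (countableX cA cB).
split=> [_ [[U V] [/= AU BV] <-]|[x y] W [[U V] [/= xU yV] UVW]].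
  rewrite openE => -[u v] [/= Uu Vv]; exists (U, V) => //=.
  by split; apply: open_nbhs_nbhs; split => //; [exact: oA|exact: oB].
have [U' [AU' U'x] U'U] := bA x U xU.
have [V' [BV' V'y] V'V] := bB y V yV.
exists (U' `*` V'); first by split=> //; exists (U', V').
by move=> [u v] [/= /U'U Uu /V'V Vv]; apply: UVW.
Qed.

Section transition.
Variables (M : manifold R m) (N : manifold R n).

Lemma transition_open k (L : manifold R k) (a b : atlas L) :
  open (atlas_chart a @` (chart_dom (atlas_chart a) `&` chart_dom (atlas_chart b))).
Proof.
rewrite openE => _ [x [ax bx] <-].
have cx : (atlas_chart a @` chart_dom (atlas_chart a)) (atlas_chart a x) by exists x.
have n1 : nbhs (atlas_chart a x) (atlas_chart a @` chart_dom (atlas_chart a)).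
  by apply: open_nbhs_nbhs; split => //; exact: chart_cod_open.
have n2 : nbhs (atlas_chart a x) (chart_inv (atlas_chart a) @^-1` chart_dom (atlas_chart b)).
  apply: (chart_inv_cont cx); rewrite chart_funK//.
  by apply: open_nbhs_nbhs; split => //; exact: chart_dom_open.
apply: (@filterS2 _ (nbhs (atlas_chart a x)) _ _ _ _ _ n1 n2).
move=> _ [y ay <-] /=; rewrite chart_funK// => yb.
by exists y.
Qed.

Definition prod_atlas_chart (ab : atlas M * atlas N) :=
  prod_chart (atlas_chart ab.1) (atlas_chart ab.2).

Fact prod_transition_smooth ab cd :
  Cinfty (prod_atlas_chart ab @`
           (chart_dom (prod_atlas_chart ab) `&` chart_dom (prod_atlas_chart cd)))
    (prod_atlas_chart cd \o chart_inv (prod_atlas_chart ab)).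
Proof.
case: ab cd => [a b] [c d] k.
have -> : chart_dom (prod_atlas_chart (a, b)) `&`
    chart_dom (prod_atlas_chart (c, d)) =
  (chart_dom (atlas_chart a) `&` chart_dom (atlas_chart c)) `*`
  (chart_dom (atlas_chart b) `&` chart_dom (atlas_chart d)).
  by rewrite setXI.
rewrite image_prod_chart.
exact: (Ck_prod_map (@transition_open _ M a c) (@transition_open _ N b d)
  (@transition_smooth _ _ M a c k) (@transition_smooth _ _ N b d k)).
Qed.

Fact prod_chart_atP (p : M * N) : chart_dom
  (prod_atlas_chart (chart_at p.1, chart_at p.2)) p.
Proof. by split; exact: chart_atP. Qed.

Definition prod_manifold : manifold R (m + n) :=
  @Manifold R (m + n) (M * N)%type (atlas M * atlas N)%type prod_atlas_chart
    (fun p => (chart_at p.1, chart_at p.2))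
    prod_chart_atP prod_transition_smooth
    (hausdorff_prod (@manifold_hausdorff _ _ M) (@manifold_hausdorff _ _ N))
    (second_countable_prod (@manifold_second_countable _ _ M)
       (@manifold_second_countable _ _ N)).

End transition.
End prod_manifold.

Section quotient_space.
Variables (K : fieldType) (V : vectType K) (U : {vspace V}).

Definition quotv := Quotient.quot U.
HB.instance Definition _ := GRing.Zmodule.on quotv.
HB.instance Definition _ := EqQuotient.on quotv.

Definition quotv_scale (a : K) (q : quotv) : quotv := \pi_quotv (a *: repr q).

Lemma quotv_eq (v w : V) :
  (\pi_quotv v = \pi_quotv w) <-> v - w \in U.
Proof.
have -> : (v - w \in U) = (v == w %[mod Quotient.quot U]).
  exact: Quotient.idealrBE.
by split=> [?|/eqP//]; apply/eqP.
Qed.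

Lemma quotv_piZ a v : \pi_quotv (a *: v) = quotv_scale a (\pi_quotv v).
Proof.
apply/quotv_eq; rewrite -scalerBr; apply: rpredZ.
by apply/quotv_eq; rewrite reprK.
Qed.

Lemma quotv_piD v w : \pi_quotv (v + w) = \pi_quotv v + \pi_quotv w.
Proof. exact: Quotient.pi_add. Qed.

Fact quotv_scaleA a b q :
  quotv_scale a (quotv_scale b q) = quotv_scale (a * b) q.
Proof.
elim/quotW: q => v.
by rewrite -(quotv_piZ b v) -(quotv_piZ a (b *: v)) -(quotv_piZ _ v) scalerA.
Qed.
Fact quotv_scale1 : left_id 1 quotv_scale.
Proof. by elim/quotW => v; rewrite -(quotv_piZ 1 v) scale1r. Qed.
Fact quotv_scaleDr : right_distributive quotv_scale +%R.
Proof.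
move=> a; elim/quotW => v; elim/quotW => w.
rewrite -(quotv_piD v w) -(quotv_piZ a v) -(quotv_piZ a w).
by rewrite -(quotv_piZ a (v + w)) -(quotv_piD (a *: v)) scalerDr.
Qed.
Fact quotv_scaleDl q : {morph quotv_scale^~ q : a b / a + b}.
Proof.
move=> a b; elim/quotW: q => v /=.
rewrite -(quotv_piZ a v) -(quotv_piZ b v) -(quotv_piZ (a + b) v).
by rewrite -(quotv_piD (a *: v)) scalerDl.
Qed.
HB.instance Definition _ := GRing.Zmodule_isLmodule.Build K quotv
  quotv_scaleA quotv_scale1 quotv_scaleDr quotv_scaleDl.
End quotient_space.

Section good_pullback.
Variables (R : realType) (k m1 m2 m : nat).
Variables (P : manifold R k) (M1 : manifold R m1) (M2 : manifold R m2).
Variables (M : manifold R m).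
Variables (f1 : M1 -> M) (f2 : M2 -> M) (p1 : P -> M1) (p2 : P -> M2).

Definition fibre_product : set (M1 * M2) := [set x | f1 x.1 = f2 x.2].

(* [P], with the smooth maps [p1] and [p2], is a good pullback of [f1] and
   [f2]. The fibre product has the subspace topology. *)
Definition good_pullback : Prop :=
  [/\ smooth p1, smooth p2,
      exists2 h : P -> set_type fibre_product, homeomorphism h &
        forall p, \val (h p) = (p1 p, p2 p),
      forall p (v : tangent p), mdiff p1 p v = 0 -> mdiff p2 p v = 0 -> v = 0 &
      forall p (v1 : tangent (p1 p)) (v2 : tangent (p2 p)),
        mdiff f1 (p1 p) v1 - mdiff f2 (p2 p) v2 = 0 <->
        exists v : tangent p, mdiff p1 p v = v1 /\ mdiff p2 p v = v2].

End good_pullback.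

(* [gmul g h] is only meaningful when [src g = tgt h]. In [gmul_smooth], [P] is
   the manifold of composable pairs; it exists and is unique up to
   diffeomorphism because [src] is a submersion. *)
Record lie_groupoid (R : realType) := LieGroupoid {
  obj_dim : nat;
  arr_dim : nat;
  obj : manifold R obj_dim;
  arr : manifold R arr_dim;
  src : arr -> obj;
  tgt : arr -> obj;
  gunit : obj -> arr;
  ginv : arr -> arr;
  gmul : arr -> arr -> arr;
  src_submersion : submersion src;
  tgt_submersion : submersion tgt;
  gunit_smooth : smooth gunit;
  ginv_smooth : smooth ginv;
  gmul_smooth : exists (k : nat) (P : manifold R k) (p1 p2 : P -> arr),
    good_pullback src tgt p1 p2 /\ smooth (fun p => gmul (p1 p) (p2 p));
  src_gunit : forall x, src (gunit x) = x;
  tgt_gunit : forall x, tgt (gunit x) = x;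
  src_ginv : forall g, src (ginv g) = tgt g;
  tgt_ginv : forall g, tgt (ginv g) = src g;
  src_gmul : forall g h, src g = tgt h -> src (gmul g h) = src h;
  tgt_gmul : forall g h, src g = tgt h -> tgt (gmul g h) = tgt g;
  gmulA : forall g h l, src g = tgt h -> src h = tgt l ->
    gmul g (gmul h l) = gmul (gmul g h) l;
  gunitM : forall g, gmul (gunit (tgt g)) g = g;
  gmul_gunit : forall g, gmul g (gunit (src g)) = g;
  gmulV : forall g, gmul (ginv g) g = gunit (src g);
  gmul_ginv : forall g, gmul g (ginv g) = gunit (tgt g)
}.

Arguments src {R l} g : rename.
Arguments tgt {R l} g : rename.

Record groupoid_map (R : realType) (G G' : lie_groupoid R) := GroupoidMap {
  map_arr : arr G -> arr G';
  map_obj : obj G -> obj G';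
  map_arr_smooth : smooth map_arr;
  map_obj_smooth : smooth map_obj;
  map_src : forall g, src (map_arr g) = map_obj (src g);
  map_tgt : forall g, tgt (map_arr g) = map_obj (tgt g);
  map_mul : forall g h, src g = tgt h ->
    map_arr (gmul g h) = gmul (map_arr g) (map_arr h)
}.

Section orbit_space.
Variables (R : realType) (G : lie_groupoid R).

Definition anchor (g : arr G) : prod_manifold (obj G) (obj G) :=
  (tgt g, src g).

Definition isotropy (x : obj G) : set (arr G) :=
  [set g | src g = x /\ tgt g = x].

Definition orbit (x : obj G) : set (obj G) := tgt @` [set g | src g = x].

Definition orbit_rel : rel (obj G) := fun x y => `[< orbit x y >].

Fact orbit_rel_equiv : equiv_class_of orbit_rel.
Proof.
split=> [x|x y|y x z]; rewrite /orbit_rel.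
- by apply/asboolP; exists (gunit x); rewrite ?tgt_gunit//= src_gunit.
- apply/asboolP/asboolP => -[g <- <-]; exists (ginv g);
    by rewrite ?tgt_ginv//= src_ginv.
- move=> /asboolP[g /= gx gy] /asboolP[h /= hy hz]; apply/asboolP.
  by exists (gmul h g); rewrite /= ?src_gmul ?tgt_gmul ?hy.
Qed.

Canonical orbit_rel_equiv_rel := EquivRelPack orbit_rel_equiv.

(* The set of orbits M/G, with the quotient topology. *)
Definition orbit_space : topologicalType :=
  quotient_topology {eq_quot orbit_rel}.

Definition to_orbit (x : obj G) : orbit_space := \pi_{eq_quot orbit_rel} x.
Definition of_orbit (q : orbit_space) : obj G :=
  repr (q : {eq_quot orbit_rel}).

(* T_xO as a subspace of T_xM: since O is identified with s^-1(x)/G_x via t, it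
   is the image of T_{1_x} s^-1(x) = ker ds under dt. *)
Definition orbit_tangent (x : obj G) : {vspace tangent x} :=
  (linfun (mdiff tgt (gunit x)) @:
     lker (linfun (mdiff src (gunit x))))%VS.

Definition orbit_normal (x : obj G) := quotv (orbit_tangent x).

(* The isomorphism eta_g : N_xO -> N_yO induced by an arrow g from x to y; the
   result does not depend on the representative of [q] nor on the lift [xi].
   When [src g = x] and [tgt g = y], [tangent (src g)] and [tangent (tgt g)] are
   [tangent x] and [tangent y], with the same preferred charts. *)
Definition normal_action (x y : obj G) (g : arr G) (q : orbit_normal x) :
    orbit_normal y :=
  \pi_(quotv (orbit_tangent y)) (mdiff tgt g
    (xget 0 [set xi : tangent g | mdiff src g xi = repr q])).

End orbit_space.

Section morita.
Variables (R : realType) (G G' : lie_groupoid R) (phi : groupoid_map G G').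

Definition fully_faithful : Prop :=
  good_pullback (@anchor _ G')
    (fun p : prod_manifold (obj G) (obj G) =>
       (map_obj phi p.1, map_obj phi p.2) : prod_manifold (obj G') (obj G'))
    (map_arr phi) (@anchor _ G).

(* [Q] is the manifold G' x_{M'} M; it exists and is unique up to
   diffeomorphism because the source map of [G'] is a submersion. *)
Definition essentially_surjective : Prop :=
  exists (k : nat) (Q : manifold R k) (q1 : Q -> arr G') (q2 : Q -> obj G),
    [/\ good_pullback src (map_obj phi) q1 q2,
        submersion (fun z => tgt (q1 z)) &
        forall x' : obj G', exists z, tgt (q1 z) = x'].

Definition morita : Prop := fully_faithful /\ essentially_surjective.

Definition orbit_map (q : orbit_space G) : orbit_space G' :=
  to_orbit (map_obj phi (of_orbit q)).

(* G_x -> G'_{phi(x)} is an isomorphism of Lie groups; the manifold structures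
   on the isotropy groups are those of embedded submanifolds of the manifolds
   of arrows. *)
Definition isotropy_iso (x : obj G) : Prop :=
  [/\ set_bij (isotropy x) (isotropy (map_obj phi x)) (map_arr phi),
      {in isotropy x &, {morph map_arr phi : g h / gmul g h}},
      smooth_on (isotropy x) (map_arr phi) &
      exists2 psi : arr G' -> arr G,
        smooth_on (isotropy (map_obj phi x)) psi &
        forall g, isotropy x g -> psi (map_arr phi g) = g].

Definition normal_map (x : obj G) (q : orbit_normal x) :
    orbit_normal (map_obj phi x) :=
  \pi_(quotv (orbit_tangent (map_obj phi x))) (mdiff (map_obj phi) x (repr q)).

Definition normal_rep_iso (x : obj G) : Prop :=
  [/\ isotropy_iso x,
      linear (@normal_map x), bijective (@normal_map x) &
      forall (g : arr G) (q : orbit_normal x), isotropy x g ->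
        normal_map (normal_action x g q) =
        normal_action (map_obj phi x) (map_arr phi g) (normal_map q)].

End morita.

(* Main.v *)
(* The equivalence is read off on tangent spaces, using the inverse function
   theorem to pass between germs and derivatives.

   Let k_g be the intersection of ker ds and ker dt at an arrow g. Restricted to
   a fibre of the source, the target has constant rank: its rank at g is dim O,
   since translations by arrows identify the images dt(ker ds). The constant
   rank theorem then gives a germ of retraction of G onto the arrows from s(g)
   to t(g) whose derivative is the identity on k_g, so that an isomorphism of
   isotropy groups induces isomorphisms on the spaces k at the units and, by
   translation and a dimension count, at all arrows.

   If phi induces a homeomorphism of orbit spaces and isomorphisms of normal
   representations, surjectivity on the normal spaces says that
   (g', x) |-> t(g') is a submersion, and injectivity on the normal spaces
   together with the isomorphisms of the spaces k gives the exactness of the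
   tangent sequence of the anchor square. The bijection from G to the fibre
   product is then a homeomorphism because a map whose derivative is onto the
   kernel of the derivative of a submersion is locally onto its zero set.
   Conversely, if phi is Morita, the normal isomorphisms follow from the two
   tangent conditions, the inverse on isotropy groups extends locally by a left
   inverse of the immersion (phi, rho), and the inverse on orbit spaces is
   continuous because submersions are open. *)

(* The isotropy groups are never given a manifold structure here. A map smooth on such a group is
   only known to extend locally to a smooth map on arrows, and the extension is arbitrary off the
   group, so an inverse of the map of isotropy groups cannot be differentiated directly.
   Precomposing the extension with the germ of retraction cures this: the composite sees only points
   of the group, and the derivative of the retraction fixes the vectors that matter. Multiplication
   is smooth only on a manifold of composable pairs. Differentiating a translation therefore means
   lifting maps into that manifold; a good pullback admits smooth lifts because its two projections
   together form an immersion and a topological embedding. Essential surjectivity asks for a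
   manifold to exist, so the fibre product of a submersion and a smooth map has to be constructed,
   from local parametrizations glued into an atlas. *)
From HB Require Import structures.
Require Import Defs.
From mathcomp Require Import all_boot all_order all_algebra.
From mathcomp Require Import all_classical all_reals all_analysis.
From mathcomp Require Import generic_quotient ring lra.

Set Implicit Arguments.
Unset Strict Implicit.
Unset Printing Implicit Defensive.

Import Order.TTheory GRing.Theory Num.Theory.
Import numFieldNormedType.Exports.

Local Open Scope classical_set_scope.
Local Open Scope ring_scope.
Local Open Scope quotient_scope.

(** * Maps of class C^k *)

Section Ck_calculus.
Variables (R : realType) (m : nat).
Implicit Types U : set 'rV[R]_m.

(** The recursion of [Ck] with an arbitrary normed module as codomain: the calculus below goes
    through scalar functions such as coordinates, determinants and their inverses, which are not row
    vectors. *)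
Fixpoint CkW (W : normedModType R) (k : nat) U (f : 'rV[R]_m -> W) : Prop :=
  if k is k'.+1 then
    (forall x, U x -> differentiable f x) /\
    (forall v, CkW k' U (fun x => 'D_v f x))
  else forall x, U x -> {for x, continuous f}.

Lemma CkWE n k U (f : 'rV[R]_m -> 'rV[R]_n) : CkW k U f <-> Ck k U f.
Proof.
elim: k f => [|k IH] f //=.
by split=> -[h1 h2]; split=> // v; apply/IH.
Qed.

Section codomain.
Variable W : normedModType R.
Implicit Types f g : 'rV[R]_m -> W.

Lemma CkWS k U f : CkW k.+1 U f -> CkW k U f.
Proof.
elim: k f => [|k IH] f /= [df Df].
  by move=> x Ux; exact: differentiable_continuous (df x Ux).
by split=> // v; exact: IH (Df v).
Qed.

Lemma sub_CkW k U V f : V `<=` U -> CkW k U f -> CkW k V f.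
Proof.
move=> VU; elim: k f => [|k IH] f /=; first by move=> h x /VU; exact: h.
by move=> [h1 h2]; split=> [x /VU|v]; [exact: h1|exact: IH].
Qed.

Lemma eq_CkW k U f g :
  open U -> (forall x, U x -> f x = g x) -> CkW k U f -> CkW k U g.
Proof.
move=> oU; elim: k f g => [|k IH] f g fg /=.
  move=> cf x Ux; rewrite /prop_for /continuous_at -fg//.
  have nfg : \forall y \near x, f y = g y.
    exact: (@filterS _ (nbhs x) _ U _ fg (open_nbhs_nbhs (conj oU Ux))).
  apply: cvg_trans (cf x Ux); exact: (@near_eq_cvg _ _ (nbhs x) _ f g nfg).
have nfg x : U x -> \forall y \near x, f y = g y.
  move=> Ux.
  exact: (@filterS _ (nbhs x) _ U _ fg (open_nbhs_nbhs (conj oU Ux))).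
move=> [df Df]; split=> [x Ux|v].
  exact: near_eq_differentiable (nfg x Ux) (df x Ux).
by apply: IH (Df v) => x Ux; apply: near_eq_derive; exact: nfg.
Qed.

Lemma CkW_cst k U (w : W) : CkW k U (fun=> w).
Proof.
elim: k w => [|k IH] w /=; first by move=> x _; exact: cst_continuous.
split=> [x _|v]; first exact: differentiable_cst.
have -> : (fun x => 'D_v (fun=> w) x) = (fun x : 'rV[R]_m => 0 : W).
  by apply/funext => x; rewrite (derive_cst w x v).
exact: IH.
Qed.

Lemma CkWD k U f g : open U -> CkW k U f -> CkW k U g ->
  CkW k U (fun x => f x + g x).
Proof.
move=> oU; elim: k f g => [|k IH] f g /=.
  by move=> cf cg x Ux; apply: continuousD; [exact: cf|exact: cg].
move=> [df Df] [dg Dg]; split=> [x Ux|v].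
  by apply: differentiableD; [exact: df|exact: dg].
apply: eq_CkW (IH _ _ (Df v) (Dg v)) => // x Ux.
by rewrite deriveD//; apply: diff_derivable; [exact: df|exact: dg].
Qed.

Lemma CkW_sum (I : Type) (r : seq I) (F : I -> 'rV[R]_m -> W) k U :
  open U -> (forall i, CkW k U (F i)) ->
  CkW k U (fun x => \sum_(i <- r) F i x).
Proof.
move=> oU CF; elim: r => [|i r IH].
  by apply: eq_CkW (CkW_cst k U 0) => // x _; rewrite big_nil.
by apply: eq_CkW (CkWD oU (CF i) IH) => // x _; rewrite big_cons.
Qed.

End codomain.

Lemma CkWM k U (f g : 'rV[R]_m -> R) : open U -> CkW k U f -> CkW k U g ->
  CkW k U (fun x => f x * g x).
Proof.
move=> oU; elim: k f g => [|k IH] f g.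
  by move=> cf cg x Ux; apply: continuousM; [exact: cf|exact: cg].
move=> Cf Cg; have [df Df] := Cf; have [dg Dg] := Cg.
split=> [x Ux|v].
  by apply: differentiableM; [exact: df|exact: dg].
have := CkWD oU (IH _ _ (CkWS Cf) (Dg v)) (IH _ _ (CkWS Cg) (Df v)).
apply: eq_CkW => // x Ux.
by rewrite deriveM//; apply: diff_derivable; [exact: df|exact: dg].
Qed.

Lemma CkW_prod (I : Type) (r : seq I) (F : I -> 'rV[R]_m -> R) k U :
  open U -> (forall i, CkW k U (F i)) ->
  CkW k U (fun x => \prod_(i <- r) F i x).
Proof.
move=> oU CF; elim: r => [|i r IH].
  by apply: eq_CkW (CkW_cst k U (1 : R)) => // x _; rewrite big_nil.
by apply: eq_CkW (CkWM oU (CF i) IH) => // x _; rewrite big_cons.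
Qed.

Lemma CkWV k U (f : 'rV[R]_m -> R) : open U -> (forall x, U x -> f x != 0) ->
  CkW k U f -> CkW k U (fun x => (f x)^-1).
Proof.
move=> oU f0; elim: k => [|k IH].
  by move=> cf x Ux; apply: continuousV; [exact: f0|exact: cf].
move=> Cf; have [df Df] := Cf; split=> [x Ux|v].
  by apply: differentiableV; [exact: df|exact: f0].
have CV := IH (CkWS Cf).
have := CkWM oU (CkW_cst k U (-1 : R)) (CkWM oU (CkWM oU CV CV) (Df v)).
apply: eq_CkW => // x Ux.
rewrite deriveV//; [|exact: f0|exact: diff_derivable (df x Ux)].
by rewrite mulN1r scaleNr expr2 invfM.
Qed.

Lemma differentiable_rowP n (f : 'rV[R]_m -> 'rV[R]_n) x :
  differentiable f x <-> forall j, differentiable (fun y => f y 0 j) x.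
Proof.
split=> [df j|df].
  exact: (@differentiable_comp _ _ _ _ f (fun M : 'rV[R]_n => M 0 j) x df
    (differentiable_coord _ _ _)).
have -> : f = fun y => \sum_(j < n) f y 0 j *: delta_mx 0 j.
  by apply/funext => y; exact: row_sum_delta.
have -> : (fun y => \sum_(j < n) f y 0 j *: delta_mx 0 j) =
    \sum_(j < n) (fun y => f y 0 j *: (delta_mx 0 j : 'rV[R]_n)).
  by apply/funext => y; rewrite fct_sumE.
by apply: differentiable_sum => j; exact: differentiableZl.
Qed.

Lemma derive_coord n (f : 'rV[R]_m -> 'rV[R]_n) x v j : differentiable f x ->
  'D_v (fun y => f y 0 j) x = ('D_v f x) 0 j.
Proof. by move=> df; rewrite derive_mx ?mxE//; exact: diff_derivable. Qed.

Lemma continuous_rowP n (f : 'rV[R]_m -> 'rV[R]_n) x :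
  {for x, continuous f} <-> forall j, {for x, continuous (fun y => f y 0 j)}.
Proof.
split=> [cf j|cf].
  exact: (@continuous_comp _ _ _ f (fun M : 'rV[R]_n => M 0 j) x cf
    (@coord_continuous _ _ _ 0 j _)).
move=> A /nbhs_ballP[e /= e0 eA].
have H : \forall y \near x, forall j, ball (f x 0 j) e (f y 0 j).
  apply: (@filter_forall _ _ (fun j y => ball (f x 0 j) e (f y 0 j)) (nbhs x)).
  move=> j; exact: (cf j _ (nbhsx_ballx _ _ e0)).
by apply: filterS H => y fy; apply: eA; split=> // i j; rewrite (ord1 i).
Qed.

Lemma CkW_rowP n k U (f : 'rV[R]_m -> 'rV[R]_n) : open U ->
  CkW k U f <-> forall j, CkW k U (fun y => f y 0 j).
Proof.
move=> oU; elim: k f => [|k IH] f.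
  split=> [cf j x Ux|cf x Ux].
    by move/continuous_rowP: (cf x Ux); exact.
  by apply/continuous_rowP => j; exact: cf.
split=> [[df Df] j|Cf].
  split=> [x /df/differentiable_rowP//|v].
  move/IH : (Df v) => /(_ j); apply: eq_CkW => // x Ux.
  by rewrite derive_coord//; exact: df.
have df x : U x -> differentiable f x.
  by move=> Ux; apply/differentiable_rowP => j; have [df _] := Cf j; exact: df.
split=> // v; apply/IH => j.
have [_ /(_ v)] := Cf j; apply: eq_CkW => // x Ux.
by rewrite derive_coord//; exact: df.
Qed.

End Ck_calculus.

(** The chain rule writes the derivative as a sum over the coordinates of [f] of products with
    partial derivatives of [g] along [f]. Those partial derivatives are again scalar functions one
    order lower, so the induction closes. *)
Lemma CkW_comp (R : realType) m n k (U : set 'rV[R]_m) (V : set 'rV[R]_n)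
    (f : 'rV[R]_m -> 'rV[R]_n) (g : 'rV[R]_n -> R) :
  open U -> open V -> (forall x, U x -> V (f x)) ->
  CkW k U f -> CkW k V g -> CkW k U (g \o f).
Proof.
move=> oU oV UV; elim: k g => [|k IH] g.
  move=> cf cg x Ux; apply: continuous_comp; first exact: cf.
  by apply: cg; exact: UV.
move=> Cf; have [df Df] := Cf => -[dg Dg]; split=> [x Ux|v].
  by apply: differentiable_comp; [exact: df|apply: dg; exact: UV].
have C j : CkW k U (fun x => ('D_v f x) 0 j * 'D_(delta_mx 0 j) g (f x)).
  apply: CkWM => //; first by move/CkW_rowP: (Df v); exact.
  exact: IH (CkWS Cf) (Dg _).
apply: eq_CkW (CkW_sum (index_enum 'I_n) oU C) => // x Ux.
have dgx := dg _ (UV _ Ux).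
have dfx := df _ Ux.
rewrite [RHS]deriveE; last exact: differentiable_comp dfx dgx.
rewrite diff_comp//= -(deriveE v dfx).
rewrite {2}(row_sum_delta ('D_v f x)) linear_sum.
by apply: eq_bigr => j _; rewrite linearZ /= -deriveE.
Qed.

(** Makes row vectors a complete normed module, as the contraction principle in [f_onto]
    requires. *)
HB.instance Definition _ (R : realType) (m n : nat) := Complete.on 'M[R]_(m, n).

Lemma near_open (T : topologicalType) (x : T) (P : set T) :
  (\forall y \near x, P y) -> exists2 V, open_nbhs x V & forall y, V y -> P y.
Proof. by rewrite /prop_near1 nbhsE => -[V oV VP]; exists V. Qed.

(** * Germs of smooth maps between coordinate spaces *)

Section Cinf_at.
Variables (R : realType) (m : nat).

(** One neighbourhood serves all orders, which makes the property hold at all nearby points as well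
    ([Cinf_at_near]). *)
Definition Cinf_at (W : normedModType R) (f : 'rV[R]_m -> W) x :=
  exists2 U : set 'rV[R]_m, open_nbhs x U & forall k, CkW k U f.

Section codomain.
Variable W : normedModType R.
Implicit Types f g : 'rV[R]_m -> W.

Lemma Cinf_at_differentiable f x : Cinf_at f x -> differentiable f x.
Proof. by move=> [U [_ Ux] /(_ 1%N)[dU _]]; exact: dU. Qed.

Lemma Cinf_at_continuous f x : Cinf_at f x -> {for x, continuous f}.
Proof. by move=> /Cinf_at_differentiable/differentiable_continuous. Qed.

Lemma Cinf_at_near f x : Cinf_at f x -> \forall y \near x, Cinf_at f y.
Proof.
move=> [U oU CU]; apply: filterS (open_nbhs_nbhs oU) => y Uy.
by exists U => //; split=> //; case: oU.
Qed.

Lemma eq_Cinf_at f g x :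
  (\forall y \near x, f y = g y) -> Cinf_at f x -> Cinf_at g x.
Proof.
move=> fg [U [oU Ux] CU].
have [V [oV Vx] VE] : exists2 V, open_nbhs x V & forall y, V y -> f y = g y.
  exact: near_open fg.
exists (U `&` V); first by split; [exact: openI|split].
move=> k; apply: (@eq_CkW _ _ _ _ _ f) => [|y [_ /VE]//|].
  exact: openI.
exact: sub_CkW (CU k).
Qed.

Lemma Cinf_at_cst (w : W) x : Cinf_at (fun=> w) x.
Proof. by exists setT; [split=> //; exact: openT|move=> k; exact: CkW_cst]. Qed.

Lemma Cinf_atD f g x : Cinf_at f x -> Cinf_at g x ->
  Cinf_at (fun y => f y + g y) x.
Proof.
move=> [U [oU Ux] CU] [V [oV Vx] CV].
exists (U `&` V); first by split; [exact: openI|split].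
move=> k; apply: CkWD; first exact: openI.
  exact: sub_CkW (CU k).
exact: sub_CkW (CV k).
Qed.

Lemma Cinf_at_derive f x v : Cinf_at f x -> Cinf_at (fun y => 'D_v f y) x.
Proof. by move=> [U oU CU]; exists U => // k; have [_ D] := CU k.+1; exact: D. Qed.

(** Derivatives are taken in the whole space, so [CkW] is a conjunction of conditions at single
    points and may be checked with a different set [V] at each of them. *)
Lemma CkW_pointwise k (U : set 'rV[R]_m) f :
  (forall x, U x -> exists2 V : set 'rV[R]_m, V x & CkW k V f) -> CkW k U f.
Proof.
elim: k f => [|k IH] f UV /=.
  by move=> x Ux; have [V Vx CV] := UV x Ux; exact: CV.
split=> [x Ux|v]; first by have [V Vx [dV _]] := UV x Ux; exact: dV.
by apply: IH => x Ux; have [V Vx [_ DV]] := UV x Ux; exists V => //; exact: DV.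
Qed.

End codomain.

Lemma Cinf_at_rowP n (f : 'rV[R]_m -> 'rV[R]_n) x :
  Cinf_at f x <-> forall j, Cinf_at (fun y => f y 0 j) x.
Proof.
split=> [[U oU CU] j|Cf].
  exists U => // k; have [oU' _] := oU.
  by have /(CkW_rowP _ _ oU') := CU k; exact.
pose P j (y : 'rV[R]_m) := exists2 U : set 'rV[R]_m, open_nbhs y U &
  forall k, CkW k U (fun y => f y 0 j).
have : \forall y \near x, forall j, P j y.
  apply: (@filter_forall _ _ P (nbhs x)) => j; exact: (Cinf_at_near (Cf j)).
move=> /near_open[U oU UP]; exists U => // k.
have [oU' _] := oU; apply/CkW_rowP => // j; apply: CkW_pointwise => y Uy.
by have [V [_ Vy] VC] := UP y Uy j; exists V.
Qed.

Lemma Cinf_at_coord i x : Cinf_at (fun y : 'rV[R]_m => y 0 i) x.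
Proof.
exists setT; first by split=> //; exact: openT.
case=> [|k] /=; first by move=> y _; exact: (@coord_continuous _ _ _ 0 i).
split=> [y _|v]; first exact: (@differentiable_coord _ 1 m y 0 i).
have -> : (fun x => 'D_v (fun y : 'rV[R]_m => y 0 i) x) = fun=> v 0 i.
  apply/funext => y; have dy := @differentiable_coord _ 1 m y 0 i.
  by rewrite (@derive_coord _ _ _ id y v i) ?derive_id.
exact: CkW_cst.
Qed.

Lemma Cinf_at_id x : Cinf_at (id : 'rV[R]_m -> 'rV[R]_m) x.
Proof. by apply/Cinf_at_rowP => j; exact: Cinf_at_coord. Qed.

Lemma CinftyP n (U : set 'rV[R]_m) (f : 'rV[R]_m -> 'rV[R]_n) :
  (forall x, U x -> Cinf_at f x) -> Cinfty U f.
Proof.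
move=> Cf k; apply/CkWE; apply: CkW_pointwise => x /Cf[V [_ Vx] CV].
by exists V.
Qed.

Lemma Cinfty_at n (U : set 'rV[R]_m) (f : 'rV[R]_m -> 'rV[R]_n) x :
  open U -> U x -> Cinfty U f -> Cinf_at f x.
Proof. by move=> oU Ux Cf; exists U => // k; apply/CkWE. Qed.

End Cinf_at.

Lemma Cinf_at_comp (R : realType) m n p (f : 'rV[R]_m -> 'rV[R]_n)
    (g : 'rV[R]_n -> 'rV[R]_p) x :
  Cinf_at f x -> Cinf_at g (f x) -> Cinf_at (g \o f) x.
Proof.
move=> Cf [V [oV Vfx] CV].
have [U [oU Ux] UC] : exists2 U, open_nbhs x U &
    forall y, U y -> V (f y) /\ Cinf_at f y.
  have : \forall y \near x, V (f y) /\ Cinf_at f y.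
    apply: filterI; last exact: Cinf_at_near.
    exact: (Cinf_at_continuous Cf (open_nbhs_nbhs (conj oV Vfx))).
  by move=> /near_open.
exists U => // k; apply/CkW_rowP => // j.
apply: (@CkW_comp _ _ _ _ _ V f (fun y => g y 0 j)) => //.
- by move=> y /UC[].
- by apply: CkW_pointwise => y /UC[_ [W [_ Wy] CW]]; exists W.
- by have /(CkW_rowP _ _ oV) := CV k; exact.
Qed.

Lemma Cinf_at_mulmx (R : realType) m n p (f : 'rV[R]_m -> 'rV[R]_n)
    (A : 'M[R]_(n, p)) x :
  Cinf_at f x -> Cinf_at (fun y => f y *m A) x.
Proof.
move=> Cf; apply: (@Cinf_at_comp _ _ _ _ f (mulmx^~ A)) => //.
apply/Cinf_at_rowP => j; exists setT; first by split=> //; exact: openT.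
move=> k; have := @CkW_sum _ _ _ _ (index_enum 'I_n)
  (fun i (y : 'rV[R]_n) => y 0 i * A i j) k setT openT.
have -> : (fun y : 'rV[R]_n => \sum_i y 0 i * A i j) =
   fun y => (y *m A) 0 j by apply/funext => y; rewrite mxE.
apply => i; apply: CkWM; [exact: openT| |exact: CkW_cst].
have [V _ CV] := Cinf_at_coord i (f x); apply: CkW_pointwise => y _.
by have [V' [_ V'y] CV'] := Cinf_at_coord i y; exists V'.
Qed.

Section Cinf_at_combinations.
Variables (R : realType) (m : nat).

Lemma Cinf_at_linear n (f : {linear 'rV[R]_m -> 'rV[R]_n}) x : Cinf_at f x.
Proof.
have -> : (f : 'rV[R]_m -> _) = fun y => y *m lin1_mx f.
  by apply/funext => y; rewrite mul_rV_lin1.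
by apply: Cinf_at_mulmx; exact: Cinf_at_id.
Qed.

Lemma linear_rV_continuous n (f : {linear 'rV[R]_m -> 'rV[R]_n}) : continuous f.
Proof. by move=> x; exact: Cinf_at_continuous (Cinf_at_linear f x). Qed.

Lemma Cinf_atB n (f g : 'rV[R]_m -> 'rV[R]_n) x :
  Cinf_at f x -> Cinf_at g x -> Cinf_at (fun y => f y - g y) x.
Proof.
move=> Cf Cg; apply: Cinf_atD => //.
have -> : (fun y => - g y) = (fun y => g y *m (- 1%:M)).
  by apply/funext => y; rewrite mulmxN mulmx1.
exact: Cinf_at_mulmx.
Qed.

Lemma Cinf_at_row_mx n p (f : 'rV[R]_m -> 'rV[R]_n) (g : 'rV[R]_m -> 'rV[R]_p) x :
  Cinf_at f x -> Cinf_at g x -> Cinf_at (fun y => row_mx (f y) (g y)) x.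
Proof.
move=> /Cinf_at_rowP Cf /Cinf_at_rowP Cg; apply/Cinf_at_rowP => j.
case: (fintype.splitP j) => k jk.
  have -> : j = lshift p k by exact: val_inj.
  by under eq_fun do rewrite row_mxEl; exact: Cf.
have -> : j = rshift n k by exact: val_inj.
by under eq_fun do rewrite row_mxEr; exact: Cg.
Qed.

Lemma Cinf_at_lsubmx n p (f : 'rV[R]_m -> 'rV[R]_(n + p)) x :
  Cinf_at f x -> Cinf_at (fun y => lsubmx (f y)) x.
Proof.
move=> /Cinf_at_rowP Cf; apply/Cinf_at_rowP => j.
by under eq_fun do rewrite mxE; exact: Cf.
Qed.

Lemma Cinf_at_rsubmx n p (f : 'rV[R]_m -> 'rV[R]_(n + p)) x :
  Cinf_at f x -> Cinf_at (fun y => rsubmx (f y)) x.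
Proof.
move=> /Cinf_at_rowP Cf; apply/Cinf_at_rowP => j.
by under eq_fun do rewrite mxE; exact: Cf.
Qed.

End Cinf_at_combinations.

(** * The inverse function theorem *)

Section matrix_functions.
Variables (R : realType) (m : nat).

Lemma CkW_det n k (U : set 'rV[R]_m) (M : 'rV[R]_m -> 'M[R]_n) : open U ->
  (forall i j, CkW k U (fun x => M x i j)) -> CkW k U (fun x => \det (M x)).
Proof.
move=> oU CM; apply: CkW_sum => // s; apply: CkWM => //; first exact: CkW_cst.
by apply: CkW_prod => // i; exact: CM.
Qed.

(** By Cramer's rule each entry is a cofactor divided by the determinant. *)
Lemma CkW_invmx n k (U : set 'rV[R]_m) (M : 'rV[R]_m -> 'M[R]_n) : open U ->
  (forall x, U x -> M x \in unitmx) ->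
  (forall i j, CkW k U (fun x => M x i j)) ->
  forall i j, CkW k U (fun x => invmx (M x) i j).
Proof.
move=> oU uM CM i j.
have C : CkW k U (fun x => (\det (M x))^-1 * cofactor (M x) j i).
  apply: CkWM => //.
    apply: CkWV => //; last exact: CkW_det.
    by move=> x /uM; rewrite unitmxE unitfE.
  rewrite /cofactor; apply: CkWM => //; first exact: CkW_cst.
  apply: CkW_det => // a b.
  by apply: eq_CkW (CM (lift j a) (lift i b)) => // x _; rewrite !mxE.
by apply: eq_CkW C => // x /uM uMx; rewrite /invmx uMx !mxE.
Qed.

End matrix_functions.

(** * Norm estimates and the mean value inequality *)

Section norms.
Variable R : realType.

Lemma normr_coord m (x : 'rV[R]_m) i : `|x 0 i| <= `|x|.
Proof.
rewrite [leRHS]/Num.Def.normr /= mx_normrE.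
exact: (le_bigmax _ (fun ij => `|x ij.1 ij.2|) (0, i)).
Qed.

Lemma normr_rV_le m (x : 'rV[R]_m) (c : R) : 0 <= c ->
  (forall i, `|x 0 i| <= c) -> `|x| <= c.
Proof.
move=> c0 xc; rewrite [leLHS]/Num.Def.normr /= mx_normrE.
by apply: bigmax_le => // -[i j] _; rewrite (ord1 i); exact: xc.
Qed.

Lemma mulmx_bounded m n (A : 'M[R]_(m, n)) :
  exists2 C : R, 0 < C & forall x : 'rV_m, `|x *m A| <= C * `|x|.
Proof.
exists (\sum_i `|row i A| + 1) => [|x].
  by apply: ltr_wpDl => //; apply: sumr_ge0.
rewrite mulmx_sum_row (le_trans (ler_norm_sum _ _ _))// mulrDl mul1r mulr_suml.
apply: ler_wpDr => //; apply: ler_sum => i _; rewrite normrZ mulrC.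
by apply: ler_wpM2l => //; exact: normr_coord.
Qed.

(** The norm of a row is the maximum of its coordinates, so the one-variable mean value theorem
    along the segment from [y] to [x], applied to each coordinate separately, gives the bound
    without loss. *)
Lemma mean_value m n (f : 'rV[R]_m -> 'rV[R]_n) p r C : 0 <= C ->
  (forall x, ball p r x -> differentiable f x) ->
  (forall x v, ball p r x -> `|'d f x v| <= C * `|v|) ->
  forall x y, ball p r x -> ball p r y -> `|f x - f y| <= C * `|x - y|.
Proof.
move=> C0 df dfC x y px py.
apply: normr_rV_le => [|j]; first by rewrite mulr_ge0.
pose l (t : R) := y + t *: (x - y).
have lB (t : R) : 0 <= t <= 1 -> ball p r (l t).
  move=> /andP[t0 t1]; move: px py; rewrite -!ball_normE /ball_ /= => px py.
  have -> : p - l t = t *: (p - x) + (1 - t) *: (p - y).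
    apply/rowP => i; rewrite !mxE; ring.
  have t10 : 0 <= 1 - t by rewrite subr_ge0.
  have /le_lt_trans : `|t *: (p - x) + (1 - t) *: (p - y)| <=
      t * `|p - x| + (1 - t) * `|p - y|.
    by rewrite (le_trans (ler_normD _ _))// !normrZ !ger0_norm.
  (* The ball is open and a strict inequality is needed; at [t = 1] the strictness comes from [x]
     alone, otherwise the term of [y] has a positive coefficient. *)
  apply; have [-> |t1'] := eqVneq t 1; first by rewrite subrr mul0r addr0 mul1r.
  have lt1 : 0 < 1 - t by rewrite subr_gt0 lt_neqAle t1'.
  have -> : r = t * r + (1 - t) * r by ring.
  by rewrite ler_ltD// ?ler_wpM2l ?ltr_pM2l// ltW.
have dl (t : R) : is_diff t l (fun h : R => h *: (x - y)).
  have D1 : is_diff t (cst y) (0 : R -> 'rV[R]_m) by exact: is_diff_cst.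
  have D2 : is_diff t ( *:%R^~ (x - y)) ( *:%R^~ (x - y)).
    exact: is_diff_scalel.
  apply: (is_diff_eq (is_diffD D1 D2)).
  by apply/funext => h /=; rewrite !fctE add0r.
pose phi (t : R) := f (l t) 0 j.
have dphi (t : R) : 0 <= t <= 1 -> is_derive t 1 phi ('d f (l t) (x - y) 0 j).
  move=> t01; have dft := df _ (lB t t01).
  have dfl : differentiable (f \o l) t by exact: differentiable_comp.
  have dphi : differentiable phi t.
    exact: (@differentiable_comp _ _ _ _ (f \o l) (fun M : 'rV[R]_n => M 0 j) t
      dfl (differentiable_coord _ _ _)).
  apply: DeriveDef; first exact: diff_derivable.
  rewrite (_ : phi = fun t => (f \o l) t 0 j)//.
  have dfl1 : derivable (f \o l) t 1 by exact: diff_derivable.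
  have := derive_mx dfl1 => /matrixP/(_ 0 j).
  rewrite mxE => <-; rewrite deriveE// diff_comp// /= diff_val.
  by rewrite scale1r.
have cphi : {within `[0, 1], continuous phi}.
  apply: derivable_within_continuous => t; rewrite in_itv /= => t01.
  by have [] := dphi t t01.
have dphi' (t : R) : t \in `]0, 1[%R -> is_derive t 1 phi ('d f (l t) (x - y) 0 j).
  by rewrite in_itv /= => /andP[t0 t1]; apply: dphi; rewrite !ltW.
have [c + fE] := MVT_segment ler01 dphi' cphi; rewrite in_itv /= => c01.
have -> : (f x - f y) 0 j = phi 1 - phi 0.
  by rewrite /phi /l scale1r scale0r addr0 [y + _]addrC subrK !mxE.
rewrite fE subr0 mulr1.
by apply: le_trans (dfC _ _ (lB c _)); [exact: normr_coord|].
Qed.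

Lemma differentiable_eps (V W : normedModType R) (f : V -> W)
    (L : {linear V -> W}) x : continuous L ->
  (forall e, 0 < e -> \forall h \near (0 : V), `|f (h + x) - f x - L h| <= e * `|h|) ->
  differentiable f x /\ 'd f x = L :> (V -> W).
Proof.
move=> cL fL.
have H : f \o shift x = cst (f x) + L +o_ (0 : V) id.
  apply/eqaddoP => e e0; apply: filterS (fL e e0) => h.
  by rewrite !fctE /= opprD addrA.
have E := diff_unique cL H.
by split=> //; apply/diff_locallyP; rewrite E.
Qed.

End norms.

Section inverse_function.
Variables (R : realType) (n : nat) (f : 'rV[R]_n -> 'rV[R]_n) (p : 'rV[R]_n).
Hypothesis Cf : Cinf_at f p.
Hypothesis dfp : forall v, 'd f p v = v.

Let diff_near_id : exists2 r, 0 < r & forall x, ball p r x ->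
  Cinf_at f x /\ forall v, `|'d f x v - v| <= 2^-1 * `|v|.
Proof.
(* The difference between ['d f x v] and [v] is a sum of [n] terms of size at most [e] times the
   norm of [v]; this [e] makes the total at most one half, and [n.+1] covers [n = 0]. *)
pose e : R := (n.+1%:R *+ 2)^-1.
have e0 : 0 < e by rewrite invr_gt0 pmulrn_lgt0.
have D : \forall x \near p, forall i,
    ball ('D_(delta_mx 0 i) f p) e ('D_(delta_mx 0 i) f x).
  apply: (@filter_forall _ _ (fun i x => ball ('D_(delta_mx 0 i) f p) e
    ('D_(delta_mx 0 i) f x)) (nbhs p)) => i.
  exact: (Cinf_at_continuous (Cinf_at_derive (delta_mx 0 i) Cf)
    (nbhsx_ballx _ _ e0)).
have : \forall x \near p, Cinf_at f x /\ forall i,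
    ball ('D_(delta_mx 0 i) f p) e ('D_(delta_mx 0 i) f x).
  by apply: filterI D; exact: Cinf_at_near.
move=> /nbhs_ballP[r /= r0 rP]; exists r => // x /rP[Cx xe]; split=> // v.
have dx := Cinf_at_differentiable Cx.
have dp := Cinf_at_differentiable Cf.
have -> : 'd f x v - v =
    \sum_i v 0 i *: ('D_(delta_mx 0 i) f x - 'D_(delta_mx 0 i) f p).
  have vE := row_sum_delta v.
  transitivity (\sum_i v 0 i *: 'd f x (delta_mx 0 i) -
      \sum_i v 0 i *: delta_mx 0 i).
    congr (_ - _); last exact: vE.
    by rewrite {1}vE linear_sum; apply: eq_bigr => i _; rewrite linearZ.
  rewrite -sumrB; apply: eq_bigr => i _; rewrite -scalerBr.
  congr (_ *: (_ - _)); first exact: esym (deriveE _ dx).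
  exact: esym (etrans (deriveE _ dp) (dfp _)).
apply: (le_trans (ler_norm_sum _ _ _)).
apply: (@le_trans _ _ (\sum_(i < n) `|v| * e)).
  apply: ler_sum => i _; rewrite normrZ ler_pM//; first exact: normr_coord.
  move: (xe i); move: ('D_(_) f p) ('D_(_) f x) => a b.
  by rewrite -ball_normE /ball_ /= distrC => /ltW.
rewrite sumr_const card_ord -mulrnAr mulrC.
apply: ler_wpM2r => //; rewrite /e -mulr_natl -[_ *+ 2]mulr_natl invfM mulrCA.
by rewrite -[leRHS]mulr1 ler_pM2l ?invr_gt0// ler_pdivrMr// mul1r ler_nat.
Qed.

(** The map [x - f x] contracts by one half. Hence [f] shrinks distances by at most a factor 2,
    which gives injectivity and a Lipschitz inverse. *)
Let f_expands r : (forall x, ball p r x ->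
  Cinf_at f x /\ forall v, `|'d f x v - v| <= 2^-1 * `|v|) ->
  forall x y, ball p r x -> ball p r y ->
    `|(x - f x) - (y - f y)| <= 2^-1 * `|x - y|.
Proof.
move=> rP.
apply: (@mean_value R n n (fun x => x - f x)) => [|x px|x v px].
- by rewrite invr_ge0.
- apply: differentiableB => //.
  by have [/Cinf_at_differentiable] := rP x px.
- have [/Cinf_at_differentiable dx dv] := rP x px.
  have idf := differentiableP dx.
  have [_ /(congr1 (@^~ v)) E] : is_diff x (id - f)
      ((id : 'rV[R]_n -> 'rV[R]_n) - ('d f x : 'rV[R]_n -> 'rV[R]_n)).
    exact: is_diffB.
  have {}E : 'd (fun x => x - f x) x v = v - 'd f x v := E.
  by rewrite E -normrN opprB.
Qed.

(** A solution of [f x = y] is a fixed point of [x - f x + y]. This map contracts by one half and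
    moves [x0] by at most half of [s], so it preserves the closed ball of radius [s]. *)
Let f_onto r : (forall x y, ball p r x -> ball p r y ->
    `|(x - f x) - (y - f y)| <= 2^-1 * `|x - y|) ->
  forall x0 s y, 0 < s -> (forall x, `|x - x0| <= s -> ball p r x) ->
    `|y - f x0| <= 2^-1 * s -> exists2 x, `|x - x0| <= s & f x = y.
Proof.
move=> rP x0 s y s0 sr ys.
pose B : set 'rV[R]_n := [set x | `|x - x0| <= s].
pose T x := (x - f x) + y.
have TB : {homo T : x / B x >-> B x}.
  move=> x /= Bx; rewrite /T /B /=.
  have -> : x - f x + y - x0 = ((x - f x) - (x0 - f x0)) + (y - f x0).
    by apply/rowP => i; rewrite !mxE; ring.
  rewrite (le_trans (ler_normD _ _))// [leRHS](splitr s) lerD//; last first.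
    by rewrite mulrC.
  apply: (le_trans (rP _ _ (sr _ Bx) (sr _ _))).
    by rewrite subrr normr0 ltW.
  by rewrite [leRHS]mulrC ler_pM2l.
pose F : {fun B >-> B} := HB.pack T (isFun.Build _ _ B B T TB).
have ctr : is_contraction F.
  exists (NngNum (@ltW _ _ 0 (2^-1 : R) ltac:(by rewrite invr_gt0))).
  split=> /=; first by rewrite invf_lt1// ltr1n.
  move=> [x z] [/= Bx Bz]; rewrite /T.
  have -> : x - f x + y - (z - f z + y) = (x - f x) - (z - f z).
    by apply/rowP => i; rewrite !mxE; ring.
  by apply: rP; exact: sr.
have clB : closed B.
  have -> : B = closed_ball_ Num.norm x0 s.
    by apply/seteqP; split=> x; rewrite /B /closed_ball_ /= distrC.
  exact: closed_closed_ball_.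
have B0 : B !=set0 by exists x0; rewrite /B /= subrr normr0 ltW.
have [x Bx] := banach_fixed_point ctr clB B0.
rewrite /= /T => xE; exists x => //.
by apply/rowP => i; move/rowP: xE => /(_ i); rewrite !mxE => H; lra.
Qed.

Theorem inverse_function : exists (V : set 'rV[R]_n) (g : 'rV[R]_n -> 'rV[R]_n),
  [/\ open_nbhs p V, open (f @` V), forall x, V x -> g (f x) = x,
      forall x, V x -> Cinf_at f x & forall y, (f @` V) y -> Cinf_at g y].
Proof.
have [r r0 rP] := diff_near_id; pose V := ball p r.
have exp := f_expands rP; have onto := f_onto exp.
have oV : open V by exact: ball_open.
have exp2 x y : V x -> V y -> `|x - y| <= 2 * `|f x - f y|.
  move=> Vx Vy; have := exp x y Vx Vy.
  have : `|x - y| <= `|(x - f x) - (y - f y)| + `|f x - f y|.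
    apply: le_trans (ler_normD _ _); rewrite le_eqVlt; apply/orP; left.
    by apply/eqP; congr (`|_|); apply/rowP => i; rewrite !mxE; ring.
  by move: (`|x - y|) (`|x - f x - _|) (`|f x - f y|) => a b c; lra.
pose g y := xget p [set x | V x /\ f x = y].
have gK x : V x -> g (f x) = x.
  move=> Vx; rewrite /g; case: xgetP => [z _ [Vz fz]|/(_ x)]; last by case.
  have := exp2 z x Vz Vx; rewrite fz subrr normr0 mulr0 normr_le0 subr_eq0.
  by move/eqP.
have ofV : open (f @` V).
  rewrite openE => _ [x0 Vx0 <-].
  have /nbhs_ballP[s /= s0 sV] : nbhs x0 V by apply: open_nbhs_nbhs.
  have s20 : 0 < s / 2 by rewrite divr_gt0.
  (* One halving puts a closed ball inside [V]; the other is the factor lost in [f_onto]. *)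
  apply/nbhs_ballP; exists (s / 2 / 2); first by rewrite /= divr_gt0.
  move=> y; rewrite -ball_normE /ball_ /= distrC => ys.
  have sub x : `|x - x0| <= s / 2 -> V x.
    move=> xs; apply: sV; rewrite -ball_normE /ball_ /= distrC.
    by apply: (le_lt_trans xs); rewrite ltr_pdivrMr// ltr_pMr// ltr1n.
  have ys' : `|y - f x0| <= 2^-1 * (s / 2) by rewrite mulrC ltW.
  by have [x /sub Vx xy] := onto x0 (s / 2) y s20 sub ys'; exists x.
have gV y : (f @` V) y -> V (g y) /\ f (g y) = y.
  by move=> [x Vx <-]; rewrite gK.
have gL y z : (f @` V) y -> (f @` V) z -> `|g y - g z| <= 2 * `|y - z|.
  by move=> /gV[Vy {2}<-] /gV[Vz {2}<-]; exact: exp2.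
(* The derivative is within one half of the identity, so a vector that it kills has norm at most
   half its own norm. *)
have uJ x : V x -> 'J f x \in unitmx.
  move=> Vx; rewrite -row_free_unit -kermx_eq0; apply/eqP/row_matrixP => i.
  have : row i (kermx ('J f x)) *m 'J f x = 0.
    by apply/sub_kermxP; exact: row_sub.
  rewrite row0; move: (row i _) => v; rewrite mul_rV_lin1 => dv.
  have [_ /(_ v)] := rP x Vx; rewrite dv sub0r normrN => H.
  by apply/eqP; rewrite -normr_le0; move: H; move: (`|v|) => a; lra.
have dg y : (f @` V) y ->
    differentiable g y /\ forall v, 'd g y v = v *m invmx ('J f (g y)).
  move=> fVy; have [Vg fg] := gV y fVy; set x := g y in Vg fg *.
  pose A := invmx ('J f x); pose L : {linear 'rV[R]_n -> 'rV[R]_n} := mulmxr A.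
  have [C C0 AC] := mulmx_bounded A.
  have dfx := Cinf_at_differentiable (rP x Vg).1.
  suff [dgy dgE] : differentiable g y /\ 'd g y = L :> ('rV[R]_n -> 'rV[R]_n).
    by split=> [|v]; [exact: dgy|exact: (congr1 (@^~ v) dgE)].
  apply: differentiable_eps; first exact: linear_rV_continuous.
  (* The remainder of [g] at [h] is minus the remainder of [f] at the increment [k] of [g],
     multiplied by [A]. Here [C] bounds [A] and 2 is the Lipschitz constant of [g]. *)
  move=> e e0; pose e' := e / (C * 2).
  have e'0 : 0 < e' by rewrite divr_gt0// mulr_gt0.
  have /eqaddoP /(_ e' e'0) nf := diff_locally dfx.
  have nfV : \forall h \near (0 : 'rV[R]_n), (f @` V) (h + y).
    have : \forall z \near y, (f @` V) z by exact: open_nbhs_nbhs.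
    by rewrite (near_shift 0) subr0.
  move: nf => /nbhs_ballP[d /= d0 dP].
  have hd : \forall h \near (0 : 'rV[R]_n), `|h| < 2^-1 * d.
    by apply: nbhs0_lt; rewrite mulr_gt0// invr_gt0.
  apply: filterS2 nfV hd => h fh hd.
  have gh := gL _ _ fh fVy; rewrite addrK -/x in gh.
  have : ball (0 : 'rV[R]_n) d (g (h + y) - x).
    rewrite -ball_normE /ball_ /= sub0r normrN; apply: (le_lt_trans gh).
    by rewrite -ltr_pdivlMl.
  move=> /dP /=.
  rewrite !fctE /= subrK (gV _ fh).2 fg => Hk.
  set k := g (h + y) - x in Hk gh *.
  have -> : k - h *m A = - ((h + y - (y + 'd f x k)) *m A).
    have kE : k = 'd f x k *m A.
      by rewrite -mul_rV_lin1 -mulmxA mulmxV ?mulmx1//; exact: uJ.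
    rewrite {1}kE -mulmxBl -mulNmx; congr (_ *m A).
    by apply/rowP => i; rewrite !mxE; ring.
  rewrite normrN (le_trans (AC _))//.
  apply: (@le_trans _ _ (C * (e' * (2 * `|h|)))).
    rewrite ler_pM2l// (le_trans Hk)// ler_pM2l//.
  rewrite /e' le_eqVlt; apply/orP; left; apply/eqP; field.
  by rewrite gt_eqF.
(* Bootstrap: the derivative of [g] is the inverse Jacobian of [f] evaluated along [g], so it is as
   regular as [g], and [g] gains one order at each turn. *)
have Cg k : CkW k (f @` V) g.
  elim: k => [|k IH].
    by move=> y /dg[/differentiable_continuous].
  split=> [y /dg[]//|v]; apply/CkW_rowP => // j.
  have C : CkW k (f @` V)
      (fun y => \sum_i v 0 i * invmx ('J f (g y)) i j).
    apply: CkW_sum => // i; apply: CkWM => //; first exact: CkW_cst.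
    apply: CkW_invmx => // [y /gV[Vg _]|a b]; first exact: uJ.
    apply: (@CkW_comp _ _ _ _ (f @` V) V g (fun x => 'J f x a b)) => //.
      by move=> y /gV[].
    have CV : CkW k V (fun x => ('D_(delta_mx 0 a) f x) 0 b).
      apply: CkW_pointwise => x Vx.
      have /Cinf_at_rowP/(_ b)[W [_ Wx] CW] :=
        Cinf_at_derive (delta_mx 0 a) (rP x Vx).1.
      by exists W.
    apply: eq_CkW CV => // x Vx.
    by rewrite deriveE ?mxE//; exact: Cinf_at_differentiable (rP x Vx).1.
  apply: eq_CkW C => // y /dg[dgy dE].
  by rewrite deriveE// dE mxE.
exists V, g; split=> //; first by split=> //; exact: ballxx.
- by move=> x Vx; have [] := rP x Vx.
- by move=> y fVy; exists (f @` V).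
Unshelve. all: by end_near.
Qed.

End inverse_function.

(** * Local normal forms *)

Lemma near_continuous (S T : topologicalType) (f : S -> T) x (P : set T) :
  {for x, continuous f} -> (\forall y \near f x, P y) ->
  \forall z \near x, P (f z).
Proof. by move=> cf; exact: cf. Qed.

(** Smoothness and the value of the Jacobian are carried together, so that a single chain of rules
    establishes both for a composite expression. *)
Definition smooth_jac (R : realType) m n (f : 'rV[R]_m -> 'rV[R]_n) x A :=
  Cinf_at f x /\ 'J f x = A.

Section smooth_jac.
Variables (R : realType) (m : nat).

Lemma jacE n (f : 'rV[R]_m -> 'rV[R]_n) x v : 'd f x v = v *m 'J f x.
Proof. by rewrite mul_rV_lin1. Qed.

Lemma smooth_jacP n (f : 'rV[R]_m -> 'rV[R]_n) x A : Cinf_at f x ->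
  (forall v, 'D_v f x = v *m A) -> smooth_jac f x A.
Proof.
move=> Cf DA; split=> //; apply/row_matrixP => i; rewrite !rowE -jacE.
apply: etrans (DA _); apply/esym/deriveE; exact: Cinf_at_differentiable.
Qed.

Lemma smooth_jacD n (f : 'rV[R]_m -> 'rV[R]_n) x A v :
  smooth_jac f x A -> 'D_v f x = v *m A.
Proof.
move=> [/Cinf_at_differentiable df <-].
by apply: etrans (jacE _ _ _); exact: deriveE.
Qed.

Lemma Cinf_at_jac n (f : 'rV[R]_m -> 'rV[R]_n) x :
  Cinf_at f x -> smooth_jac f x ('J f x).
Proof. by []. Qed.

Lemma eq_smooth_jac n (f g : 'rV[R]_m -> 'rV[R]_n) x A :
  (\forall y \near x, f y = g y) -> smooth_jac f x A -> smooth_jac g x A.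
Proof.
move=> fg fA; have Cg := eq_Cinf_at fg fA.1; apply: smooth_jacP => // v.
rewrite -(smooth_jacD v fA); apply/esym; exact: near_eq_derive.
Qed.

Lemma smooth_jac_id x : smooth_jac (id : 'rV[R]_m -> 'rV[R]_m) x 1%:M.
Proof.
apply: smooth_jacP => [|v]; first exact: Cinf_at_id.
by rewrite derive_id mulmx1.
Qed.

Lemma smooth_jac_cst n (w : 'rV[R]_n) (x : 'rV[R]_m) :
  smooth_jac (fun=> w) x 0.
Proof.
apply: smooth_jacP => [|v]; first exact: Cinf_at_cst.
by rewrite (derive_cst w x v) mulmx0.
Qed.

Section sum.
Variables (n : nat) (f g : 'rV[R]_m -> 'rV[R]_n) (x : 'rV[R]_m).
Variables A B : 'M[R]_(m, n).
Hypotheses (fA : smooth_jac f x A) (gB : smooth_jac g x B).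

Let drv v : derivable f x v /\ derivable g x v.
Proof.
by split; apply/diff_derivable/Cinf_at_differentiable; [case: fA|case: gB].
Qed.

Lemma smooth_jac_add : smooth_jac (fun y => f y + g y) x (A + B).
Proof.
apply: smooth_jacP => [|v]; first by apply: Cinf_atD; [case: fA|case: gB].
have [df dg] := drv v.
by rewrite (deriveD df dg) (smooth_jacD v fA) (smooth_jacD v gB) mulmxDr.
Qed.

Lemma smooth_jac_sub : smooth_jac (fun y => f y - g y) x (A - B).
Proof.
apply: smooth_jacP => [|v]; first by apply: Cinf_atB; [case: fA|case: gB].
have [df dg] := drv v.
by rewrite (deriveB df dg) (smooth_jacD v fA) (smooth_jacD v gB) mulmxBr.
Qed.

End sum.

Lemma smooth_jac_row_mx n p (f : 'rV[R]_m -> 'rV[R]_n)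
    (g : 'rV[R]_m -> 'rV[R]_p) x A B :
  smooth_jac f x A -> smooth_jac g x B ->
  smooth_jac (fun y => row_mx (f y) (g y)) x (row_mx A B).
Proof.
move=> fA gB; have C := Cinf_at_row_mx fA.1 gB.1.
have dC := Cinf_at_differentiable C.
apply: smooth_jacP => // v; apply/rowP => j; rewrite -derive_coord//.
case: (fintype.splitP j) => k jk.
  have -> : j = lshift p k by exact: val_inj.
  under eq_fun do rewrite row_mxEl.
  rewrite derive_coord; last exact: Cinf_at_differentiable fA.1.
  by rewrite mul_mx_row row_mxEl (smooth_jacD v fA).
have -> : j = rshift n k by exact: val_inj.
under eq_fun do rewrite row_mxEr.
rewrite derive_coord; last exact: Cinf_at_differentiable gB.1.
by rewrite mul_mx_row row_mxEr (smooth_jacD v gB).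
Qed.

End smooth_jac.

Lemma smooth_jac_comp (R : realType) m n p (f : 'rV[R]_m -> 'rV[R]_n)
    (g : 'rV[R]_n -> 'rV[R]_p) x A B :
  smooth_jac f x A -> smooth_jac g (f x) B -> smooth_jac (g \o f) x (A *m B).
Proof.
move=> fA gB; have C := Cinf_at_comp fA.1 gB.1.
split=> //; apply/row_matrixP => i; rewrite !rowE -jacE.
have dg := Cinf_at_differentiable gB.1; have df := Cinf_at_differentiable fA.1.
apply: etrans (congr1 (@^~ _) (diff_comp df dg)) _ => /=.
by rewrite jacE gB.2 jacE fA.2 mulmxA.
Qed.

Lemma smooth_jac_mulmx (R : realType) m n p (f : 'rV[R]_m -> 'rV[R]_n) x A
    (B : 'M[R]_(n, p)) :
  smooth_jac f x A -> smooth_jac (fun y => f y *m B) x (A *m B).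
Proof.
move=> fA; apply: (smooth_jac_comp (g := mulmx^~ B) fA).
have C : Cinf_at (fun y : 'rV[R]_n => y *m B) (f x).
  by apply: Cinf_at_mulmx; exact: Cinf_at_id.
split=> //; apply/row_matrixP => i; rewrite !rowE -jacE.
exact: (congr1 (@^~ _) (diff_lin (f x)
  (@linear_rV_continuous R n p (mulmxr B)))).
Qed.

Lemma inverse_function_jac (R : realType) n (f : 'rV[R]_n -> 'rV[R]_n) p :
  smooth_jac f p 1%:M -> exists (V : set 'rV[R]_n) (g : 'rV[R]_n -> 'rV[R]_n),
  [/\ open_nbhs p V, open_nbhs (f p) (f @` V), forall x, V x -> g (f x) = x,
      forall x, V x -> Cinf_at f x & forall y, (f @` V) y -> Cinf_at g y].
Proof.
move=> [Cf Jf]; have [|V [g [oV ofV gK CV Cg]]] := inverse_function Cf.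
  by move=> v; rewrite jacE Jf mulmx1.
by exists V, g; split=> //; split=> //; exists p => //; case: oV.
Qed.

Section local_normal_forms.
Variables (R : realType) (m n : nat) (f : 'rV[R]_m -> 'rV[R]_n) (p : 'rV[R]_m).
Variable L : 'M[R]_(m, n).
Hypothesis fL : smooth_jac f p L.

(* In the coordinates [straighten], [f] is the linear map [L]. *)
Definition straighten u := f u *m pinvmx L + (u - u *m (L *m pinvmx L)).

(** The first summand has derivative [L *m pinvmx L] and the second is its complement to the
    identity, whatever the rank of [L]. *)
Lemma straighten_jac : smooth_jac straighten p 1%:M.
Proof.
have := smooth_jac_add (smooth_jac_mulmx (pinvmx L) fL)
  (smooth_jac_sub (smooth_jac_id p)
    (smooth_jac_mulmx (L *m pinvmx L) (smooth_jac_id p))).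
by rewrite mul1mx addrC subrK.
Qed.

Lemma straightenM u : row_full L -> straighten u *m L = f u.
Proof.
move=> fL1; have PL := mulVpmx fL1.
rewrite /straighten; move: (pinvmx L) PL => P PL.
by rewrite mulmxDl mulmxBl -!mulmxA PL !mulmx1 subrr addr0.
Qed.

(** In the straightened coordinates [f] is [L], and multiplication by [pinvmx L] is an affine
    section; the inverse of [straighten] brings it back. *)
Lemma local_section : row_full L -> exists s : 'rV[R]_n -> 'rV[R]_m,
  [/\ Cinf_at s (f p), s (f p) = p & \forall y \near f p, f (s y) = y].
Proof.
move=> fL1; have [V [g [[oV Vp] [oW Wp] gK CV Cg]]] :=
  inverse_function_jac straighten_jac.
pose a (y : 'rV[R]_n) := straighten p + (y - f p) *m pinvmx L.
have Ca y : Cinf_at a y.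
  apply: Cinf_atD; first exact: Cinf_at_cst.
  apply/Cinf_at_mulmx/Cinf_atB; [exact: Cinf_at_id|exact: Cinf_at_cst].
have ap : a (f p) = straighten p by rewrite /a subrr mul0mx addr0.
exists (g \o a); split.
- by apply: Cinf_at_comp => //; rewrite ap; exact: Cg.
- by rewrite /= ap gK.
have : \forall y \near f p, (straighten @` V) (a y).
  apply: (Cinf_at_continuous (Ca (f p))); rewrite ap.
  exact: open_nbhs_nbhs.
apply: filterS => y [x Vx xa]; rewrite /= -xa gK// -straightenM// xa.
by rewrite mulmxDl straightenM// -mulmxA mulVpmx// mulmx1 addrC subrK.
Qed.

(** Following [f] by multiplication with [pinvmx L] gives a map with identity derivative, hence a
    local inverse. *)
Lemma local_retraction : row_free L -> exists s : 'rV[R]_n -> 'rV[R]_m,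
  Cinf_at s (f p) /\ \forall x \near p, s (f x) = x.
Proof.
move=> fL1; have PL := mulmxVp fL1.
have J : smooth_jac (fun u => f u *m pinvmx L) p 1%:M.
  by have := smooth_jac_mulmx (pinvmx L) fL; rewrite PL.
have [V [g [[oV Vp] [oW Wp] gK CV Cg]]] := inverse_function_jac J.
exists (fun y => g (y *m pinvmx L)); split.
  apply: (@Cinf_at_comp _ _ _ _ (mulmx^~ (pinvmx L)) g); last exact: Cg.
  by apply: Cinf_at_mulmx; exact: Cinf_at_id.
by apply: filterS (open_nbhs_nbhs (conj oV Vp)) => x; exact: gK.
Qed.

End local_normal_forms.

(** After straightening [f], the image of [H] lies in an affine translate of the kernel of [L], and
    the derivative of [H] is onto that kernel. Completing [H] by the directions outside the row
    space of [A] turns the claim into the inverse function theorem. *)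
Lemma onto_zero_set (R : realType) a b c (H : 'rV[R]_a -> 'rV[R]_b)
    (f : 'rV[R]_b -> 'rV[R]_c) p A L :
  smooth_jac H p A -> smooth_jac f (H p) L ->
  (\forall u \near p, f (H u) = f (H p)) -> row_full L ->
  (forall w : 'rV_b, w *m L = 0 -> (w <= A)%MS) ->
  forall U, nbhs p U ->
  \forall z \near H p, f z = f (H p) -> exists2 u, U u & H u = z.
Proof.
move=> HA fL fH fL1 kerA U nU; set q := H p in fL fH *.
have AL : A *m L = 0.
  have [_ <-] := smooth_jac_comp HA fL.
  have := smooth_jac_cst (f q) p; have fH' : \forall u \near p, f q = (f \o H) u.
    by apply: filterS fH => u /= ->.
  by move=> /(eq_smooth_jac fH') [].
have sJ := straighten_jac fL; set Psi := straighten f L in sJ.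
have [V [g [[oV Vq] [oW Wq] gK CV Cg]]] := inverse_function_jac sJ.
pose P := pinvmx A.
pose h (w : 'rV[R]_b) := p + w *m P.
have hJ : smooth_jac h 0 P.
  have := smooth_jac_add (smooth_jac_cst p (0 : 'rV[R]_b))
    (smooth_jac_mulmx P (smooth_jac_id 0)).
  by rewrite add0r mul1mx.
have h0 : h 0 = p by rewrite /h mul0mx addr0.
(* The first term moves along the image of [H] and has derivative [P *m A]; the second supplies the
   missing part of the identity. *)
pose Th (w : 'rV[R]_b) := Psi (H (h w)) + (w - w *m (P *m A)).
have ThJ : smooth_jac Th 0 1%:M.
  have HhJ : smooth_jac (H \o h) 0 (P *m A).
    by apply: smooth_jac_comp hJ _; rewrite h0.
  have PJ : smooth_jac (Psi \o (H \o h)) 0 (P *m A *m 1%:M).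
    by apply: smooth_jac_comp HhJ _; rewrite /= h0.
  have := smooth_jac_add PJ (smooth_jac_sub (smooth_jac_id 0)
    (smooth_jac_mulmx (P *m A) (smooth_jac_id 0))).
  by rewrite mulmx1 mul1mx addrC subrK.
have [V' [g' [[oV' V'0] [oW' W'0] gK' CV' Cg']]] := inverse_function_jac ThJ.
have Th0 : Th 0 = Psi q by rewrite /Th h0 mul0mx subrr addr0.
rewrite Th0 in W'0.
have cP : {for q, continuous Psi} by apply: Cinf_at_continuous; case: sJ.
have g'0 : g' (Psi q) = 0 by rewrite -Th0 gK'.
have cg' : {for Psi q, continuous g'}.
  by apply: Cinf_at_continuous; exact: Cg'.
have ch : {for 0, continuous h} by apply: Cinf_at_continuous; case: hJ.
have cH : {for p, continuous H} by apply: Cinf_at_continuous; case: HA.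
have nU' : \forall u \near p, [/\ U u, V (H u) & f (H u) = f q].
  have nV : \forall u \near p, V (H u) by apply: cH; exact: open_nbhs_nbhs.
  by apply: filterS3 nU nV fH.
have nw : \forall w \near (0 : 'rV[R]_b),
    [/\ U (h w), V (H (h w)) & f (H (h w)) = f q].
  by have := near_continuous ch; rewrite h0; move=> /(_ _ nU').
have nz : \forall z \near q,
    let w := g' (Psi z) in [/\ U (h w), V (H (h w)) & f (H (h w)) = f q].
  have := near_continuous cg'; rewrite g'0 => /(_ _ nw).
  by move=> /(near_continuous cP).
have nW' : \forall z \near q, (Th @` V') (Psi z).
  exact: (near_continuous cP (open_nbhs_nbhs (conj oW' W'0))).
have nV : \forall z \near q, V z by exact: open_nbhs_nbhs.
apply: filterS3 nz nW' nV => z /= [Uz Vz fz] [w V'w wz] zV fzq.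
move: Uz Vz fz; rewrite -wz gK' // => Uz Vz fz.
exists (h w) => //.
(* Applying [L] to [Th w = Psi z] leaves [w *m L = 0], so [w] lies in the row space of [A] and the
   completing term of [Th] vanishes: [z] comes from [H] alone. *)
have E : w *m (P *m A) = w.
  have /submxP[v ->] : (w <= A)%MS.
    apply: kerA; have /(congr1 (mulmx^~ L)) := wz.
    rewrite straightenM// fzq mulmxDl straightenM// fz mulmxBl -!mulmxA AL.
    by rewrite !mulmx0 subr0 => wL; apply: (addrI (f q)); rewrite wL addr0.
  by rewrite -mulmxA [A *m _]mulmxA mulmxKpV.
have : Psi (H (h w)) = Psi z by rewrite -wz /Th E subrr addr0.
by move=> /(congr1 g); rewrite !gK.
Qed.

Lemma locally_constant (R : realType) m n (f : 'rV[R]_m -> 'rV[R]_n) p :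
  (\forall x \near p, smooth_jac f x 0) -> \forall x \near p, f x = f p.
Proof.
move=> /nbhs_ballP[r /= r0 rP]; apply/nbhs_ballP; exists r => // x px.
apply/eqP; rewrite -subr_eq0 -normr_le0 -(mul0r `|x - p|).
apply: (mean_value _ _ _ px) => // [y /rP[+ _]|y v /rP[_ Jy]|].
- exact: Cinf_at_differentiable.
- by rewrite jacE Jy mulmx0 normr0 mul0r.
- exact: ballxx.
Qed.

(** The image of [W] under [p] has at least the dimension of [W], so [p] kills nothing in the row
    space of [W]. *)
Lemma rank_preimage_eq0 (F : fieldType) k n c r (W : 'M[F]_(k, n)) (p : 'M[F]_(n, c))
    (C : 'M[F]_(r, c)) :
  (C <= W *m p)%MS -> (\rank W <= \rank C)%N ->
  forall w : 'rV_n, (w <= W)%MS -> w *m p = 0 -> w = 0.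
Proof.
move=> CW rW w wW wp; have := mxrank_mul_ker W p.
have rC : (\rank W <= \rank (W *m p))%N by exact: leq_trans rW (mxrankS CW).
move=> H; have /eqP : \rank (W :&: kermx p)%MS = 0%N.
  by apply/eqP; rewrite -leqn0 -(leq_add2l (\rank (W *m p))) H addn0.
rewrite mxrank_eq0 => /eqP W0; apply/eqP; rewrite -submx0 -W0.
by rewrite sub_capmx wW; apply/sub_kermxP.
Qed.

(* Constant rank theorem for the restriction of [t] to the fibre of [s]
   through [p], whose tangent spaces are the kernels of the derivative of [s]. *)
Section fibre_retraction.
Variables (R : realType) (n m m' : nat).
Variables (s : 'rV[R]_n -> 'rV[R]_m) (t : 'rV[R]_n -> 'rV[R]_m').
Variables (p : 'rV[R]_n) (A : 'M[R]_(n, m)) (B : 'M[R]_(n, m')).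
Hypotheses (sA : smooth_jac s p A) (tB : smooth_jac t p B) (A1 : row_full A).
Hypothesis rank_t : \forall h \near p, s h = s p ->
  \rank (kermx ('J s h) *m ('J t h)) = \rank (kermx A *m B).

Lemma fibre_retraction : exists r : 'rV[R]_n -> 'rV[R]_n,
  [/\ Cinf_at r p, r p = p,
    \forall h \near p, s (r h) = s p /\ t (r h) = t p &
    forall v : 'rV_n, v *m A = 0 -> v *m B = 0 -> v *m ('J r p) = v].
Proof.
have := mulVpmx A1; move: (pinvmx A) => P PA.
(* [N] is the projection onto the kernel of [A] along the row space of [P]. *)
pose N : 'M[R]_n := 1%:M - A *m P.
have NA : N *m A = 0 by rewrite mulmxBl mul1mx -mulmxA PA mulmx1 subrr.
have PN : P *m N = 0 by rewrite mulmxBr mulmx1 mulmxA PA mul1mx subrr.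
have vN (v : 'rV_n) : v *m A = 0 -> v *m N = v.
  by move=> vA; rewrite mulmxBr mulmx1 mulmxA vA mul0mx subr0.
have NN : N *m N = N by rewrite {1}/N mulmxBl mul1mx -mulmxA PN mulmx0 subr0.
have kN : (N :=: kermx A)%MS.
  apply/eqmxP/andP; split; first by apply/sub_kermxP.
  by apply/row_subP => i; rewrite -(vN (row i _)) ?submxMl//; apply/sub_kermxP; exact: row_sub.
(* [C] is the derivative of [t] restricted to the kernel of [A], extended by 0 on the row space of
   [P]; [Q] is a generalized inverse of it. *)
have [C [CE NC]] : exists C : 'M[R]_(n, m'), C = N *m B /\ N *m C = C.
  by exists (N *m B); rewrite mulmxA NN.
have rC : \rank C = \rank (kermx A *m B) by rewrite CE (eqmxMr B kN).
have [Q CQ] : exists Q : 'M[R]_(m', n), C *m Q *m C = C by exists (pinvmx C); rewrite mulmxKpV.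
have BE : B - A *m (P *m B) = C by rewrite CE mulmxBl mul1mx mulmxA.
clearbody N.
have PC : P *m C = 0 by rewrite -NC mulmxA PN mul0mx.
(* [D] is the derivative at [p] of the nonlinear part of [Psi] below. Since [D] fixes [A] and [C],
   the correction [u - u *m D] makes the derivative of [Psi] the identity without disturbing the
   components of [Psi] seen by [A] and [C]. *)
pose D := A *m P + (B - A *m (P *m B)) *m (Q *m N).
pose Psi (u : 'rV[R]_n) : 'rV[R]_n := (s u *m P + (t u - s u *m (P *m B)) *m (Q *m N)) + (u - u *m D).
have PsiJ u As Bs : smooth_jac s u As -> smooth_jac t u Bs ->
    smooth_jac Psi u (As *m P + (Bs - As *m (P *m B)) *m (Q *m N) + (1%:M - D)).
  move=> sAs tBs; apply: smooth_jac_add; last first.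
    have := smooth_jac_sub (smooth_jac_id u)
      (smooth_jac_mulmx D (smooth_jac_id u)).
    by rewrite mul1mx.
  apply: smooth_jac_add; first exact: smooth_jac_mulmx.
  apply: smooth_jac_mulmx; apply: smooth_jac_sub => //.
  exact: smooth_jac_mulmx.
have DA : D *m A = A.
  by rewrite /D BE mulmxDl -!mulmxA PA NA !mulmx0 addr0 mulmx1.
have DC : D *m C = C.
  by rewrite /D BE mulmxDl -!mulmxA PC NC !mulmx0 add0r mulmxA CQ.
have PsiA u : Psi u *m A = s u.
  rewrite /Psi mulmxDl [X in _ + X]mulmxBl -(mulmxA u) DA subrr addr0.
  by rewrite mulmxDl -!mulmxA PA NA !mulmx0 addr0 mulmx1.
have PsiC u : Psi u *m C = (t u - s u *m (P *m B)) *m (Q *m C).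
  rewrite /Psi mulmxDl [X in _ + X]mulmxBl -(mulmxA u) DC subrr addr0.
  by rewrite mulmxDl -!mulmxA PC NC mulmx0 add0r.
have PsiJp : smooth_jac Psi p 1%:M.
  by have := PsiJ _ _ _ sA tB; rewrite -/D addrC subrK.
have [V [g [[oV Vp] [oW Wp] gK CV Cg]]] := inverse_function_jac PsiJp.
(* [E] projects onto the common kernel of [A] and [C], the tangent directions of the fibre of
   [(s, t)]. The retraction projects by [E] in the coordinates [Psi], where [s] is [A]; this keeps
   [s] constant at once. *)
pose E := 1%:M - row_mx A C *m pinvmx (row_mx A C).
have ED : E *m row_mx A C = 0 by rewrite mulmxBl mul1mx mulmxKpV ?subrr.
have [EA EC] : E *m A = 0 /\ E *m C = 0.
  by apply/eq_row_mx; rewrite -mul_mx_row ED row_mx0.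
have vE (v : 'rV_n) : v *m A = 0 -> v *m C = 0 -> v *m E = v.
  move=> vA vC; rewrite mulmxBr mulmx1 mulmxA mul_mx_row vA vC row_mx0 mul0mx.
  by rewrite subr0.
clearbody E D Psi.
pose a (h : 'rV[R]_n) : 'rV[R]_n := Psi p + (h - p) *m E.
have aJ h : smooth_jac a h E.
  have := smooth_jac_add (smooth_jac_cst (Psi p) h)
    (smooth_jac_mulmx E (smooth_jac_sub (smooth_jac_id h) (smooth_jac_cst p h))).
  by rewrite subr0 mul1mx add0r.
have ap : a p = Psi p by rewrite /a subrr mul0mx addr0.
have nW : \forall h \near p, (Psi @` V) (a h).
  have := near_continuous (Cinf_at_continuous (aJ p).1); rewrite ap.
  by apply; exact: open_nbhs_nbhs.
have gJ (y : 'rV[R]_n) : (Psi @` V) y -> exists2 u : 'rV[R]_n, V u &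
    Psi u = y /\ (smooth_jac g y (jacobian g y) /\
      jacobian g y *m jacobian Psi u = 1%:M).
  move=> [u Vu uy]; exists u => //; split=> //; rewrite -uy; split.
    by apply: Cinf_at_jac; apply: Cg; exists u.
  have Jy : smooth_jac g (Psi u) ('J g (Psi u)).
    by apply: Cinf_at_jac; apply: Cg; exists u.
  have := smooth_jac_comp Jy; rewrite gK// => /(_ _ _ _ (Cinf_at_jac (CV u Vu))).
  have idE : \forall y \near Psi u, id y = (Psi \o g) y.
    have : open_nbhs (Psi u) (Psi @` V) by split=> //; exists u.
    move=> /open_nbhs_nbhs; apply: filterS => _ [x Vx <-] /=; by rewrite gK.
  by move: (smooth_jac_id (Psi u)) => /(eq_smooth_jac idE)[_ <-] [_ <-].
exists (g \o a); split.
- by apply: Cinf_at_comp; [case: (aJ p)|rewrite ap; apply: Cg; exists p].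
- by rewrite /= ap gK.
- have sga : \forall h \near p, s (g (a h)) = s p.
    apply: filterS nW => h [u Vu ua]; rewrite -ua gK// -PsiA ua /a.
    by rewrite mulmxDl -mulmxA EA mulmx0 addr0 PsiA.
  (* For [t] only [(t - s *m (P *m B)) *m (Q *m C)] is linear in the new coordinates, so constancy
     is obtained from a vanishing derivative, and this is where the rank hypothesis enters. *)
  suff tga : \forall h \near p, smooth_jac (t \o (g \o a)) h 0.
    have := locally_constant tga; rewrite /= ap gK//.
    by apply: filterS2 sga => h.
  have cga : {for p, continuous (g \o a)}.
    apply: continuous_comp; first exact: Cinf_at_continuous (aJ p).1.
    by rewrite ap; apply/Cinf_at_continuous/Cg; exists p.
  have nst : \forall u \near p, [/\ Cinf_at s u, Cinf_at t u &
      (s u = s p -> \rank (kermx ('J s u) *m ('J t u)) = \rank (kermx A *m B))].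
    by apply: filterS3 (Cinf_at_near sA.1) (Cinf_at_near tB.1) rank_t.
  have nst' : \forall h \near p, let u := g (a h) in
      [/\ Cinf_at s u, Cinf_at t u &
      (s u = s p -> \rank (kermx ('J s u) *m ('J t u)) = \rank (kermx A *m B))].
    by have := near_continuous cga; rewrite /= ap gK// => /(_ _ nst).
  apply: filterS3 nW sga nst' => h Wah sh [Csu Ctu rk].
  have [u Vu [ua [gJa GPsi]]] := gJ _ Wah.
  have gu : g (a h) = u by rewrite -ua gK.
  rewrite gu in sh Csu Ctu rk; move/(_ sh): rk => rk.
  have sJu := Cinf_at_jac Csu; have tJu := Cinf_at_jac Ctu.
  set A' := 'J s u in rk sJu *; set B' := 'J t u in rk tJu *.
  set G := 'J g (a h) in gJa GPsi.
  have := smooth_jac_comp (smooth_jac_comp (aJ h) gJa).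
  rewrite /= gu => /(_ _ _ _ tJu).
  suff -> : E *m G *m B' = 0 by [].
  have JPsi : smooth_jac Psi u ('J Psi u) by apply/Cinf_at_jac/CV.
  have JA : ('J Psi u) *m A = A'.
    have [_ <-] := smooth_jac_mulmx A JPsi.
    by have -> : (fun y => Psi y *m A) = s by apply/funext => y; rewrite PsiA.
  have JC : 'J Psi u *m C = (B' - A' *m (P *m B)) *m (Q *m C).
    have [_ <-] := smooth_jac_mulmx C JPsi.
    have -> : (fun y => Psi y *m C) =
        fun y => (t y - s y *m (P *m B)) *m (Q *m C).
      by apply/funext => y; rewrite PsiC.
    have [_ ->] := smooth_jac_mulmx (Q *m C) (smooth_jac_sub tJu
      (smooth_jac_mulmx (P *m B) sJu)); by [].
  have GA : G *m A' = A by rewrite -JA mulmxA GPsi mul1mx.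
  have GC : G *m (B' - A' *m (P *m B)) *m (Q *m C) = C.
    by rewrite -mulmxA -JC mulmxA GPsi mul1mx.
  have GBC k (X : 'M[R]_(k, n)) :
      X *m A = 0 -> X *m G *m B' *m (Q *m C) = X *m C.
    move=> XA; rewrite -[in RHS]GC [RHS]mulmxA; congr (_ *m _).
    rewrite mulmxBr [G *m (A' *m _)]mulmxA GA mulmxBr [X *m (A *m _)]mulmxA XA.
    by rewrite mul0mx subr0 mulmxA.
  have kX k (X : 'M[R]_(k, n)) : X *m A = 0 -> (X *m G *m B' <= kermx A' *m B')%MS.
    by move=> XA; apply: submxMr; apply/sub_kermxP; rewrite -mulmxA GA.
  (* At a nearby point of the fibre of [s], [Q *m C] maps the image of the derivative of [t] onto
     the row space of [C]. Equal ranks make this map injective, so a vector of that image killed by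
     [Q *m C] is zero. *)
  have inj w := @rank_preimage_eq0 _ _ _ _ _ (kermx A' *m B') (Q *m C) C _ _ w.
  apply/row_matrixP => i; rewrite row0; apply: inj.
  + by rewrite -{1}NC -(GBC _ _ NA); apply: submxMr; exact: kX.
  + by rewrite rk rC.
  + by apply: (submx_trans (row_sub _ _)); exact: kX.
  + by rewrite -row_mul GBC// EC row0.
- move=> v vA vB.
  have vC : v *m C = 0 by rewrite CE mulmxA vN.
  have [_ ->] : smooth_jac (g \o a) p (E *m ('J g (a p))) by
    apply: smooth_jac_comp (aJ p) (Cinf_at_jac _); rewrite ap; apply: Cg; exists p.
  have /gJ[u Vu [ua [_ GJ]]] := nbhs_singleton nW.
  rewrite mulmxA vE//; move: GJ; rewrite ap in ua *.
  have -> : u = p by rewrite -(gK u Vu) ua gK.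
  by rewrite PsiJp.2 mulmx1 => ->; rewrite mulmx1.
Qed.
End fibre_retraction.

(** * Smooth maps between manifolds *)

Section chart_theory.
Variables (R : realType) (T : topologicalType) (n : nat) (c : chart R T n).
Variable x : T.
Hypothesis cx : chart_dom c x.

Lemma chart_dom_nbhs : nbhs x (chart_dom c).
Proof. by apply: open_nbhs_nbhs; split=> //; exact: chart_dom_open. Qed.

Lemma chart_cod_nbhs : nbhs (c x) (c @` chart_dom c).
Proof. by apply: open_nbhs_nbhs; split; [exact: chart_cod_open|exists x]. Qed.

Lemma near_chart (P : set 'rV[R]_n) :
  (\forall u \near c x, P u) -> \forall y \near x, P (c y).
Proof. exact: near_continuous (chart_fun_cont cx). Qed.

Lemma near_chart_inv (P : set T) :
  (\forall y \near x, P y) -> \forall u \near c x, P (chart_inv c u).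
Proof.
have cv : (c @` chart_dom c) (c x) by exists x.
by have := near_continuous (chart_inv_cont cv); rewrite chart_funK//; exact.
Qed.

Lemma near_chart_invK : \forall u \near c x, c (chart_inv c u) = u.
Proof.
by apply: filterS chart_cod_nbhs => _ [y cy <-]; rewrite chart_funK.
Qed.

End chart_theory.


Definition rep (R : realType) m n (M : manifold R m) (N : manifold R n)
    (f : M -> N) (a : atlas M) (b : atlas N) : 'rV[R]_m -> 'rV[R]_n :=
  atlas_chart b \o f \o chart_inv (atlas_chart a).

Definition adom (R : realType) m (M : manifold R m) (a : atlas M) : set M :=
  chart_dom (atlas_chart a).

Lemma adom_at (R : realType) m (M : manifold R m) (x : M) :
  adom (chart_at x) x.
Proof. exact: chart_atP. Qed.

(** Continuity is required separately: charts are total functions, arbitrary outside their domains,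
    so a smooth coordinate expression means nothing until [f] is known to stay in the domain of the
    target chart. *)
Definition smooth_at (R : realType) m n (M : manifold R m) (N : manifold R n)
    (f : M -> N) x :=
  {for x, continuous f} /\
  Cinf_at (rep f (chart_at x) (chart_at (f x))) (atlas_chart (chart_at x) x).

Definition cjac (R : realType) m n (M : manifold R m) (N : manifold R n)
    (a : atlas M) (b : atlas N) (f : M -> N) x : 'M[R]_(m, n) :=
  'J (rep f a b) (atlas_chart a x).

(* The matrix of [mdiff]; it acts on row vectors, so that products of such
   matrices are in the order opposite to that of composition. *)
HB.lock Definition mjac (R : realType) m n (M : manifold R m) (N : manifold R n)
    (f : M -> N) x : 'M[R]_(m, n) := cjac (chart_at x) (chart_at (f x)) f x.

Lemma mjacE (R : realType) m n (M : manifold R m) (N : manifold R n)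
    (f : M -> N) x : mjac f x = cjac (chart_at x) (chart_at (f x)) f x.
Proof. by rewrite mjac.unlock. Qed.

Lemma mdiffE (R : realType) m n (M : manifold R m) (N : manifold R n)
    (f : M -> N) x (v : tangent x) : mdiff f x v = v *m mjac f x.
Proof. rewrite mjacE; exact: jacE. Qed.

Section rep_theory.
Variables (R : realType) (m n p : nat).
Variables (M : manifold R m) (N : manifold R n) (P : manifold R p).

Lemma transition_Cinf (a b : atlas M) x : adom a x -> adom b x ->
  Cinf_at (rep id a b) (atlas_chart a x).
Proof.
move=> ax bx; apply: Cinfty_at (@transition_open _ _ M a b) _
  (@transition_smooth _ _ M a b).
by exists x.
Qed.

Lemma rep_comp (f : M -> N) (g : N -> P) (a : atlas M) (b : atlas N)
    (c : atlas P) x :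
  adom a x -> adom b (f x) -> {for x, continuous f} ->
  \forall u \near atlas_chart a x, rep g b c (rep f a b u) = rep (g \o f) a c u.
Proof.
move=> ax bfx cf.
have nb : \forall y \near x, adom b (f y).
  exact: near_continuous cf (chart_dom_nbhs bfx).
by apply: filterS (near_chart_inv ax nb) => u bu; rewrite /rep /= chart_funK.
Qed.

End rep_theory.

Section smooth_at_theory.
Variables (R : realType) (m n : nat) (M : manifold R m) (N : manifold R n).
Implicit Types f g : M -> N.

Lemma rep_change f (a a' : atlas M) (b b' : atlas N) x : adom a x ->
  adom a' x -> adom b (f x) -> adom b' (f x) -> {for x, continuous f} ->
  Cinf_at (rep f a b) (atlas_chart a x) ->
  Cinf_at (rep f a' b') (atlas_chart a' x).
Proof.
move=> ax a'x bx b'x cf Cf.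
have E1 := rep_comp f b a'x ax (f := id) cvg_id.
have E2 := rep_comp id b' a'x bx cf.
have C1 : Cinf_at (rep f a' b) (atlas_chart a' x).
  apply: (eq_Cinf_at E1); apply: Cinf_at_comp; first exact: transition_Cinf.
  by rewrite /rep /= chart_funK.
apply: (eq_Cinf_at E2); apply: Cinf_at_comp => //.
by rewrite {2}/rep /= chart_funK//; exact: transition_Cinf.
Qed.

Lemma smooth_atP f (a : atlas M) (b : atlas N) x :
  adom a x -> adom b (f x) ->
  smooth_at f x <->
  {for x, continuous f} /\ Cinf_at (rep f a b) (atlas_chart a x).
Proof.
move=> ax bx; split=> -[cf Cf]; split=> //.
  by apply: rep_change Cf => //; exact: chart_atP.
by apply: rep_change Cf => //; exact: chart_atP.
Qed.

Lemma smooth_at_continuous f x : smooth_at f x -> {for x, continuous f}.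
Proof. by case. Qed.

Lemma smooth_atP_cjac f (a : atlas M) (b : atlas N) x :
  adom a x -> adom b (f x) -> smooth_at f x ->
  smooth_jac (rep f a b) (atlas_chart a x) (cjac a b f x).
Proof. by move=> ax bx /(smooth_atP ax bx)[_ Cf]. Qed.

Lemma smooth_jac_mjac f x : smooth_at f x ->
  smooth_jac (rep f (chart_at x) (chart_at (f x)))
    (atlas_chart (chart_at x) x) (mjac f x).
Proof. by move=> [_ Cf]; rewrite mjacE. Qed.

Lemma eq_smooth_at f g x :
  (\forall y \near x, f y = g y) -> smooth_at f x -> smooth_at g x.
Proof.
move=> fg sf; have fgx := nbhs_singleton fg; rewrite /= in fgx.
have [ax bx] := (chart_atP x, chart_atP (f x)).
have bgx : adom (chart_at (f x)) (g x) by rewrite -fgx.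
apply/(smooth_atP ax bgx); have [cf Cf] := sf; split.
  move=> A; rewrite -fgx => /cf fA.
  by apply: filterS2 fg fA => y /= <-.
apply: eq_Cinf_at Cf; apply: filterS (near_chart_inv ax fg) => u.
by rewrite /rep /= => ->.
Qed.

Lemma eq_mjac f g x :
  (\forall y \near x, f y = g y) -> smooth_at f x -> mjac f x = mjac g x.
Proof.
move=> fg [_ Cf]; have fgx := nbhs_singleton fg; rewrite /= in fgx.
have ax := chart_atP x.
rewrite !mjacE /cjac -fgx.
have E : \forall u \near atlas_chart (chart_at x) x,
    rep f (chart_at x) (chart_at (f x)) u = rep g (chart_at x) (chart_at (f x)) u.
  by apply: filterS (near_chart_inv ax fg) => u; rewrite /rep /= => ->.
by have [_ ->] := eq_smooth_jac E (Cinf_at_jac Cf).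
Qed.

Lemma smooth_at_near f x : smooth_at f x -> \forall y \near x, smooth_at f y.
Proof.
move=> [cf Cf]; have [ax bx] := (adom_at x, adom_at (f x)).
set a := chart_at x in Cf ax; set b := chart_at (f x) in Cf bx.
have nb := near_continuous cf (chart_dom_nbhs bx).
have : \forall y \near x, [/\ adom a y, adom b (f y) &
    Cinf_at (rep f a b) (atlas_chart a y)].
  by apply: filterS3 (chart_dom_nbhs ax) nb (near_chart ax (Cinf_at_near Cf)).
move=> /near_open[V [oV Vx] VP].
apply: filterS (open_nbhs_nbhs (conj oV Vx)) => y Vy.
have [ay bfy Cy] := VP y Vy.
apply: (smooth_atP ay bfy).2; split; last exact: Cy.
have ry : rep f a b (atlas_chart a y) = atlas_chart b (f y).
  by rewrite /rep /= chart_funK.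
have cy : {for y, continuous (chart_inv (atlas_chart b) \o
    (rep f a b \o atlas_chart a))}.
  apply: continuous_comp; last by apply: chart_inv_cont; rewrite /= ry; exists (f y).
  by apply: continuous_comp; [exact: chart_fun_cont|exact: Cinf_at_continuous].
have E z : V z -> (chart_inv (atlas_chart b) \o (rep f a b \o atlas_chart a)) z = f z.
  by move=> /VP[az bfz _]; rewrite /rep /= !chart_funK.
move=> B; rewrite -(E y Vy) => /cy; apply: filterS2 (open_nbhs_nbhs (conj oV Vy)).
by move=> z Vz Bz; rewrite /preimage /= -(E z Vz); exact: Bz.
Qed.

Lemma smooth_inP (U : set M) f : open U ->
  smooth_in U f <-> forall x, U x -> smooth_at f x.
Proof.
move=> oU; split=> [[cf Cf] x Ux|sf].
  have [ax bx] := (chart_atP x, chart_atP (f x)).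
  apply/(smooth_atP ax bx); split; first exact: cf.
  move: (Cf (chart_at x) (chart_at (f x))); set W := (X in Cinfty X _) => Cfx.
  have [V [oV Vx] VW] : exists2 V, open_nbhs (atlas_chart (chart_at x) x) V &
      forall u, V u -> W u.
    apply: near_open.
    have nU : nbhs x U by exact: open_nbhs_nbhs.
    have nb := near_continuous (cf x Ux) (chart_dom_nbhs bx).
    have nP : \forall y \near x, (chart_dom (atlas_chart (chart_at x)) `&` U
        `&` f @^-1` chart_dom (atlas_chart (chart_at (f x)))) y.
      by apply: filterS3 (chart_dom_nbhs ax) nU nb.
    have nP' := near_chart_inv ax nP; have nK := near_chart_invK ax.
    apply: filterS2 nP' nK => u Pu <-.
    by exists (chart_inv (atlas_chart (chart_at x)) u).
  exists V => // k; apply/CkWE; apply: sub_Ck (Cfx k) => u; exact: VW.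
split=> [x /sf[]//|a b]; apply: CinftyP => _ [x [[ax Ux] bx] <-].
by have /(smooth_atP ax bx)[] := sf x Ux.
Qed.

Lemma smoothP f : smooth f <-> forall x, smooth_at f x.
Proof.
split=> [sf x|sf]; first by apply: (smooth_inP f openT).1.
by apply/(smooth_inP f openT) => x _.
Qed.

Lemma smooth_at_cst (y : N) x : smooth_at (fun=> y : N) (x : M).
Proof.
split; first exact: cst_continuous.
exact: Cinf_at_cst.
Qed.

Lemma mjac_cst (y : N) x : mjac (fun=> y : N) (x : M) = 0.
Proof.
rewrite mjacE; by have [_] := smooth_jac_cst (atlas_chart (chart_at y) y)
  (atlas_chart (chart_at x) x).
Qed.

End smooth_at_theory.

Section smooth_at_comp.
Variables (R : realType) (m n p : nat).
Variables (M : manifold R m) (N : manifold R n) (P : manifold R p).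

Lemma smooth_at_id (x : M) : smooth_at id x.
Proof.
split; first exact: cvg_id.
by apply: transition_Cinf; exact: chart_atP.
Qed.

Lemma mjac_id (x : M) : mjac id x = 1%:M.
Proof.
have E : \forall u \near atlas_chart (chart_at x) x,
    id u = rep id (chart_at x) (chart_at x) u.
  by apply: filterS (near_chart_invK (chart_atP x)) => u; rewrite /rep /= => ->.
rewrite mjacE; by have [_] := eq_smooth_jac E (smooth_jac_id _).
Qed.

Lemma cjac_comp (f : M -> N) (g : N -> P) (a : atlas M) (b : atlas N)
    (c : atlas P) x : adom a x -> adom b (f x) -> adom c (g (f x)) ->
  smooth_at f x -> smooth_at g (f x) ->
  smooth_at (g \o f) x /\ cjac a c (g \o f) x = cjac a b f x *m cjac b c g (f x).
Proof.
move=> ax bx cx sf sg.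
have Jf := smooth_atP_cjac ax bx sf.
have Jg := smooth_atP_cjac bx cx sg.
have fb : rep f a b (atlas_chart a x) = atlas_chart b (f x).
  by rewrite /rep /= chart_funK.
rewrite -fb in Jg.
have [C J] := eq_smooth_jac (rep_comp g c ax bx (smooth_at_continuous sf))
  (smooth_jac_comp Jf Jg).
split=> //; apply/(@smooth_atP _ _ _ _ _ (g \o f) a c x ax cx); split=> //.
by apply: continuous_comp; exact: smooth_at_continuous.
Qed.

Variables (f : M -> N) (g : N -> P) (x : M).
Hypotheses (sf : smooth_at f x) (sg : smooth_at g (f x)).

Lemma smooth_at_comp : smooth_at (g \o f) x.
Proof.
by have [] := cjac_comp (chart_atP x) (chart_atP (f x)) (chart_atP (g (f x)))
  sf sg.
Qed.

Lemma mjac_comp : mjac (g \o f) x = mjac f x *m mjac g (f x).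
Proof.
rewrite !mjacE; by have [] := cjac_comp (chart_atP x) (chart_atP (f x)) (chart_atP (g (f x)))
  sf sg.
Qed.

End smooth_at_comp.

Section product.
Variables (R : realType) (m n : nat) (M : manifold R m) (N : manifold R n).
Let MN := prod_manifold M N.

Let rep_fst (z : MN) : \forall w \near atlas_chart (chart_at z) z,
  w *m lin1_mx lsubmx =
  rep (fst : MN -> M) (chart_at z) (chart_at z.1) w.
Proof.
apply: filterS (near_chart_invK (chart_atP z)) => w /= wE.
by rewrite mul_rV_lin1 -{1}wE /= row_mxKl.
Qed.

Let rep_snd (z : MN) : \forall w \near atlas_chart (chart_at z) z,
  w *m lin1_mx rsubmx =
  rep (snd : MN -> N) (chart_at z) (chart_at z.2) w.
Proof.
apply: filterS (near_chart_invK (chart_atP z)) => w /= wE.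
by rewrite mul_rV_lin1 -{1}wE /= row_mxKr.
Qed.

Let fst_jac (z : MN) := eq_smooth_jac (rep_fst z)
  (smooth_jac_mulmx (lin1_mx lsubmx) (smooth_jac_id _)).
Let snd_jac (z : MN) := eq_smooth_jac (rep_snd z)
  (smooth_jac_mulmx (lin1_mx rsubmx) (smooth_jac_id _)).

Lemma smooth_at_fst (z : MN) : smooth_at (fst : MN -> M) z.
Proof. by split; [exact: cvg_fst|case: (fst_jac z)]. Qed.

Lemma smooth_at_snd (z : MN) : smooth_at (snd : MN -> N) z.
Proof. by split; [exact: cvg_snd|case: (snd_jac z)]. Qed.

Lemma mjac_fst (z : MN) (v : 'rV_(m + n)) :
  v *m mjac (fst : MN -> M) z = lsubmx v.
Proof.
rewrite mjacE /cjac; have [_ ->] := fst_jac z.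
by rewrite mul1mx mul_rV_lin1.
Qed.

Lemma mjac_snd (z : MN) (v : 'rV_(m + n)) :
  v *m mjac (snd : MN -> N) z = rsubmx v.
Proof.
rewrite mjacE /cjac; have [_ ->] := snd_jac z.
by rewrite mul1mx mul_rV_lin1.
Qed.

Variables (p : nat) (P : manifold R p) (f : P -> M) (g : P -> N) (x : P).
Hypotheses (sf : smooth_at f x) (sg : smooth_at g x).

Lemma smooth_at_pair : smooth_at (fun y => (f y, g y) : MN) x.
Proof.
split; last by apply: Cinf_at_row_mx; [case: sf|case: sg].
by apply: cvg_pair; [case: sf|case: sg].
Qed.

Lemma mjac_pair :
  mjac (fun y => (f y, g y) : MN) x = row_mx (mjac f x) (mjac g x).
Proof.
rewrite !mjacE; by have [_] := smooth_jac_row_mx (Cinf_at_jac sf.2) (Cinf_at_jac sg.2).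
Qed.

End product.

Lemma nbhs_set_type (X : topologicalType) (A : set X) (x : set_type A)
    (U : set (set_type A)) :
  nbhs x U <-> exists2 V, nbhs (\val x) V & forall y : set_type A, V (\val y) -> U y.
Proof.
split=> [|[V nV VU]].
  rewrite nbhsE => -[_ [[V oV <-] Vx] VU]; exists V.
    by exists V => //; split=> //; move: Vx; rewrite /= set_valE.
  by move=> y Vy; apply: VU; rewrite /= set_valE.
have : nbhs x (set_val @^-1` V) by apply: initial_continuous; rewrite set_valE.
by apply: filterS => y; rewrite /= set_valE; exact: VU.
Qed.

Lemma row_full_surjP (F : fieldType) m n (A : 'M[F]_(m, n)) :
  row_full A <-> forall w : 'rV_n, exists v, v *m A = w.
Proof.
split=> [/row_fullP[B BA] w|Aw]; first by exists (w *m B); rewrite -mulmxA BA mulmx1.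
rewrite -sub1mx; apply/row_subP => i; apply/submxP.
by have [v vA] := Aw (row i 1%:M); exists v.
Qed.

Lemma submersionP (R : realType) m n (M : manifold R m) (N : manifold R n)
    (f : M -> N) :
  submersion f <->
  (forall x, smooth_at f x) /\ forall x, row_full (mjac f x).
Proof.
split=> [[/smoothP sf df]|[sf df]]; split=> //.
- move=> x; apply/row_full_surjP => w; have [v vw] := df x w.
  by exists v; apply: etrans vw; rewrite -mdiffE.
- exact: (smoothP f).2 sf.
- move=> x w; have [v vw] := (row_full_surjP _).1 (df x) w.
  by exists v; apply: etrans vw; rewrite -mdiffE.
Qed.

(** * Good pullbacks in terms of neighbourhoods and matrices *)

Section pullback.
Variables (R : realType) (k m1 m2 m : nat).
Variables (P : manifold R k) (M1 : manifold R m1) (M2 : manifold R m2).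
Variables (M : manifold R m).
Variables (f1 : M1 -> M) (f2 : M2 -> M) (p1 : P -> M1) (p2 : P -> M2).

(** The last condition expresses continuity of the inverse through neighbourhoods in the ambient
    product, so that later arguments avoid the subspace topology. *)
Lemma homeo_fibre_product : continuous p1 -> continuous p2 ->
  (exists2 h : P -> set_type (fibre_product f1 f2), homeomorphism h &
     forall p, \val (h p) = (p1 p, p2 p)) <->
  [/\ forall p, f1 (p1 p) = f2 (p2 p),
      forall p q, p1 p = p1 q -> p2 p = p2 q -> p = q,
      forall a b, f1 a = f2 b -> exists2 p, p1 p = a & p2 p = b &
      forall p W, nbhs p W -> \forall z \near (p1 p, p2 p), f1 z.1 = f2 z.2 ->
        exists2 q, W q & p1 q = z.1 /\ p2 q = z.2].
Proof.
move=> c1 c2; split.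
  move=> [h [ch [g cg [hK gK]]] hE].
  have onto a b : f1 a = f2 b -> exists2 p, p1 p = a & p2 p = b.
    move=> ab; have Fab : (a, b) \in fibre_product f1 f2 by exact/mem_set.
    by exists (g (exist _ (a, b) Fab)); have := hE (g (exist _ (a, b) Fab));
      rewrite gK => -[].
  split=> //.
  - move=> p; have /set_mem := valP (h p); rewrite hE; exact.
  - move=> p q e1 e2; rewrite -(hK p) -(hK q); congr g; apply: val_inj.
    by rewrite !hE e1 e2.
  - move=> p W; rewrite -{1}(hK p) => /(cg (h p))/nbhs_set_type[V].
    rewrite hE => nV VW; apply: filterS nV => z Vz zF.
    have Fz : z \in fibre_product f1 f2 by exact/mem_set.
    exists (g (exist _ z Fz)); first exact: VW.
    have E := hE (g (exist _ z Fz)); rewrite gK in E.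
    by split; [exact: esym (congr1 fst E)|exact: esym (congr1 snd E)].
move=> [pF pI pS pO].
have hF p : (p1 p, p2 p) \in fibre_product f1 f2 by exact/mem_set/pF.
pose h p : set_type (fibre_product f1 f2) := exist _ (p1 p, p2 p) (hF p).
exists h => //; split.
  move=> p U /nbhs_set_type[V nV VU].
  have cV : \forall q \near p, V (p1 q, p2 q).
    have c12 : {for p, continuous (fun q => (p1 q, p2 q))}.
      by apply: cvg_pair; [exact: c1|exact: c2].
    exact: near_continuous c12 nV.
  by apply: filterS cV => q Vq; exact: VU.
have gP (z : set_type (fibre_product f1 f2)) :
    exists p, p1 p = (\val z).1 /\ p2 p = (\val z).2.
  have /set_mem zF := valP z.
  by have [p] := pS _ _ zF; exists p.
have [g gE] := choice gP; exists g; last first.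
  split=> [p|z]; first by have [e1 e2] := gE (h p); exact: pI.
  by have [e1 e2] := gE z; apply: val_inj; exact: injective_projections.
move=> z W nW; apply/nbhs_set_type; have [e1 e2] := gE z.
have := pO (g z) W nW; rewrite e1 e2 => nz.
have {}nz : \forall y \near \val z, f1 y.1 = f2 y.2 ->
        exists2 q, W q & p1 q = y.1 /\ p2 q = y.2.
  by move: nz; case: (\val z).
exists [set y | f1 y.1 = f2 y.2 -> exists2 q, W q & p1 q = y.1 /\ p2 q = y.2].
  by [].
move=> y /= Vy; have /set_mem yF := valP y; have [q Wq [q1 q2]] := Vy yF.
have [e1' e2'] := gE y.
by rewrite (_ : g y = q)//; apply: pI; rewrite ?q1 ?q2.
Qed.

Lemma good_pullbackP :
  good_pullback f1 f2 p1 p2 <->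
  [/\ forall p, smooth_at p1 p, forall p, smooth_at p2 p,
     [/\ forall p, f1 (p1 p) = f2 (p2 p),
      forall p q, p1 p = p1 q -> p2 p = p2 q -> p = q,
      forall a b, f1 a = f2 b -> exists2 p, p1 p = a & p2 p = b &
      forall p W, nbhs p W -> \forall z \near (p1 p, p2 p), f1 z.1 = f2 z.2 ->
        exists2 q, W q & p1 q = z.1 /\ p2 q = z.2],
      forall p (v : 'rV_k), v *m mjac p1 p = 0 -> v *m mjac p2 p = 0 -> v = 0 &
      forall p (v1 : 'rV_m1) (v2 : 'rV_m2),
        v1 *m mjac f1 (p1 p) = v2 *m mjac f2 (p2 p) <->
        exists2 v, v *m mjac p1 p = v1 & v *m mjac p2 p = v2].
Proof.
split.
  move=> [/smoothP s1 /smoothP s2 hh inj ex].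
  have c1 : continuous p1 by move=> p; case: (s1 p).
  have c2 : continuous p2 by move=> p; case: (s2 p).
  split=> //; first exact/(homeo_fibre_product c1 c2).
  - move=> p v v1 v2; apply: inj; [exact: etrans (mdiffE _ _) v1|].
    exact: etrans (mdiffE _ _) v2.
  - move=> p v1 v2; have E1 := mdiffE f1 (v1 : tangent (p1 p)).
    have E2 := mdiffE f2 (v2 : tangent (p2 p)).
    have [i1 i2] := ex p v1 v2; split=> [vv|[v v1E v2E]].
      have [|v [v1E v2E]] := i1.
        by rewrite E1 E2; apply/eqP; rewrite subr_eq0; apply/eqP.
      exists v; [exact: etrans (esym (mdiffE _ _)) v1E|].
      exact: etrans (esym (mdiffE _ _)) v2E.
    have := i2; rewrite E1 E2 => {}i2; apply/eqP; rewrite -subr_eq0; apply/eqP.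
    apply: i2; exists v; split; [exact: etrans (mdiffE _ _) v1E|].
    exact: etrans (mdiffE _ _) v2E.
move=> [s1 s2 hh inj ex].
have c1 : continuous p1 by move=> p; case: (s1 p).
have c2 : continuous p2 by move=> p; case: (s2 p).
split; [exact/smoothP|exact/smoothP|exact/(homeo_fibre_product c1 c2)| |].
- move=> p v v1 v2; apply: inj; [exact: etrans (esym (mdiffE _ _)) v1|].
  exact: etrans (esym (mdiffE _ _)) v2.
- move=> p v1 v2; have E1 := mdiffE f1 v1; have E2 := mdiffE f2 v2.
  rewrite E1 E2; split=> [vv|[v [v1E v2E]]].
    have [|v v1E v2E] := (ex p v1 v2).1.
      by apply/eqP; rewrite -subr_eq0; apply/eqP.
    exists v; split; [exact: etrans (mdiffE _ _) v1E|].
    exact: etrans (mdiffE _ _) v2E.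
  apply/eqP; rewrite subr_eq0; apply/eqP; apply/(ex p v1 v2).
  exists v; [exact: etrans (esym (mdiffE _ _)) v1E|].
  exact: etrans (esym (mdiffE _ _)) v2E.
Qed.

End pullback.

Lemma chart_inj (R : realType) (T : topologicalType) n (c : chart R T n) x y :
  chart_dom c x -> chart_dom c y -> c x = c y -> x = y.
Proof. by move=> cx cy /(congr1 (chart_inv c)); rewrite !chart_funK. Qed.

Section smooth_at_chart.
Variables (R : realType) (m n : nat) (M : manifold R m) (N : manifold R n).

Lemma smooth_at_chart (a : atlas M) (b : atlas N) x y
    (F : 'rV[R]_m -> 'rV[R]_n) :
  adom a x -> adom b y -> F (atlas_chart a x) = atlas_chart b y ->
  Cinf_at F (atlas_chart a x) ->
  let f := chart_inv (atlas_chart b) \o F \o atlas_chart a in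
  [/\ smooth_at f x, f x = y, cjac a b f x = 'J F (atlas_chart a x) &
      \forall z \near x, adom b (f z) /\ atlas_chart b (f z) = F (atlas_chart a z)].
Proof.
move=> ax by_ Fx CF f.
have fx : f x = y by rewrite /f /= Fx chart_funK.
have bfx : adom b (f x) by rewrite fx.
have nF : \forall u \near atlas_chart a x,
    (atlas_chart b @` adom b) (F u).
  apply: (near_continuous (Cinf_at_continuous CF)); rewrite Fx.
  exact: chart_cod_nbhs.
have cf : {for x, continuous f}.
  apply: continuous_comp; first exact: chart_fun_cont.
  apply: continuous_comp; first exact: Cinf_at_continuous.
  by apply: chart_inv_cont; rewrite Fx; exists y.
have E : \forall u \near atlas_chart a x, F u = rep f a b u.
  apply: filterS2 nF (near_chart_invK ax) => u [z bz zu] uK.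
  by rewrite /rep /f /= uK -zu chart_funK.
have [C J] := eq_smooth_jac E (Cinf_at_jac CF).
have sf : smooth_at f x := (smooth_atP ax bfx).2 (conj cf C).
split.
  exact: sf.
  exact: fx.
  rewrite /cjac.
  exact: J.
apply: filterS (near_chart ax nF) => z; rewrite /f /comp.
move: (F _) => u [w bw <-].
by rewrite (chart_funK bw); split; [exact: bw|exact: erefl].
Qed.

End smooth_at_chart.

Section local_geometry.
Variables (R : realType) (m n : nat) (M : manifold R m) (N : manifold R n).

Lemma submersion_open (f : M -> N) x U : smooth_at f x -> row_full (mjac f x) ->
  nbhs x U -> \forall y \near f x, exists2 z, U z & f z = y.
Proof.
move=> sf f1 nU; have [ax bx] := (adom_at x, adom_at (f x)).
have [s [Cs sx sE]] := local_section (smooth_jac_mjac sf) f1.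
have rx : rep f (chart_at x) (chart_at (f x)) (atlas_chart (chart_at x) x) =
  atlas_chart (chart_at (f x)) (f x) by rewrite /rep /= chart_funK.
rewrite rx in Cs sx sE.
have nb := near_continuous (smooth_at_continuous sf) (chart_dom_nbhs bx).
have nUb : \forall z \near x, U z /\ adom (chart_at (f x)) (f z).
  by apply: filterS2 nU nb.
have ncs := near_continuous (Cinf_at_continuous Cs); rewrite sx in ncs.
have H := near_chart bx (ncs _ (near_chart_inv ax nUb)).
apply: filterS3 (chart_dom_nbhs bx) H (near_chart bx sE).
move=> y by_ [Uz bz] fz; exists (chart_inv (atlas_chart (chart_at x))
  (s (atlas_chart (chart_at (f x)) y))) => //.
exact: chart_inj bz by_ fz.
Qed.

Lemma immersion_retraction (e : M -> N) p :
  smooth_at e p -> row_free (mjac e p) ->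
  exists l : N -> M, smooth_at l (e p) /\ \forall q \near p, l (e q) = q.
Proof.
move=> se e1; have [ap be] := (adom_at p, adom_at (e p)).
have [s [Cs sE]] := local_retraction (smooth_jac_mjac se) e1.
have rp q : adom (chart_at p) q ->
    rep e (chart_at p) (chart_at (e p)) (atlas_chart (chart_at p) q) =
    atlas_chart (chart_at (e p)) (e q).
  by move=> aq; rewrite /rep /= chart_funK.
rewrite rp// in Cs.
have sp : s (atlas_chart (chart_at (e p)) (e p)) = atlas_chart (chart_at p) p.
  by rewrite -rp// (nbhs_singleton sE).
have [sl _ _ _] := smooth_at_chart be ap sp Cs.
exists (chart_inv (atlas_chart (chart_at p)) \o s \o
  atlas_chart (chart_at (e p))); split=> //.
apply: filterS2 (chart_dom_nbhs ap) (near_chart ap sE) => q aq.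
by rewrite rp//= => ->; rewrite chart_funK.
Qed.

End local_geometry.

(** A local left inverse of the immersion [e] recovers [f] from [e \o f]; continuity keeps [f] where
    that inverse is valid. *)
Lemma smooth_at_lift (R : realType) m n p (M : manifold R m) (N : manifold R n)
    (P : manifold R p) (f : M -> P) (e : P -> N) x :
  {for x, continuous f} -> smooth_at e (f x) -> row_free (mjac e (f x)) ->
  smooth_at (e \o f) x -> smooth_at f x.
Proof.
move=> cf se e1 sef; have [l [sl lE]] := immersion_retraction se e1.
apply: (@eq_smooth_at _ _ _ _ _ (l \o (e \o f))).
  exact: near_continuous cf lE.
exact: smooth_at_comp.
Qed.

Lemma row_free_injP (F : fieldType) m n (A : 'M[F]_(m, n)) :
  row_free A <-> forall v : 'rV_m, v *m A = 0 -> v = 0.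
Proof.
split=> [fA v|Ai].
  by rewrite -(mul0mx _ A) => /(row_free_inj fA).
rewrite -kermx_eq0; apply/eqP/row_matrixP => i; rewrite row0; apply: Ai.
by apply/sub_kermxP; exact: row_sub.
Qed.

Section good_pullback_theory.
Variables (R : realType) (k m1 m2 m : nat).
Variables (P : manifold R k) (M1 : manifold R m1) (M2 : manifold R m2).
Variables (M : manifold R m).
Variables (f1 : M1 -> M) (f2 : M2 -> M) (p1 : P -> M1) (p2 : P -> M2).

(** Smoothness part of the universal property. The two projections form an immersion, and the
    neighbourhood condition of [good_pullbackP] yields the continuity of [f]. *)
Lemma good_pullback_lift n (N : manifold R n) (f : N -> P) x :
  good_pullback f1 f2 p1 p2 ->
  smooth_at (p1 \o f) x -> smooth_at (p2 \o f) x -> smooth_at f x.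
Proof.
move=> /good_pullbackP[s1 s2 [pF pI pS pO] inj ex] sf1 sf2.
have sp12 := smooth_at_pair (s1 (f x)) (s2 (f x)).
apply: (smooth_at_lift (e := fun q => (p1 q, p2 q) : prod_manifold M1 M2)) => //.
- move=> W nW; have c12 : {for x, continuous (fun y => (p1 (f y), p2 (f y)))}.
    by apply: cvg_pair; [case: sf1|case: sf2].
  apply: filterS (near_continuous c12 (pO _ _ nW)) => y /= /(_ (pF _)).
  by move=> [q Wq [q1 q2]]; rewrite /= -(pI q (f y)).
- rewrite mjac_pair//; apply/row_free_injP => v; rewrite mul_mx_row -row_mx0.
  by move=> /eq_row_mx[]; exact: inj.
- exact: smooth_at_pair.
Qed.

(** By transversality the difference of [f1] and [f2], read in coordinates, is a submersion with the
    fibre product as zero set; exactness says that the derivative of [(p1, p2)] fills its kernel. So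
    [onto_zero_set] applies. *)
Lemma fibre_product_onto p :
  smooth_at p1 p -> smooth_at p2 p -> smooth_at f1 (p1 p) ->
  smooth_at f2 (p2 p) -> (forall q, f1 (p1 q) = f2 (p2 q)) ->
  (forall w : 'rV_m, exists (v1 : 'rV_m1) (v2 : 'rV_m2),
    v1 *m mjac f1 (p1 p) - v2 *m mjac f2 (p2 p) = w) ->
  (forall (v1 : 'rV_m1) (v2 : 'rV_m2), v1 *m mjac f1 (p1 p) = v2 *m mjac f2 (p2 p) ->
    exists2 v, v *m mjac p1 p = v1 & v *m mjac p2 p = v2) ->
  forall W, nbhs p W -> \forall z \near (p1 p, p2 p), f1 z.1 = f2 z.2 ->
        exists2 q, W q & p1 q = z.1 /\ p2 q = z.2.
Proof.
move=> s1 s2 sf1 sf2 pF surj ex W nW.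
(* One chart at the common value for both maps, so that their coordinate expressions can be
   subtracted. *)
set b := chart_at (f1 (p1 p)).
have cp := adom_at p; have c1 := adom_at (p1 p).
have c2 := adom_at (p2 p); have b1 : adom b (f1 (p1 p)) by exact: adom_at.
have b2 : adom b (f2 (p2 p)) by rewrite -pF.
have J1 := smooth_jac_mjac s1; have J2 := smooth_jac_mjac s2.
have Jf1 := smooth_jac_mjac sf1; have Jf2 := smooth_atP_cjac c2 b2 sf2.
have E2 : cjac (chart_at (p2 p)) b f2 (p2 p) = mjac f2 (p2 p).
  by rewrite mjacE /b pF.
rewrite E2 in Jf2.
move: (mjac p1 p) (mjac p2 p) (mjac f1 (p1 p)) (mjac f2 (p2 p)) surj ex J1 J2 Jf1 Jf2.
move=> A1 A2 B1 B2 surj ex J1 J2 Jf1 Jf2 {E2}.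
have JH := smooth_jac_row_mx J1 J2.
set H := (X in smooth_jac X _ _) in JH.
have Hc q : adom (chart_at p) q -> H (atlas_chart (chart_at p) q) =
    row_mx (atlas_chart (chart_at (p1 p)) (p1 q)) (atlas_chart (chart_at (p2 p)) (p2 q)).
  by move=> cq; rewrite /H /rep /= !chart_funK.
pose f (w : 'rV[R]_(m1 + m2)) := rep f1 (chart_at (p1 p)) b (lsubmx w) -
  rep f2 (chart_at (p2 p)) b (rsubmx w).
pose L := lin1_mx (@lsubmx R 1 m1 m2) *m B1 - lin1_mx (@rsubmx R 1 m1 m2) *m B2.
have JL : smooth_jac f (H (atlas_chart (chart_at p) p)) L.
  rewrite Hc//; set w := row_mx _ _.
  have lw : w *m lin1_mx (@lsubmx R 1 m1 m2) = atlas_chart (chart_at (p1 p)) (p1 p).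
    by rewrite mul_rV_lin1 /= row_mxKl.
  have rw : w *m lin1_mx (@rsubmx R 1 m1 m2) = atlas_chart (chart_at (p2 p)) (p2 p).
    by rewrite mul_rV_lin1 /= row_mxKr.
  rewrite -lw in Jf1; rewrite -rw in Jf2.
  have := smooth_jac_sub
    (smooth_jac_comp (smooth_jac_mulmx (lin1_mx (@lsubmx R 1 m1 m2)) (smooth_jac_id w)) Jf1)
    (smooth_jac_comp (smooth_jac_mulmx (lin1_mx (@rsubmx R 1 m1 m2)) (smooth_jac_id w)) Jf2).
  rewrite !mul1mx -/L; congr (smooth_jac _ _ _); apply/funext => z.
  by rewrite /f /= !mul_rV_lin1.
have nf q1 q2 : adom (chart_at (p1 p)) q1 -> adom (chart_at (p2 p)) q2 ->
    f1 q1 = f2 q2 ->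
    f (row_mx (atlas_chart (chart_at (p1 p)) q1) (atlas_chart (chart_at (p2 p)) q2)) = 0.
  move=> cq1 cq2 q12; rewrite /f row_mxKl row_mxKr /rep /= !chart_funK//.
  by rewrite q12 subrr.
have fH0 : f (H (atlas_chart (chart_at p) p)) = 0 by rewrite Hc// nf.
have n1 := near_continuous (smooth_at_continuous s1) (chart_dom_nbhs c1).
have n2 := near_continuous (smooth_at_continuous s2) (chart_dom_nbhs c2).
have n12 : \forall q \near p, [/\ adom (chart_at p) q, adom (chart_at (p1 p)) (p1 q)
    & adom (chart_at (p2 p)) (p2 q)] by apply: filterS3 (chart_dom_nbhs cp) n1 n2.
have fH : \forall u \near atlas_chart (chart_at p) p,
    f (H u) = f (H (atlas_chart (chart_at p) p)).
  rewrite fH0; apply: filterS2 (near_chart_inv cp n12) (near_chart_invK cp).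
  by move=> u [cu c1u c2u] <-; rewrite Hc// nf.
have Lfull : row_full L.
  apply/row_full_surjP => w; have [v1 [v2 <-]] := surj w; exists (row_mx v1 v2).
  by rewrite /L mulmxBr !mulmxA !mul_rV_lin1 /= row_mxKl row_mxKr.
have kerL (w : 'rV_(m1 + m2)) : w *m L = 0 -> (w <= row_mx A1 A2)%MS.
  rewrite /L mulmxBr !mulmxA !mul_rV_lin1 /= => /eqP; rewrite subr_eq0 => /eqP.
  move=> /ex[v v1 v2]; apply/submxP; exists v.
  by rewrite mul_mx_row v1 v2 hsubmxK.
have nW' : \forall q \near p, [/\ W q, adom (chart_at (p1 p)) (p1 q)
    & adom (chart_at (p2 p)) (p2 q)] by apply: filterS2 nW n12 => q Wq [].
have onto := onto_zero_set JH JL fH Lfull kerL (near_chart_inv cp nW').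
rewrite fH0 Hc// in onto.
pose c12 (z : M1 * M2) := row_mx (atlas_chart (chart_at (p1 p)) z.1)
  (atlas_chart (chart_at (p2 p)) z.2).
have cc12 : {for (p1 p, p2 p), continuous c12}.
  exact: (@prod_chart_fun_cont _ _ _ _ _ (atlas_chart (chart_at (p1 p)))
    (atlas_chart (chart_at (p2 p))) (p1 p, p2 p) (conj c1 c2)).
have nd : \forall z \near (p1 p, p2 p),
    adom (chart_at (p1 p)) z.1 /\ adom (chart_at (p2 p)) z.2.
  by exists (adom (chart_at (p1 p)), adom (chart_at (p2 p))) => //=;
    split; exact: chart_dom_nbhs.
apply: filterS2 nd (near_continuous cc12 onto) => -[q1 q2] /= [cq1 cq2] onto' q12.
have [|u [Wu c1u c2u] Hu] := onto'; first exact: nf.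
exists (chart_inv (atlas_chart (chart_at p)) u) => //.
by split; [apply: chart_inj c1u cq1 _|apply: chart_inj c2u cq2 _];
  move: Hu; rewrite /H /c12 /rep /= => /eq_row_mx[].
Qed.

End good_pullback_theory.

(** The rank of the target derivative on a source fibre does not depend on the charts; [T] carries
    one kernel onto the other. *)
Lemma rank_kermx_change (F : fieldType) n m m' (T : 'M[F]_n) (T1 : 'M[F]_m)
    (T2 : 'M[F]_m') (S : 'M[F]_(n, m)) (B : 'M[F]_(n, m')) :
  T \in unitmx -> T1 \in unitmx -> T2 \in unitmx ->
  \rank (kermx (T *m S *m T1) *m (T *m B *m T2)) = \rank (kermx S *m B).
Proof.
move=> uT uT1 uT2; rewrite !mulmxA mxrankMfree ?row_free_unit//.
suff kE : (kermx (T *m S *m T1) *m T :=: kermx S)%MS by rewrite (eqmxMr B kE).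
apply/eqmxP/andP; split.
  apply/sub_kermxP; have fT1 : row_free T1 by rewrite row_free_unit.
  apply: (row_free_inj fT1); rewrite mul0mx.
  by have := mulmx_ker (T *m S *m T1); rewrite !mulmxA.
rewrite -[X in (X <= _)%MS](mulmxKV uT); apply: submxMr; apply/sub_kermxP.
by rewrite !mulmxA mulmxKV// mulmx_ker mul0mx.
Qed.

Lemma repE (R : realType) m n (M : manifold R m) (N : manifold R n) (f : M -> N)
    (a : atlas M) (b : atlas N) x : adom a x ->
  rep f a b (atlas_chart a x) = atlas_chart b (f x).
Proof. by move=> ax; rewrite /rep /= chart_funK. Qed.

Section transition_jac.
Variables (R : realType) (n : nat) (M : manifold R n).

Lemma cjac_id_unit (a b : atlas M) x : adom a x -> adom b x ->
  cjac a b id x \in unitmx.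
Proof.
move=> ax bx; have [s1 s2] := (smooth_at_id x, smooth_at_id (id x)).
have [_ E] := cjac_comp ax bx ax s1 s2.
have idE : \forall u \near atlas_chart a x, id u = rep (id \o id) a a u.
  by apply: filterS (near_chart_invK ax) => u; rewrite /rep /= => ->.
have [_ E1] := eq_smooth_jac idE (smooth_jac_id _).
have [u _] := mulmx1_unit (etrans (esym E) E1); exact: u.
Qed.

End transition_jac.

Lemma cjacE (R : realType) m n (M : manifold R m) (N : manifold R n) (f : M -> N)
    (a : atlas M) (b : atlas N) x : adom a x -> adom b (f x) -> smooth_at f x ->
  cjac a b f x =
  cjac a (chart_at x) id x *m mjac f x *m cjac (chart_at (f x)) b id (f x).
Proof.
move=> ax bx sf; have [ax' bx'] := (adom_at x, adom_at (f x)).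
rewrite mjacE; have [sf1 ->] := cjac_comp (f := f) (g := id) ax bx' bx sf (smooth_at_id _).
congr (_ *m _).
by have [_ ->] := cjac_comp (f := id) (g := f) ax ax' bx' (smooth_at_id _) sf.
Qed.

Lemma manifold_fibre_retraction (R : realType) n m m' (G : manifold R n)
    (M : manifold R m) (M' : manifold R m') (s : G -> M) (t : G -> M') g :
  (forall h, smooth_at s h) -> (forall h, smooth_at t h) ->
  row_full (mjac s g) ->
  (forall h, s h = s g -> \rank (kermx (mjac s h) *m mjac t h) =
                          \rank (kermx (mjac s g) *m mjac t g)) ->
  exists r : G -> G, [/\ smooth_at r g, r g = g,
    \forall h \near g, s (r h) = s g /\ t (r h) = t g &
    forall v : 'rV_n, v *m mjac s g = 0 -> v *m mjac t g = 0 -> v *m mjac r g = v].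
Proof.
move=> ss st s1 rk; have [ag bg] := (adom_at g, adom_at (s g)).
have cg := adom_at (t g).
set a := chart_at g in ag *; set b := chart_at (s g) in bg *.
set c := chart_at (t g) in cg *.
have nabc : \forall h \near g, [/\ adom a h, adom b (s h) & adom c (t h)].
  apply: filterS3 (chart_dom_nbhs ag) (near_continuous (ss g).1 (chart_dom_nbhs bg))
    (near_continuous (st g).1 (chart_dom_nbhs cg)) => h; by [].
(* The hypothesis reads each [h] in its own preferred charts, the local theorem in those of [g];
   transition matrices are invertible and keep the rank. *)
have rank_near : \forall u \near atlas_chart a g,
    rep s a b u = rep s a b (atlas_chart a g) ->
    \rank (kermx ('J (rep s a b) u) *m 'J (rep t a c) u) =
    \rank (kermx (mjac s g) *m mjac t g).
  apply: filterS2 (near_chart_inv ag nabc) (near_chart_invK ag).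
  move=> u [au bu cu] <-.
  set h := chart_inv _ u in au bu cu *.
  move=> sh0; have sh : s h = s g.
    apply: (chart_inj bu bg).
    exact: etrans (esym (repE s b au)) (etrans sh0 (repE s b ag)).
  apply: etrans (rk h sh).
  have E1 := cjacE au bu (ss h); have E2 := cjacE au cu (st h).
  apply: (etrans (congr2 (fun A B => \rank (kermx A *m B)) E1 E2)).
  by apply: rank_kermx_change; apply: cjac_id_unit => //; exact: adom_at.
have sJ := smooth_jac_mjac (ss g); have tJ := smooth_jac_mjac (st g).
have [r [Cr rg str dr]] := fibre_retraction sJ tJ s1 rank_near.
have [f [sr rgg jr nr]] : exists f : G -> G,
  [/\ smooth_at f g, f g = g, cjac a a f g = 'J r (atlas_chart a g) &
    \forall z \near g, adom a (f z) /\ atlas_chart a (f z) = r (atlas_chart a z)].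
  by exists (chart_inv (atlas_chart a) \o r \o atlas_chart a);
    exact: (smooth_at_chart ag ag rg Cr).
exists f; split.
- exact: sr.
- exact: rgg.
- have nf := near_continuous sr.1; rewrite rgg in nf.
  apply: filterS3 nr (near_chart ag str) (nf _ nabc).
  move=> h [afh fh] [sh th] [_ bfh cfh]; rewrite -fh in sh th.
  split; [apply: (chart_inj bfh bg)|apply: (chart_inj cfh cg)].
    exact: etrans (esym (repE s b afh)) (etrans sh (repE s b ag)).
  exact: etrans (esym (repE t c afh)) (etrans th (repE t c ag)).
- move=> v vs vt.
  have E : mjac f g = cjac a a f g :=
    etrans (mjacE f g) (congr1 (fun y => cjac a (chart_at y) f g) rgg).
  by rewrite E jr; apply: dr; [exact: vs|exact: vt].
Qed.

(** * Submanifolds and good pullbacks *)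

Section submanifold.
Variables (R : realType) (n d : nat) (A : manifold R n) (X : set A).
(* Around [x] in [X] the submanifold is parametrized by [e x], and [c x] gives
   the parameters of the points of [X]. *)
Variables (c : A -> 'rV[R]_n -> 'rV[R]_d) (e : A -> 'rV[R]_d -> 'rV[R]_n).
Let ch (x : A) := atlas_chart (chart_at x).
Hypothesis c_smooth : forall x, X x -> Cinf_at (c x) (ch x x).
Hypothesis e_smooth : forall x, X x -> Cinf_at (e x) (c x (ch x x)).
Hypothesis ecK : forall x, X x ->
  \forall y \near x, X y -> e x (c x (ch x y)) = ch x y.
Hypothesis ceK : forall x, X x -> \forall z \near c x (ch x x),
  X (chart_inv (ch x) (e x z)) /\ c x (e x z) = z.

Let good_param x z := [/\ X (chart_inv (ch x) (e x z)), c x (e x z) = z,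
  Cinf_at (e x) z & (ch x @` adom (chart_at x)) (e x z)].

Let good_point (V : set 'rV[R]_d) x y := [/\ adom (chart_at x) y,
  X y -> e x (c x (ch x y)) = ch x y, V (c x (ch x y)) & Cinf_at (c x) (ch x y)].

(** The hypotheses hold only near each point; [V] and [W] are open sets on which they hold outright,
    with [W] sent into [V] by the parameters. Off [X] a dummy pair makes the choice total. *)
Let neighbourhoods x : exists VW : set 'rV[R]_d * set A, X x ->
  [/\ open VW.1, open_nbhs x VW.2, forall z, VW.1 z -> good_param x z &
      forall y, VW.2 y -> good_point VW.1 x y].
Proof.
have [Xx|nXx] := pselect (X x); last by exists (set0, set0).
have ax : adom (chart_at x) x by exact: adom_at.
have ecx : e x (c x (ch x x)) = ch x x := nbhs_singleton (ecK Xx) Xx.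
have nV : \forall z \near c x (ch x x), good_param x z.
  have ncod : \forall z \near c x (ch x x),
      (ch x @` adom (chart_at x)) (e x z).
    have := near_continuous (Cinf_at_continuous (e_smooth Xx)).
    by rewrite ecx; apply; exact: chart_cod_nbhs.
  apply: filterS3 (ceK Xx) (Cinf_at_near (e_smooth Xx)) ncod.
  by move=> z [z1 z2] z3 z4; split.
have [V [oV Vx] VP] := near_open nV.
have nW : \forall y \near x, good_point V x y.
  have n1 : \forall y \near x, V (c x (ch x y)) /\ Cinf_at (c x) (ch x y).
    have cV := near_continuous (Cinf_at_continuous (c_smooth Xx))
      (open_nbhs_nbhs (conj oV Vx)).
    have n0 : \forall u \near ch x x, V (c x u) /\ Cinf_at (c x) u.
      by apply: filterS2 cV (Cinf_at_near (c_smooth Xx)) => u.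
    by apply: filterS (near_chart ax n0) => y.
  apply: filterS3 (chart_dom_nbhs ax) (ecK Xx) n1.
  by move=> y y1 y2 [y3 y4]; split.
have [W oW WP] := near_open nW.
by exists (V, W).
Qed.

Let VW x := sval (cid (neighbourhoods x)).
Let V x := (VW x).1.
Let W x := (VW x).2.
Let VWP x (Xx : X x) : [/\ open (V x), open_nbhs x (W x),
  forall z, V x z -> good_param x z & forall y, W x y -> good_point (V x) x y].
Proof. exact: (svalP (cid (neighbourhoods x))). Qed.

Let Q : topologicalType := set_type X.
Let iota (q : Q) : A := \val q.

Let iotaX q : X (iota q). Proof. exact: set_mem (valP q). Qed.

Let iota_continuous : continuous iota.
Proof. by move=> q; rewrite /iota; have := @initial_continuous _ _ set_val q; rewrite set_valE. Qed.

Section chart_at_point.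
Variable q : Q.
Let x := iota q.
Let Xx : X x := iotaX q.

Let phi (y : Q) : 'rV[R]_d := c x (ch x (iota y)).
Let psi0 (z : 'rV[R]_d) : A := chart_inv (ch x) (e x z).
(** An inverse chart is a total function, so [q] is the default where the parametrization leaves
    [X]. *)
Let psi (z : 'rV[R]_d) : Q :=
  if pselect (X (psi0 z)) is left Xz then exist _ (psi0 z) (mem_set Xz) else q.
Let D : set Q := [set y | W x (iota y)].

Let iota_psi z : X (psi0 z) -> iota (psi z) = psi0 z.
Proof. by rewrite /psi; case: pselect. Qed.

Let psi0_cont z : V x z -> {for z, continuous psi0}.
Proof.
have [_ _ Vp _] := VWP Xx; move=> /Vp[_ _ Ce cod].
apply: continuous_comp; first exact: Cinf_at_continuous.
exact: chart_inv_cont.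
Qed.

Let D_open : open D.
Proof.
have [_ [oW _] _ _] := VWP Xx.
by have /continuousP := iota_continuous; apply.
Qed.

Let phiK y : D y -> V x (phi y) /\ psi0 (phi y) = iota y.
Proof.
have [_ _ _ Wp] := VWP Xx; move=> /Wp[ay ey Vy _]; split=> //.
by rewrite /psi0 ey ?chart_funK//; exact: iotaX.
Qed.

Let phi_image : phi @` D = [set z | V x z /\ W x (psi0 z)].
Proof.
have [_ _ Vp _] := VWP Xx.
apply/seteqP; split=> [_ [y Dy <-]|z [Vz Wz]] /=.
  by have [Vy ->] := phiK Dy.
have [Xz cez _ [y ay yz]] := Vp _ Vz; have iz := iota_psi Xz.
exists (psi z); first by rewrite /D /= iz.
by rewrite /phi iz /psi0 -{1}yz (chart_funK ay) yz.
Qed.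

Let cod_open : open (phi @` D).
Proof.
have [oV [oW _] _ _] := VWP Xx.
rewrite phi_image openE => z [Vz Wz].
have n1 : nbhs z (V x) by exact: open_nbhs_nbhs.
have n2 : \forall y \near z, W x (psi0 y).
  exact: near_continuous (psi0_cont Vz) (open_nbhs_nbhs (conj oW Wz)).
by apply: filterS2 n1 n2.
Qed.

Let funK y : D y -> psi (phi y) = y.
Proof.
move=> Dy; have [_ e1] := phiK Dy; apply: val_inj.
rewrite -[LHS]/(iota (psi (phi y))) iota_psi e1//; exact: iotaX.
Qed.

Let phi_cont y : D y -> {for y, continuous phi}.
Proof.
have [_ _ _ Wp] := VWP Xx; move=> /Wp[ay _ _ Cy].
have C2 : {for iota y, continuous (c x \o ch x)}.
  apply: continuous_comp; first exact: chart_fun_cont.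
  exact: Cinf_at_continuous.
exact: (@continuous_comp _ _ _ iota (c x \o ch x) y (@iota_continuous _) C2).
Qed.

Let psi_cont z : (phi @` D) z -> {for z, continuous psi}.
Proof.
have [oV _ Vp _] := VWP Xx; rewrite phi_image => -[Vz Wz].
have [Xz _ _ _] := Vp _ Vz.
move=> U /nbhs_set_type[B nB BU].
rewrite -/(iota (psi z)) iota_psi// in nB.
have n1 : nbhs z (V x) by exact: open_nbhs_nbhs.
apply: filterS2 n1 (near_continuous (psi0_cont Vz) nB) => y /Vp[Xy _ _ _] By.
by apply: BU; rewrite -/(iota (psi y)) iota_psi.
Qed.

Definition submanifold_chart : chart R Q d :=
  Chart D_open cod_open funK phi_cont psi_cont.

Lemma submanifold_chart_inv z : X (chart_inv (ch x) (e x z)) ->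
  iota (chart_inv submanifold_chart z) = chart_inv (ch x) (e x z).
Proof. exact: iota_psi. Qed.

End chart_at_point.

(** Points index their own charts, so the preferred chart at [q] is built from [c] and [e] at [q],
    and the derivative of the inclusion there is that of [e]. *)
Lemma submanifold_exists : exists (S : manifold R d) (i : S -> A),
  [/\ forall q, X (i q) /\ forall p, i p = i q -> p = q,
      (forall x, X x -> exists q, i q = x),
      (forall q U, nbhs q U -> \forall y \near i q, X y ->
        exists2 p, U p & i p = y),
      forall q, smooth_at i q &
      forall q, mjac i q = 'J (e (i q)) (c (i q) (ch (i q) (i q)))].
Proof.
have trans p q : Cinfty (submanifold_chart p @`
    (chart_dom (submanifold_chart p) `&` chart_dom (submanifold_chart q)))
  (submanifold_chart q \o chart_inv (submanifold_chart p)).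
  apply: CinftyP => _ [y [Dp Dq] <-].
  have [_ _ Vp Wp] := VWP (iotaX p); have [_ _ _ Wq] := VWP (iotaX q).
  have [ap ep Vy Cp] := Wp _ Dp; have [aq eq _ Cq] := Wq _ Dq.
  have [oV _ _ _] := VWP (iotaX p).
  set z := submanifold_chart p y.
  have [Xz cez Ce cod] := Vp _ Vy.
  have ez : e (iota p) z = ch (iota p) (iota y) by apply: ep; exact: iotaX.
  apply: (@eq_Cinf_at _ _ _ (c (iota q) \o (rep id (chart_at (iota p))
    (chart_at (iota q)) \o e (iota p)))).
    have nV : nbhs z (V (iota p)) by exact: open_nbhs_nbhs.
    apply: filterS nV => w /Vp[Xw _ _ _].
    have E : (submanifold_chart q \o chart_inv (submanifold_chart p)) w =
      c (iota q) (ch (iota q) (iota (chart_inv (submanifold_chart p) w))) by [].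
    by rewrite E submanifold_chart_inv.
  apply: Cinf_at_comp.
    apply: Cinf_at_comp => //; rewrite ez; exact: transition_Cinf.
  by rewrite /= ez repE.
have Qh : hausdorff_space Q.
  move=> p q cl; apply: val_inj; apply: (@manifold_hausdorff _ _ A).
  move=> B C nB nC.
  have [] := cl (iota @^-1` B) (iota @^-1` C).
  - exact: iota_continuous.
  - exact: iota_continuous.
  by move=> y [By Cy]; exists (iota y).
have Qs : @second_countable Q.
  have [B cB [oB bB]] := @manifold_second_countable _ _ A.
  exists ((fun U => iota @^-1` U) @` B).
    exact: sub_countable (card_image_le _ _) cB.
  split=> [_ [U BU <-]|q U /nbhs_set_type[C nC CU]].
    by have /continuousP := iota_continuous; apply; exact: oB.
  have [C' [BC' C'q] C'C] := bB _ _ nC.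
  exists (iota @^-1` C'); first by split=> //; exists C'.
  by move=> y /C'C; exact: CU.
have dom q : chart_dom (submanifold_chart q) q.
  by have [_ [_ Wq] _ _] := VWP (iotaX q).
pose S : manifold R d := @Manifold R d Q Q submanifold_chart id dom trans Qh Qs.
exists S, iota.
have iota_rep q : smooth_jac (rep (iota : S -> A) (q : atlas S) (chart_at (iota q)))
    (c (iota q) (ch (iota q) (iota q)))
    ('J (e (iota q)) (c (iota q) (ch (iota q) (iota q)))).
  have [oV [_ Wq] Vp Wp] := VWP (iotaX q).
  have [_ _ Vq _] := Wp _ Wq.
  have nV := open_nbhs_nbhs (conj oV Vq).
  apply: eq_smooth_jac; last exact/Cinf_at_jac/e_smooth/iotaX.
  apply: filterS nV => w /Vp[Xw _ _ [y ay yw]].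
  have E : rep (iota : S -> A) (q : atlas S) (chart_at (iota q)) w =
      ch (iota q) (iota (chart_inv (submanifold_chart q) w)) by [].
  by rewrite E submanifold_chart_inv// -yw (chart_funK ay).
split.
- by move=> q; split=> [|p]; [exact: iotaX|exact: val_inj].
- by move=> x Xx; exists (exist _ x (mem_set Xx)).
- move=> q U /nbhs_set_type[B nB BU]; apply: filterS nB => y By Xy.
  by exists (exist _ y (mem_set Xy)) => //; exact: BU.
- move=> q; split; first exact: iota_continuous.
  by have [] := iota_rep q.
- by move=> q; rewrite mjacE; have [_ <-] := iota_rep q.
Qed.
End submanifold.

Lemma smooth_jac_inverse (R : realType) n (f g : 'rV[R]_n -> 'rV[R]_n) p :
  smooth_jac f p 1%:M -> Cinf_at g (f p) -> (\forall x \near p, g (f x) = x) ->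
  smooth_jac g (f p) 1%:M.
Proof.
move=> fJ Cg gK; split=> //.
have [_ E1] := smooth_jac_comp fJ (Cinf_at_jac Cg).
have gK' : \forall x \near p, id x = (g \o f) x by apply: filterS gK => x /= ->.
have [_ E2] := eq_smooth_jac gK' (smooth_jac_id p).
by rewrite -E2 E1 mul1mx.
Qed.

(** * Fibre products of a submersion and a smooth map *)

Section pullback_param.
Variables (R : realType) (m1 m2 m : nat).
Variables (M1 : manifold R m1) (M2 : manifold R m2) (M : manifold R m).
Variables (f1 : M1 -> M) (f2 : M2 -> M) (x1 : M1) (x2 : M2).
Hypothesis f1_full : row_full (mjac f1 x1).
Hypotheses (sf1 : smooth_at f1 x1) (sf2 : smooth_at f2 x2) (x12 : f1 x1 = f2 x2).
Let A := prod_manifold M1 M2.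
Let x : A := (x1, x2).
Let ch := atlas_chart (chart_at x).

(* Straightening [f1] to the linear map [A1], the fibre product is
   parametrized by the kernel of [A1] and [M2]. *)
Lemma pullback_param : exists (c : 'rV[R]_(m1 + m2) -> 'rV[R]_(m1 - m + m2))
    (e : 'rV[R]_(m1 - m + m2) -> 'rV[R]_(m1 + m2)),
  [/\ Cinf_at c (ch x), Cinf_at e (c (ch x)),
    (\forall y \near x, f1 y.1 = f2 y.2 -> e (c (ch y)) = ch y),
    (\forall z \near c (ch x), f1 (chart_inv ch (e z)).1 =
       f2 (chart_inv ch (e z)).2 /\ c (e z) = z) &
    (forall v : 'rV_(m1 + m2), lsubmx v *m mjac f1 x1 = rsubmx v *m mjac f2 x2 ->
       exists w : 'rV_(m1 - m + m2), w *m 'J e (c (ch x)) = v) /\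
    (forall w : 'rV_(m1 - m + m2), w *m 'J e (c (ch x)) = 0 -> w = 0)].
Proof.
set b := chart_at (f1 x1).
have a1 := adom_at x1; have a2 := adom_at x2.
have b1 : adom b (f1 x1) by exact: adom_at.
have b2 : adom b (f2 x2) by rewrite -x12.
have J1 := smooth_jac_mjac sf1.
have J2 := smooth_atP_cjac a2 b2 sf2.
have E2 : cjac (chart_at x2) b f2 x2 = mjac f2 x2.
  by rewrite mjacE /b x12.
rewrite E2 {E2} in J2.
move: (mjac f1 x1) (mjac f2 x2) f1_full J1 J2 => A1 A2 A1f J1 J2.
(* Full rank of [A1] forces [m <= m1], so the subtraction is exact and [K] is a basis of the
   kernel. *)
have [K [KA Kf]] : exists K : 'M[R]_(m1 - m, m1), (K :=: kermx A1)%MS /\ row_free K.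
  have : (m1 - m)%N = \rank (kermx A1) by rewrite mxrank_ker (eqP A1f).
  move=> ->; exists (row_base (kermx A1)).
  by split; [exact: eq_row_base|exact: row_base_free].
have sJ := straighten_jac J1; set Psi := straighten _ _ in sJ.
have PsiA u : Psi u *m A1 = rep f1 (chart_at x1) b u by exact: straightenM.
have [V [g [[oV Vp] [oW Wp] gK CV Cg]]] := inverse_function_jac sJ.
have nV : \forall u \near atlas_chart (chart_at x1) x1, V u by exact: open_nbhs_nbhs.
have gJ : smooth_jac g (Psi (atlas_chart (chart_at x1) x1)) 1%:M.
  apply: smooth_jac_inverse sJ (Cg _ Wp) _.
  by apply: filterS nV => u; exact: gK.
have [P [PA PsiE]] : exists P : 'M[R]_(m, m1), P *m A1 = 1%:M /\
    forall u, Psi u = rep f1 (chart_at x1) b u *m P + (u - u *m (A1 *m P)).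
  by exists (pinvmx A1); rewrite mulVpmx.
clearbody Psi.
(* [N] projects onto the kernel of [A1], and [J] below reads the projection in the basis [K]. *)
pose N := 1%:M - A1 *m P.
have KA0 : K *m A1 = 0 by apply/sub_kermxP; rewrite KA.
have KN : K *m N = K by rewrite mulmxBr mulmx1 mulmxA KA0 mul0mx subr0.
have NK : N *m pinvmx K *m K = N.
  apply: mulmxKpV; rewrite KA; apply/sub_kermxP.
  by rewrite mulmxBl mul1mx -mulmxA PA mulmx1 subrr.
have PN : P *m N = 0 by rewrite mulmxBr mulmx1 mulmxA PA mul1mx subrr.
have NN : N *m N = N by rewrite {1}/N mulmxBl mul1mx -mulmxA PN mulmx0 subr0.
have PsiN u : Psi u *m N = u *m N.
  rewrite PsiE mulmxDl -mulmxA PN mulmx0 add0r.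
  have -> : u - u *m (A1 *m P) = u *m N by rewrite mulmxBr mulmx1.
  by rewrite -mulmxA NN.
have KK : K *m pinvmx K = 1%:M by exact: mulmxVp.
pose J := N *m pinvmx K.
have NE : A1 *m P + N = 1%:M by rewrite /N addrC subrK.
move: (pinvmx K) KK @J NK => K' KK J NK.
have JE : J = N *m K' by [].
have JK : J *m K = N by rewrite JE.
clearbody J N.
pose F2 := rep f2 (chart_at x2) b.
pose c (u : 'rV[R]_(m1 + m2)) : 'rV[R]_(m1 - m + m2) := row_mx (lsubmx u *m J) (rsubmx u).
(* The straightened point of [M1]: its kernel part is the free parameter, and its image under [A1]
   is forced to be the value of [f2]. *)
pose om (z : 'rV[R]_(m1 - m + m2)) : 'rV[R]_m1 := lsubmx z *m K + F2 (rsubmx z) *m P.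
pose e (z : 'rV[R]_(m1 - m + m2)) : 'rV[R]_(m1 + m2) := row_mx (g (om z)) (rsubmx z).
set u1 := atlas_chart (chart_at x1) x1 in Vp Wp nV gJ J1 sJ.
set u2 := atlas_chart (chart_at x2) x2 in J2.
have chx : ch x = row_mx u1 u2 by [].
have cx : c (ch x) = row_mx (u1 *m J) u2 by rewrite /c chx row_mxKl row_mxKr.
have F12 : rep f1 (chart_at x1) b u1 = F2 u2 by rewrite /F2 !repE// x12.
have omx : om (c (ch x)) = Psi u1.
  rewrite /om cx row_mxKl row_mxKr -!mulmxA JK -F12 PsiE addrC; congr (_ + _).
  by rewrite -{2}[u1]mulmx1 -mulmxBr -NE addrAC subrr add0r.
have omJ : smooth_jac om (c (ch x))
    (lin1_mx (@lsubmx R 1 (m1 - m) m2) *m K + lin1_mx (@rsubmx R 1 (m1 - m) m2) *m A2 *m P).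
  have rw : c (ch x) *m lin1_mx (@rsubmx R 1 (m1 - m) m2) = u2.
    by rewrite cx mul_rV_lin1 /= row_mxKr.
  rewrite -rw in J2; have I := smooth_jac_id (c (ch x)).
  have := smooth_jac_add
    (smooth_jac_mulmx K (smooth_jac_mulmx (lin1_mx (@lsubmx R 1 (m1 - m) m2)) I))
    (smooth_jac_mulmx P (smooth_jac_comp (smooth_jac_mulmx (lin1_mx (@rsubmx R 1 (m1 - m) m2)) I) J2)).
  rewrite !mul1mx; congr (smooth_jac _ _ _); apply/funext => z.
  by rewrite /om /F2 /= !mul_rV_lin1.
have eJ : smooth_jac e (c (ch x)) (row_mx
    (lin1_mx (@lsubmx R 1 (m1 - m) m2) *m K + lin1_mx (@rsubmx R 1 (m1 - m) m2) *m A2 *m P)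
    (lin1_mx (@rsubmx R 1 (m1 - m) m2))).
  rewrite -omx in gJ.
  have := smooth_jac_row_mx (smooth_jac_comp omJ gJ)
    (smooth_jac_mulmx (lin1_mx (@rsubmx R 1 (m1 - m) m2)) (smooth_jac_id (c (ch x)))).
  rewrite mulmx1 mul1mx; congr (smooth_jac _ _ _); apply/funext => z.
  by rewrite /e /= mul_rV_lin1.
have eJE (w : 'rV_(m1 - m + m2)) : w *m 'J e (c (ch x)) =
    row_mx (lsubmx w *m K + rsubmx w *m A2 *m P) (rsubmx w).
  by rewrite eJ.2 mul_mx_row mulmxDr !mulmxA !mul_rV_lin1.
have nb : \forall y \near x, [/\ adom (chart_at x1) y.1, adom (chart_at x2) y.2,
    adom b (f1 y.1), adom b (f2 y.2) & V (atlas_chart (chart_at x1) y.1)].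
  have nb1 : \forall y \near x1, [/\ adom (chart_at x1) y, adom b (f1 y) &
      V (atlas_chart (chart_at x1) y)].
    exact: filterS3 (chart_dom_nbhs a1) (near_continuous sf1.1 (chart_dom_nbhs b1))
      (near_chart a1 nV).
  have nb2 : \forall y \near x2, adom (chart_at x2) y /\ adom b (f2 y).
    exact: filterS2 (chart_dom_nbhs a2) (near_continuous sf2.1 (chart_dom_nbhs b2)).
  exists ([set y | [/\ adom (chart_at x1) y, adom b (f1 y) &
      V (atlas_chart (chart_at x1) y)]],
    [set y | adom (chart_at x2) y /\ adom b (f2 y)]) => //=.
  by move=> [y1 y2] /= [[y11 y12 y13] [y21 y22]].
have ec : \forall y \near x, f1 y.1 = f2 y.2 -> e (c (ch y)) = ch y.
  apply: filterS nb => y [y11 y21 y12 y22 Vy1] y12E.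
  have chE : ch y = row_mx (atlas_chart (chart_at x1) y.1)
    (atlas_chart (chart_at x2) y.2) by [].
  rewrite chE /e /om /c !row_mxKl !row_mxKr -!mulmxA JK; congr row_mx.
  rewrite -[RHS]gK//; congr g; rewrite PsiE addrC; congr (_ + _).
    by rewrite /F2 !repE// y12E.
  by rewrite -{2}[atlas_chart _ y.1]mulmx1 -mulmxBr -NE addrAC subrr add0r.
have ex : e (c (ch x)) = ch x by exact: (nbhs_singleton ec).
exists c, e; split.
- apply: Cinf_at_row_mx; last by apply: Cinf_at_rsubmx; exact: Cinf_at_id.
  by apply/Cinf_at_mulmx/Cinf_at_lsubmx; exact: Cinf_at_id.
- by case: eJ.
- exact: ec.
- have ne := near_continuous (Cinf_at_continuous eJ.1).
  rewrite ex in ne; have ax : adom (chart_at x) x by exact: adom_at.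
  have no := near_continuous (Cinf_at_continuous omJ.1); rewrite omx in no.
  have nW : \forall u \near Psi u1, (Psi @` V) u by exact: open_nbhs_nbhs.
  have nch := near_chart_inv ax nb.
  apply: filterS3 (ne _ nch) (ne _ (near_chart_invK ax)) (no _ nW).
  move=> z [y11 y21 y12 y22 Vy1] ezE [u Vu uz].
  set y := chart_inv _ (e z) in y11 y21 y12 y22 Vy1 ezE *.
  have [e1 e2] : atlas_chart (chart_at x1) y.1 = g (om z) /\
      atlas_chart (chart_at x2) y.2 = rsubmx z.
    by move: ezE => /eq_row_mx[].
  rewrite -uz gK// in e1.
  split.
    apply: (chart_inj y12 y22).
    rewrite -(repE f1 b y11) -(repE f2 b y21) e1 e2 -PsiA uz /om mulmxDl.
    by rewrite -!mulmxA KA0 PA mulmx0 mulmx1 add0r.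
  rewrite /c /e row_mxKl row_mxKr -uz gK//.
  rewrite JE [u *m _]mulmxA -PsiN uz /om mulmxDl -(mulmxA _ K) KN.
  by rewrite -(mulmxA _ P) PN mulmx0 addr0 -mulmxA KK mulmx1 hsubmxK.
- split=> [v v12|w].
    exists (row_mx (lsubmx v *m J) (rsubmx v)).
    rewrite eJE row_mxKl row_mxKr -v12 -!mulmxA JK -mulmxDr addrC NE mulmx1.
    exact: hsubmxK.
  rewrite eJE -row_mx0 => /eq_row_mx[]; move=> + w2; rewrite w2 !mul0mx addr0 => w1.
  rewrite -[w]hsubmxK w2 -[lsubmx w]mulmx1 -KK mulmxA w1 mul0mx.
  exact: row_mx0.
Qed.

End pullback_param.

(** Supplies the manifold over which essential surjectivity is stated. *)
Theorem good_pullback_exists (R : realType) m1 m2 m (M1 : manifold R m1)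
    (M2 : manifold R m2) (M : manifold R m) (f1 : M1 -> M) (f2 : M2 -> M) :
  submersion f1 -> smooth f2 -> exists (k : nat) (Q : manifold R k)
    (q1 : Q -> M1) (q2 : Q -> M2), good_pullback f1 f2 q1 q2.
Proof.
move=> /submersionP[sf1 f1f] /smoothP sf2.
pose A := prod_manifold M1 M2; pose X : set A := fibre_product f1 f2.
pose ch (x : A) := atlas_chart (chart_at x).
pose good (x : A) (ce : ('rV[R]_(m1 + m2) -> 'rV[R]_(m1 - m + m2)) *
    ('rV[R]_(m1 - m + m2) -> 'rV[R]_(m1 + m2))) := let: (c, e) := ce in
  [/\ Cinf_at c (ch x x), Cinf_at e (c (ch x x)),
    (\forall y \near x, f1 y.1 = f2 y.2 -> e (c (ch x y)) = ch x y),
    (\forall z \near c (ch x x), f1 (chart_inv (ch x) (e z)).1 =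
       f2 (chart_inv (ch x) (e z)).2 /\ c (e z) = z) &
    (forall v : 'rV_(m1 + m2),
       lsubmx v *m mjac f1 x.1 = rsubmx v *m mjac f2 x.2 ->
       exists w : 'rV_(m1 - m + m2), w *m 'J e (c (ch x x)) = v) /\
    (forall w : 'rV_(m1 - m + m2), w *m 'J e (c (ch x x)) = 0 -> w = 0)].
have goodE (x : A) : exists ce, X x -> good x ce.
  have [Xx|nX] := pselect (X x); last by exists (fun=> 0, fun=> 0).
  case: x Xx => x1 x2 Xx.
  have [c [e ceP]] := pullback_param (f1f x1) (sf1 x1) (sf2 x2) Xx.
  by exists (c, e).
have [ce ceP] := choice goodE.
pose c x := (ce x).1; pose e x := (ce x).2.
have {}ceP x : X x -> good x (c x, e x).
  by move=> /ceP; rewrite /c /e; case: (ce x).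
have [S [i [iX iS iO si Ji]]] := @submanifold_exists R (m1 + m2) (m1 - m + m2)
  A X c e (fun x Xx => let: And5 h _ _ _ _ := ceP x Xx in h)
  (fun x Xx => let: And5 _ h _ _ _ := ceP x Xx in h)
  (fun x Xx => let: And5 _ _ h _ _ := ceP x Xx in h)
  (fun x Xx => let: And5 _ _ _ h _ := ceP x Xx in h).
exists (m1 - m + m2)%N, S, (fun q => (i q).1), (fun q => (i q).2).
have s1 q : smooth_at (fun q => (i q).1) q.
  exact: (smooth_at_comp (si q) (@smooth_at_fst _ _ _ M1 M2 (i q))).
have s2 q : smooth_at (fun q => (i q).2) q.
  exact: (smooth_at_comp (si q) (@smooth_at_snd _ _ _ M1 M2 (i q))).
have jac q (v : 'rV_(m1 - m + m2)) :
    v *m mjac (fun q => (i q).1) q = lsubmx (v *m mjac i q) /\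
    v *m mjac (fun q => (i q).2) q = rsubmx (v *m mjac i q).
  have E1 := mjac_comp (si q) (@smooth_at_fst _ _ _ M1 M2 (i q)).
  have E2 := mjac_comp (si q) (@smooth_at_snd _ _ _ M1 M2 (i q)).
  split; [apply: (etrans (congr1 (mulmx v) E1))|
    apply: (etrans (congr1 (mulmx v) E2))]; rewrite mulmxA.
    exact: mjac_fst.
  exact: mjac_snd.
have jacP q := let: And5 _ _ _ _ h := ceP _ (iX q).1 in h.
apply/good_pullbackP; split=> //.
- split.
  + by move=> p; have [] := iX p.
  + move=> p q e1 e2; apply: (iX q).2; exact: injective_projections.
  + by move=> a b ab; have [q qE] := iS (a, b) ab; exists q; rewrite qE.
  + move=> p W nW; have := iO p W nW; case: (i p) => a b.
    apply: filterS => z Hz /Hz[q Wq <-]; by exists q.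
- move=> p v v1 v2; have [j1 j2] := jac p v.
  have [_ inj] := jacP p; apply: inj; rewrite -Ji.
  by rewrite -[LHS]hsubmxK -j1 -j2 v1 v2 row_mx0.
- move=> p v1 v2; split=> [v12|[v <- <-]].
    have [surj _] := jacP p; have [|v vE] := surj (row_mx v1 v2).
      by rewrite row_mxKl row_mxKr.
    exists v; have [j1 j2] := jac p v; [rewrite j1|rewrite j2];
      by rewrite Ji vE ?row_mxKl ?row_mxKr.
  have E1 := mjac_comp (s1 p) (sf1 (i p).1).
  have E2 := mjac_comp (s2 p) (sf2 (i p).2).
  have fE : f1 \o (fun q => (i q).1) = f2 \o (fun q => (i q).2).
    by apply/funext => q; have [] := iX q.
  have E := congr1 (fun f => mjac f p) fE.
  rewrite -!mulmxA; congr (_ *m _).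
  exact: etrans (esym E1) (etrans E E2).
Qed.

(** * Lie groupoids *)

(** Each rank is the dimension of one kernel minus that of the common kernel, and full rank gives
    the two kernels the same dimension. *)
Lemma rank_kermx_sym (F : fieldType) n m (A B : 'M[F]_(n, m)) :
  row_full A -> row_full B -> \rank (kermx A *m B) = \rank (kermx B *m A).
Proof.
move=> Af Bf.
have E1 := mxrank_mul_ker (kermx A) B; have E2 := mxrank_mul_ker (kermx B) A.
have rk : \rank (kermx A) = \rank (kermx B).
  by rewrite !mxrank_ker (eqP Af) (eqP Bf).
by apply/eqP; rewrite -(eqn_add2r (\rank (kermx A :&: kermx B)%MS)) E1 rk -E2 capmxC.
Qed.

Lemma mulmx_chain (F : pzRingType) k a b c d (v : 'M[F]_(k, a))
    (A : 'M[F]_(a, b)) (B : 'M[F]_(b, d)) (C : 'M[F]_(a, c)) (D : 'M[F]_(c, d)) :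
  A *m B = C *m D -> v *m A *m B = v *m C *m D.
Proof. by rewrite -!mulmxA => ->. Qed.

Section groupoid.
Variables (R : realType) (G : lie_groupoid R).
Local Notation ds g := (mjac (@src R G) g).
Local Notation dt g := (mjac (@tgt R G) g).

Lemma src_at (g : arr G) : smooth_at (@src R G) g.
Proof. by have /submersionP[] := src_submersion G. Qed.
Lemma tgt_at (g : arr G) : smooth_at (@tgt R G) g.
Proof. by have /submersionP[] := tgt_submersion G. Qed.
Lemma src_full (g : arr G) : row_full (ds g).
Proof. by have /submersionP[] := src_submersion G. Qed.
Lemma tgt_full (g : arr G) : row_full (dt g).
Proof. by have /submersionP[] := tgt_submersion G. Qed.
Lemma ginv_at (g : arr G) : smooth_at (@ginv R G) g.
Proof. by have /smoothP := ginv_smooth G. Qed.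
Lemma gunit_at (x : obj G) : smooth_at (@gunit R G) x.
Proof. by have /smoothP := gunit_smooth G. Qed.

Lemma gmulKg (g h : arr G) : src g = tgt h -> gmul (ginv g) (gmul g h) = h.
Proof.
by move=> gh; rewrite gmulA ?src_ginv// gmulV gh gunitM.
Qed.

Lemma gmulgI (g h h' : arr G) : src g = tgt h -> src g = tgt h' ->
  gmul g h = gmul g h' -> h = h'.
Proof. by move=> gh gh' E; rewrite -(gmulKg gh) E gmulKg. Qed.

Lemma ginvK (g : arr G) : ginv (ginv g) = g.
Proof.
apply: (@gmulgI (ginv g)); rewrite ?(src_ginv, tgt_ginv)//.
by rewrite gmul_ginv gmulV tgt_ginv.
Qed.

Section multiplication.
Variables (k : nat) (P : manifold R k) (p1 p2 : P -> arr G).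
Hypothesis Ppb : good_pullback (@src R G) (@tgt R G) p1 p2.
Let mu p := gmul (p1 p) (p2 p).
Hypothesis mu_smooth : smooth mu.

Let mu_at p : smooth_at mu p. Proof. by have /smoothP := mu_smooth. Qed.
Let p1_at p : smooth_at p1 p. Proof. by have /good_pullbackP[] := Ppb. Qed.
Let p2_at p : smooth_at p2 p. Proof. by have /good_pullbackP[] := Ppb. Qed.
Let p12 p : src (p1 p) = tgt (p2 p).
Proof. by have /good_pullbackP[_ _ [h _ _ _] _ _] := Ppb. Qed.

(** A composable pair of tangent vectors is tangent to [P]; the last two equations differentiate the
    formulas for the source and the target of a product. *)
Lemma mul_tangent p (a b : 'rV[R]_(arr_dim G)) :
  a *m ds (p1 p) = b *m dt (p2 p) -> exists v : 'rV_k,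
  [/\ v *m mjac p1 p = a, v *m mjac p2 p = b,
      v *m mjac mu p *m ds (mu p) = b *m ds (p2 p) &
      v *m mjac mu p *m dt (mu p) = a *m dt (p1 p)].
Proof.
move=> ab; have /good_pullbackP[_ _ _ _ ex] := Ppb.
have [v va vb] := (ex p a b).1 ab; exists v; split; [exact: va|exact: vb| |].
  have E1 := mjac_comp (mu_at p) (src_at (mu p)).
  have E2 := mjac_comp (p2_at p) (src_at (p2 p)).
  have fE : @src R G \o mu = @src R G \o p2.
    by apply/funext => q; rewrite /= src_gmul.
  have E := congr1 (fun f => mjac f p) fE.
  by rewrite -vb; exact: (mulmx_chain v (etrans (esym E1) (etrans E E2))).
have E1 := mjac_comp (mu_at p) (tgt_at (mu p)).
have E2 := mjac_comp (p1_at p) (tgt_at (p1 p)).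
have fE : @tgt R G \o mu = @tgt R G \o p1.
  by apply/funext => q; rewrite /= tgt_gmul.
have E := congr1 (fun f => mjac f p) fE.
by rewrite -va; exact: (mulmx_chain v (etrans (esym E1) (etrans E E2))).
Qed.

(** The self-map [L] of [P] sending [(g, h)] to the pair of the inverse of [g] and the product [gh]
    recovers [h] as the product of its value. The derivative of [L] kills [v] because both
    components of [L] do. *)
Lemma mul_tangent_inj p (v : 'rV_k) :
  v *m mjac p1 p = 0 -> v *m mjac mu p = 0 -> v *m mjac p2 p = 0.
Proof.
move=> v1 vm; have /good_pullbackP[_ _ [_ _ onto _] inj _] := Ppb.
have LP q : exists q', p1 q' = ginv (p1 q) /\ p2 q' = mu q.
  have [|q' e1 e2] := onto (ginv (p1 q)) (mu q); last by exists q'.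
  by rewrite src_ginv tgt_gmul.
have [L LE] := choice LP.
have L1 : p1 \o L = @ginv R G \o p1 by apply/funext => q; have [] := LE q.
have L2 : p2 \o L = mu by apply/funext => q; have [] := LE q.
have L3 : mu \o L = p2.
  by apply/funext => q; have [e1 e2] := LE q; rewrite /mu /= e1 e2 gmulKg.
have si1 : smooth_at (p1 \o L) p.
  by rewrite L1; apply: smooth_at_comp; [exact: p1_at|exact: ginv_at].
have sL : smooth_at L p.
  by apply: (good_pullback_lift Ppb) => //; rewrite L2.
have vL : v *m mjac L p = 0.
  apply: (inj (L p)).
    have E1 := mjac_comp sL (p1_at (L p)).
    have E2 := mjac_comp (p1_at p) (ginv_at (p1 p)).
    have E := congr1 (fun f => mjac f p) L1.
    rewrite -mulmxA; apply: (etrans (congr1 (mulmx v) (etrans (esym E1) (etrans E E2)))).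
    by rewrite mulmxA v1 mul0mx.
  have E1 := mjac_comp sL (p2_at (L p)).
  have E := congr1 (fun f => mjac f p) L2.
  by rewrite -mulmxA; apply: (etrans (congr1 (mulmx v) (etrans (esym E1) E))).
have E1 := mjac_comp sL (mu_at (L p)).
have E := congr1 (fun f => mjac f p) L3.
apply: (etrans (congr1 (mulmx v) (etrans (esym E) E1))).
by rewrite mulmxA vL mul0mx.
Qed.

End multiplication.

(** Since [a] is tangent to a source fibre, [(a, 0)] is tangent to the manifold of composable pairs,
    and [b] is its image under multiplication. *)
Lemma right_translation (g h : arr G) (a : 'rV_(arr_dim G)) : src g = tgt h ->
  a *m ds g = 0 -> exists b : 'rV_(arr_dim G),
    b *m ds (gmul g h) = 0 /\ b *m dt (gmul g h) = a *m dt g.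
Proof.
move=> gh a0; have [k [P [p1 [p2 [Ppb smu]]]]] := gmul_smooth G.
have /good_pullbackP[_ _ [_ _ onto _] _ _] := Ppb.
have [p e1 e2] := onto _ _ gh; subst g h.
have [|v [_ _ vs vt]] := @mul_tangent _ _ _ _ Ppb smu p a 0.
  by rewrite a0 mul0mx.
exists (v *m mjac (fun p => gmul (p1 p) (p2 p)) p).
by split; [exact: (etrans vs (mul0mx _ _))|exact: vt].
Qed.

(* Its row space is T_xO. *)
Definition orbit_mx (x : obj G) := kermx (ds (gunit x)) *m dt (gunit x).

Lemma kermx_mulP (F : fieldType) n m m' (A : 'M[F]_(n, m)) (B : 'M[F]_(n, m'))
    (w : 'rV_m') :
  (w <= kermx A *m B)%MS <-> exists2 v : 'rV_n, v *m A = 0 & v *m B = w.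
Proof.
split=> [/submxP[u ->]|[v vA <-]].
  exists (u *m kermx A); last exact: esym (mulmxA _ _ _).
  apply: etrans (esym (mulmxA _ _ _)) _.
  by rewrite mulmx_ker mulmx0.
by apply: submxMr; exact/sub_kermxP.
Qed.

(** Right translation by [g] takes source-fibre vectors at the unit of the target to those at [g]
    with the same image under the target derivative; translation by the inverse goes back. *)
Lemma orbit_mx_tgt (g : arr G) : (orbit_mx (tgt g) :=: kermx (ds g) *m dt g)%MS.
Proof.
apply/eqmxP/andP; split; apply/rV_subP => w /kermx_mulP[a a0 <-];
  apply/kermx_mulP.
  have [|b] := right_translation _ a0 (h := g); first by rewrite src_gunit.
  by rewrite gunitM => -[b0 bt]; exists b.
have [|b] := right_translation _ a0 (h := ginv g); first by rewrite tgt_ginv.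
by rewrite gmul_ginv => -[b0 bt]; exists b.
Qed.

Lemma ginv_tangent (g : arr G) (a : 'rV_(arr_dim G)) :
  a *m mjac (@ginv R G) g *m ds (ginv g) = a *m dt g /\
  a *m mjac (@ginv R G) g *m dt (ginv g) = a *m ds g.
Proof.
have E1 := mjac_comp (ginv_at g) (src_at (ginv g)).
have E2 := mjac_comp (ginv_at g) (tgt_at (ginv g)).
have f1 : @src R G \o @ginv R G = @tgt R G.
  by apply/funext => q; rewrite /= src_ginv.
have f2 : @tgt R G \o @ginv R G = @src R G.
  by apply/funext => q; rewrite /= tgt_ginv.
have F1 := congr1 (fun f => mjac f g) f1; have F2 := congr1 (fun f => mjac f g) f2.
split; apply: (etrans (esym (mulmxA _ _ _))).
  exact: (congr1 (mulmx a) (etrans (esym E1) F1)).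
exact: (congr1 (mulmx a) (etrans (esym E2) F2)).
Qed.

Lemma orbit_mx_src (g : arr G) : (orbit_mx (src g) :=: kermx (dt g) *m ds g)%MS.
Proof.
have E := orbit_mx_tgt (ginv g); rewrite tgt_ginv in E.
apply: (eqmx_trans E); apply/eqmxP/andP; split; apply/rV_subP => w /kermx_mulP[a a0 <-];
  apply/kermx_mulP.
  have [i1 i2] := ginv_tangent (ginv g) a; rewrite ginvK in i1 i2.
  exists (a *m mjac (@ginv R G) (ginv g)); [exact: etrans i2 a0|exact: i1].
have [i1 i2] := ginv_tangent g a.
exists (a *m mjac (@ginv R G) g); [exact: etrans i1 a0|exact: i2].
Qed.

(** The two tangent spaces are images at the same arrow [g], of one kernel by the other derivative,
    and [rank_kermx_sym] compares them. *)
Lemma rank_orbit_mx (g : arr G) :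
  \rank (orbit_mx (tgt g)) = \rank (orbit_mx (src g)).
Proof.
apply: etrans (orbit_mx_tgt g).1 _; apply: etrans _ (esym (orbit_mx_src g).1).
apply: rank_kermx_sym.
  exact: src_full.
exact: tgt_full.
Qed.

(** Stands in for a submanifold structure on the arrows with given ends: every vector of the common
    kernel is fixed by the derivative of a map into that set. *)
Lemma isotropy_retraction (g : arr G) : exists r : arr G -> arr G,
  [/\ smooth_at r g, r g = g,
    \forall h \near g, src (r h) = src g /\ tgt (r h) = tgt g &
    forall v : 'rV_(arr_dim G), v *m ds g = 0 -> v *m dt g = 0 ->
      v *m mjac r g = v].
Proof.
apply: manifold_fibre_retraction; [exact: src_at|exact: tgt_at|exact: src_full|].
move=> h hg; apply: etrans (esym (orbit_mx_tgt h).1) _.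
apply: etrans _ (orbit_mx_tgt g).1.
exact: (etrans (rank_orbit_mx h) (etrans
  (congr1 (fun x => \rank (orbit_mx x)) hg) (esym (rank_orbit_mx g)))).
Qed.

End groupoid.

(** * Groupoid maps on orbit directions and on the common kernels *)

Section groupoid_map.
Variables (R : realType) (G G' : lie_groupoid R) (phi : groupoid_map G G').
Local Notation F := (map_arr phi).
Local Notation f := (map_obj phi).
Local Notation ds g := (mjac (@src R _) g).
Local Notation dt g := (mjac (@tgt R _) g).
Local Notation n := (arr_dim G).
Local Notation n' := (arr_dim G').

Lemma map_arr_at g : smooth_at F g.
Proof. by have /smoothP := map_arr_smooth phi. Qed.
Lemma map_obj_at x : smooth_at f x.
Proof. by have /smoothP := map_obj_smooth phi. Qed.

(** The image of a unit is idempotent, and cancellation makes it a unit. *)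
Lemma map_unit x : F (gunit x) = gunit (f x).
Proof.
have su : src (F (gunit x)) = f x by rewrite map_src src_gunit.
have tu : tgt (F (gunit x)) = f x by rewrite map_tgt tgt_gunit.
apply: (@gmulgI _ _ (F (gunit x))); rewrite ?su ?tgt_gunit//.
rewrite -[in RHS]su gmul_gunit -map_mul ?src_gunit ?tgt_gunit//.
by rewrite -{1}(tgt_gunit x) gunitM.
Qed.

Lemma map_inv g : F (ginv g) = ginv (F g).
Proof.
have sF : src (F g) = tgt (F (ginv g)) by rewrite map_src map_tgt tgt_ginv.
apply: (gmulgI sF); first by rewrite tgt_ginv.
by rewrite -map_mul ?tgt_ginv// gmul_ginv gmul_ginv map_unit map_tgt.
Qed.

Lemma map_src_jac g : mjac F g *m ds (F g) = ds g *m mjac f (src g).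
Proof.
have E1 := mjac_comp (map_arr_at g) (src_at (F g)).
have E2 := mjac_comp (src_at g) (map_obj_at (src g)).
have fE : @src R G' \o F = f \o @src R G.
  by apply/funext => h; rewrite /= map_src.
by rewrite -E1 -E2 fE.
Qed.

Lemma map_tgt_jac g : mjac F g *m dt (F g) = dt g *m mjac f (tgt g).
Proof.
have E1 := mjac_comp (map_arr_at g) (tgt_at (F g)).
have E2 := mjac_comp (tgt_at g) (map_obj_at (tgt g)).
have fE : @tgt R G' \o F = f \o @tgt R G.
  by apply/funext => h; rewrite /= map_tgt.
by rewrite -E1 -E2 fE.
Qed.

Lemma map_orbit_mx x (w : 'rV_(obj_dim G)) :
  (w <= orbit_mx x)%MS -> (w *m mjac f x <= orbit_mx (f x))%MS.
Proof.
move=> /kermx_mulP[a a0 <-]; apply/kermx_mulP.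
have E1 := map_src_jac (gunit x); have E2 := map_tgt_jac (gunit x).
rewrite map_unit src_gunit in E1; rewrite map_unit tgt_gunit in E2.
exists (a *m mjac F (gunit x)); rewrite -mulmxA ?E1 ?E2 mulmxA//.
by rewrite a0 mul0mx.
Qed.

(* [b] is the image of [a] under the left translation by [g]. *)
Lemma left_translation (g h : arr G) (a : 'rV_n) : src g = tgt h ->
  a *m dt h = 0 -> exists b : 'rV_n,
  [/\ b *m ds (gmul g h) = a *m ds h, b *m dt (gmul g h) = 0,
      (b = 0 -> a = 0) &
      (a *m mjac F h = 0 -> b *m mjac F (gmul g h) = 0)].
Proof.
move=> gh a0; have [k [P [p1 [p2 [Ppb smu]]]]] := gmul_smooth G.
have [k' [P' [p1' [p2' [Ppb' smu']]]]] := gmul_smooth G'.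
have /good_pullbackP[s1 s2 [p12 _ onto _] _ _] := Ppb.
have /good_pullbackP[s1' s2' [_ _ onto' _] inj' _] := Ppb'.
have [p e1 e2] := onto _ _ gh; subst g h.
have [|v [v1 v2 vs vt]] := @mul_tangent _ _ _ _ _ _ Ppb smu p 0 a.
  by rewrite a0 mul0mx.
set mu := fun p => gmul (p1 p) (p2 p) in smu vs vt *.
rewrite -/(mu p); exists (v *m mjac mu p); split.
- exact: vs.
- by rewrite vt mul0mx.
- move=> vm; rewrite -v2.
  exact: (mul_tangent_inj Ppb smu v1 vm).
move=> aF; pose mu' p' := gmul (p1' p') (p2' p').
(* [L] lifts the pair of images under [F] to [P'], so that multiplying after [L] is [F] after
   multiplying; this makes the translation natural in the groupoid. *)
have LP q : exists q', p1' q' = F (p1 q) /\ p2' q' = F (p2 q).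
  have [|q' e1 e2] := onto' (F (p1 q)) (F (p2 q)); last by exists q'.
  by rewrite map_src map_tgt p12.
have [L LE] := choice LP.
have L1 : p1' \o L = F \o p1 by apply/funext => q; have [] := LE q.
have L2 : p2' \o L = F \o p2 by apply/funext => q; have [] := LE q.
have L3 : mu' \o L = F \o mu.
  apply/funext => q; have [e1 e2] := LE q.
  by rewrite /mu' /= e1 e2 /mu map_mul.
have mu_at : smooth_at mu p by have /smoothP := smu.
have mu'_at q : smooth_at mu' q by have /smoothP := smu'.
have sL : smooth_at L p.
  apply: (good_pullback_lift Ppb').
    rewrite L1; apply: smooth_at_comp; [exact: s1|exact: map_arr_at].
  rewrite L2; apply: smooth_at_comp; [exact: s2|exact: map_arr_at].
have vL : v *m mjac L p = 0.
  apply: (inj' (L p)); rewrite -mulmxA.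
    rewrite -(mjac_comp sL (s1' (L p))) L1 (mjac_comp (s1 p) (map_arr_at _)).
    by rewrite mulmxA v1 mul0mx.
  rewrite -(mjac_comp sL (s2' (L p))) L2 (mjac_comp (s2 p) (map_arr_at _)).
  by rewrite mulmxA v2 aF.
rewrite -mulmxA -(mjac_comp mu_at (map_arr_at _)) -L3.
by rewrite (mjac_comp sL (mu'_at _)) mulmxA vL mul0mx.
Qed.

(* Its row space is the tangent space at [g] of the set of arrows with the
   source and the target of [g]. *)
Definition isotropy_mx (K : lie_groupoid R) (g : arr K) :=
  (kermx (ds g) :&: kermx (dt g))%MS.

Lemma isotropy_mxP (K : lie_groupoid R) (g : arr K) (v : 'rV_(arr_dim K)) :
  (v <= isotropy_mx g)%MS <-> v *m ds g = 0 /\ v *m dt g = 0.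
Proof.
rewrite sub_capmx; split=> [/andP[/sub_kermxP ? /sub_kermxP ?]//|[? ?]].
by apply/andP; split; apply/sub_kermxP.
Qed.

(** Rank-nullity for the target derivative on the source kernel: the orbit dimension and this rank
    have a constant sum, and the orbit dimension depends only on the target. *)
Lemma rank_isotropy_mx (K : lie_groupoid R) (g : arr K) :
  \rank (isotropy_mx g) = \rank (isotropy_mx (gunit (tgt g))).
Proof.
have H (h : arr K) : (\rank (orbit_mx (tgt h)) + \rank (isotropy_mx h))%N =
    (arr_dim K - obj_dim K)%N.
  rewrite (orbit_mx_tgt h).1 mxrank_mul_ker mxrank_ker.
  by rewrite (eqP (src_full h)).
apply/eqP; rewrite -(eqn_add2l (\rank (orbit_mx (tgt g)))) H.
by rewrite -{1}(tgt_gunit (tgt g)) H.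
Qed.

Lemma map_isotropy_mx g (v : 'rV_n) :
  (v <= isotropy_mx g)%MS -> (v *m mjac F g <= isotropy_mx (F g))%MS.
Proof.
move=> /isotropy_mxP[vs vt]; apply/isotropy_mxP.
rewrite -!mulmxA map_src_jac map_tgt_jac !mulmxA vs vt.
by rewrite !mul0mx.
Qed.

Lemma isotropy_map_inj g :
  (forall v : 'rV_n, (v <= isotropy_mx (gunit (src g)))%MS ->
     v *m mjac F (gunit (src g)) = 0 -> v = 0) ->
  forall v : 'rV_n, (v <= isotropy_mx g)%MS -> v *m mjac F g = 0 -> v = 0.
Proof.
move=> inj v /isotropy_mxP[vs vt] vF.
have [|b [bs bt b0 bF]] := left_translation (g := ginv g) _ vt.
  by rewrite src_ginv.
rewrite gmulV in bs bt b0 bF.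
apply: b0; apply: inj; last exact: bF.
by apply/isotropy_mxP; rewrite bs.
Qed.

(** Injectivity gives the image the dimension of [isotropy_mx g], the same as at the unit of the
    target; surjectivity at that unit makes this at least the dimension of [isotropy_mx (F g)]. *)
Lemma isotropy_map_onto g :
  (forall v : 'rV_n, (v <= isotropy_mx g)%MS -> v *m mjac F g = 0 -> v = 0) ->
  (forall w : 'rV_n', (w <= isotropy_mx (gunit (f (tgt g))))%MS ->
     exists2 v : 'rV_n, (v <= isotropy_mx (gunit (tgt g)))%MS &
       v *m mjac F (gunit (tgt g)) = w) ->
  forall w : 'rV_n', (w <= isotropy_mx (F g))%MS ->
    exists2 v : 'rV_n, (v <= isotropy_mx g)%MS & v *m mjac F g = w.
Proof.
move=> inj onto w wk.
have sub : (isotropy_mx g *m mjac F g <= isotropy_mx (F g))%MS.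
  apply/row_subP => i; rewrite row_mul; apply: map_isotropy_mx; exact: row_sub.
have rk : (\rank (isotropy_mx (F g)) <= \rank (isotropy_mx g *m mjac F g))%N.
  have -> : \rank (isotropy_mx g *m mjac F g) = \rank (isotropy_mx g).
    have := mxrank_mul_ker (isotropy_mx g) (mjac F g).
    have -> : (isotropy_mx g :&: kermx (mjac F g))%MS = 0.
      apply/row_matrixP => i; rewrite row0.
      have := row_sub i (isotropy_mx g :&: kermx (mjac F g))%MS.
      by rewrite sub_capmx => /andP[Hk /sub_kermxP]; exact: inj.
    by rewrite mxrank0 addn0.
  rewrite (rank_isotropy_mx g) (rank_isotropy_mx (F g)) map_tgt.
  apply: leq_trans (mxrankM_maxl (isotropy_mx (gunit (tgt g))) (mjac F (gunit (tgt g)))).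
  apply/mxrankS/row_subP => i; have [v vk <-] := onto _ (row_sub i _).
  exact: submxMr.
have := mxrank_leqif_sup sub => -[_ E].
have : (isotropy_mx (F g) <= isotropy_mx g *m mjac F g)%MS.
  by rewrite -E eqn_leq rk mxrankS.
move=> /(submx_trans wk)/submxP[u ->]; exists (u *m isotropy_mx g).
  exact: submxMl.
by rewrite mulmxA.
Qed.

(** * The derivative of an isomorphism of isotropy groups *)

Section isotropy_iso.
Variable x : obj G.
Hypothesis iso : isotropy_iso phi x.
Let e := gunit x.
Let e' := gunit (f x).
Let Fe : F e = e' := map_unit x.

(** Near the unit, [F0] inverts [F] on the isotropy group only; its other values are unconstrained,
    so it is used below only after a retraction. *)
Let extension : exists F0 : arr G' -> arr G, [/\ smooth_at F0 e', F0 e' = e,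
  \forall h \near e', isotropy (f x) h -> isotropy x (F0 h) /\ F (F0 h) = h &
  \forall h \near e', forall g, isotropy x g -> F g = h -> F0 h = g].
Proof.
have [[Fk Finj Fonto] _ _ [psi spsi psiK]] := iso.
have [|U [F0 [oU Ue sF0 F0E]]] := spsi e'; first by rewrite /isotropy /= src_gunit tgt_gunit.
have nU : \forall h \near e', U h by exact: open_nbhs_nbhs.
have ek : isotropy x e by rewrite /isotropy /= src_gunit tgt_gunit.
have e'k : isotropy (f x) e' by rewrite /isotropy /= src_gunit tgt_gunit.
have ext h : U h -> forall g, isotropy x g -> F g = h -> F0 h = g.
  move=> Uh g gk gh; rewrite F0E ?psiK// -?gh ?psiK//.
  by split; [exact: Fk|rewrite gh].
exists F0; split.
- exact: ((smooth_inP F0 oU).1 sF0 e' Ue).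
- by apply: ext; last exact: Fe.
- apply: filterS nU => h Uh hk; have [g gk gh] := Fonto h hk.
  by rewrite (ext h Uh g gk gh).
- by apply: filterS nU => h Uh; exact: ext.
Qed.

(** Near the unit the retraction [r] equals [F0] after [F] after [r]. Differentiated along [v],
    which [r] fixes, this recovers [v] from its image. *)
Lemma isotropy_iso_inj (v : 'rV_n) :
  (v <= isotropy_mx e)%MS -> v *m mjac F e = 0 -> v = 0.
Proof.
have [F0 [sF0 F0e _ F0F]] := extension.
move=> /isotropy_mxP[vs vt] vF.
have [r [sr re rk dr]] := isotropy_retraction e.
have sF : smooth_at F (r e) by exact: map_arr_at.
have sFr := smooth_at_comp sr sF.
have Fre : F (r e) = e' by rewrite re Fe.
have sF0' : smooth_at F0 ((F \o r) e) by rewrite /= Fre.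
have E : \forall h \near e, r h = (F0 \o (F \o r)) h.
  have nF := near_continuous sFr.1; rewrite /= Fre in nF.
  apply: filterS2 rk (nF _ F0F) => h [hs ht] F0h /=.
  by rewrite (F0h (r h))//; rewrite /isotropy /= hs ht src_gunit tgt_gunit.
have := eq_mjac E sr; rewrite (mjac_comp sFr sF0') (mjac_comp sr sF) re => Er.
by rewrite -(dr v vs vt) Er !mulmxA (dr v vs vt) vF mul0mx.
Qed.

(** The preimage is the image of [w] under the derivative of [F0]. It lies in the common kernel
    because source and target are constant along [F0] after [r], and it maps to [w] because [F]
    after that composite is [r]. *)
Lemma isotropy_iso_onto (w : 'rV_n') : (w <= isotropy_mx e')%MS ->
  exists2 v : 'rV_n, (v <= isotropy_mx e)%MS & v *m mjac F e = w.
Proof.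
have [F0 [sF0 F0e FF0 _]] := extension.
move=> /isotropy_mxP[ws wt].
have [r [sr re rk dr]] := isotropy_retraction e'.
have sF0' : smooth_at F0 (r e') by rewrite re.
have sF0r := smooth_at_comp sr sF0'.
have F0re : (F0 \o r) e' = e by rewrite /= re.
have rk' : \forall h \near e', isotropy (f x) (r h).
  by apply: filterS rk => h [hs ht]; rewrite /isotropy /= hs ht src_gunit tgt_gunit.
have nFF0 : \forall h \near e', isotropy (f x) (r h) ->
    isotropy x (F0 (r h)) /\ F (F0 (r h)) = r h.
  by have := near_continuous sr.1; rewrite re => /(_ _ FF0).
have iso0 : \forall h \near e', isotropy x ((F0 \o r) h) /\ r h = (F \o (F0 \o r)) h.
  by apply: filterS2 rk' nFF0 => h /= hk /(_ hk)[].
have jac0 : mjac (F0 \o r) e' = mjac r e' *m mjac F0 e'.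
  by rewrite (mjac_comp sr sF0') re.
have fixw m (p : manifold R m) (q : arr G -> p) : smooth_at q e ->
    w *m mjac (q \o (F0 \o r)) e' = w *m mjac F0 e' *m mjac q e.
  move=> sq; have sq' : smooth_at q ((F0 \o r) e') by rewrite F0re.
  by rewrite (mjac_comp sF0r sq') jac0 F0re !mulmxA (dr w ws wt).
exists (w *m mjac F0 e').
  apply/isotropy_mxP; rewrite -!fixw; [|exact: tgt_at|exact: src_at].
  have cst (q : arr G -> obj G) y : smooth_at q e ->
      (forall h, isotropy x h -> q h = y) -> w *m mjac (q \o (F0 \o r)) e' = 0.
    move=> sq qy; have E : \forall h \near e', (q \o (F0 \o r)) h = y.
      by apply: filterS iso0 => h [/qy].
    have sqr : smooth_at (q \o (F0 \o r)) e'.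
      by apply: smooth_at_comp => //; rewrite F0re.
    by rewrite (eq_mjac E sqr) mjac_cst mulmx0.
  split; first by apply: (cst _ x); [exact: src_at|move=> h []].
  by apply: (cst _ x); [exact: tgt_at|move=> h []].
have E : \forall h \near e', r h = (F \o (F0 \o r)) h.
  by apply: filterS iso0 => h [].
by rewrite -fixw; [rewrite -(eq_mjac E sr) dr|exact: map_arr_at].
Qed.

End isotropy_iso.
End groupoid_map.

(** * Normal spaces and the normal representation *)

Lemma memv_img_lker (K : fieldType) (U V W : vectType K) (f : {linear U -> V})
    (g : {linear U -> W}) (w : W) :
  w \in (linfun g @: lker (linfun f))%VS <-> exists2 u, f u = 0 & g u = w.
Proof.
split=> [/memv_imgP[u]|[u fu <-]].
  by rewrite memv_ker lfunE => /eqP fu ->; exists u; rewrite ?lfunE.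
by apply/memv_imgP; exists u; rewrite ?memv_ker lfunE //; apply/eqP.
Qed.

Section normal_space.
Variables (R : realType) (G : lie_groupoid R).
Local Notation ds g := (mjac (@src R _) g).
Local Notation dt g := (mjac (@tgt R _) g).

Lemma orbit_tangentP x (v : tangent x) :
  v \in orbit_tangent x <-> ((v : 'rV_(obj_dim G)) <= orbit_mx x)%MS.
Proof.
have E1 := @mdiffE _ _ _ _ _ (@src R G) (gunit x).
have E2 := @mdiffE _ _ _ _ _ (@tgt R G) (gunit x).
apply: iff_trans (memv_img_lker _ _ _) _.
split=> [[u us ut]|/kermx_mulP[u us ut]].
  apply/kermx_mulP; exists u.
    exact: etrans (esym (E1 u)) us.
  exact: etrans (esym (E2 u)) ut.
exists u; first exact: etrans (E1 u) us.
exact: etrans (E2 u) ut.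
Qed.

Lemma normal_eq x (v w : tangent x) :
  \pi_(quotv (orbit_tangent x)) v = \pi_(quotv (orbit_tangent x)) w <->
  ((v - w : 'rV_(obj_dim G)) <= orbit_mx x)%MS.
Proof. by apply: iff_trans (quotv_eq _ _ _) _; exact: orbit_tangentP. Qed.

Lemma normal_repr x (v : tangent x) :
  ((repr (\pi_(quotv (orbit_tangent x)) v) - v : 'rV_(obj_dim G)) <= orbit_mx x)%MS.
Proof. by apply/normal_eq; rewrite reprK. Qed.

(** Two admissible lifts differ by a vector whose source derivative is tangent to the orbit.
    Subtracting a vector of the target kernel with that source derivative keeps the target
    derivative and lands in the source kernel, so the targets agree modulo the orbit. *)
Lemma normal_actionE (x y : obj G) (g : arr G) (a : 'rV_(arr_dim G))
    (v : tangent x) : src g = x -> tgt g = y ->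
  ((a *m ds g - v : 'rV_(obj_dim G)) <= orbit_mx x)%MS ->
  normal_action y g (\pi_(quotv (orbit_tangent x)) v) =
  \pi_(quotv (orbit_tangent y)) (a *m dt g : tangent y).
Proof.
move=> gx gy; subst x y.
move=> av; rewrite /normal_action; set r := repr _.
have rv := normal_repr v; rewrite -/r in rv.
(* The default 0 of [xget] does not occur, since the source map is a submersion. *)
case: xgetP => [xi _ /= xiE|no]; last first.
  have [b bE] := (row_full_surjP _).1 (src_full g) r.
  by case: (no b); apply: etrans bE; exact: mdiffE.
apply/normal_eq; rewrite mdiffE -mulmxBl.
have xid : xi *m ds g = r by apply: etrans xiE; rewrite mdiffE.
have : ((xi - a) *m ds g <= orbit_mx (src g))%MS.
  rewrite mulmxBl xid.
  have -> : (r : 'rV_(obj_dim G)) - a *m ds g = (r - v) - (a *m ds g - v).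
    by rewrite opprB addrA subrK.
  by rewrite addmx_sub// eqmx_opp.
rewrite orbit_mx_src => /kermx_mulP[b bt bs].
rewrite orbit_mx_tgt; apply/kermx_mulP; exists (xi - a - b).
  by rewrite mulmxBl bs subrr.
by rewrite [LHS]mulmxBl bt subr0.
Qed.

End normal_space.

Section normal_map.
Variables (R : realType) (G G' : lie_groupoid R) (phi : groupoid_map G G').
Variable x : obj G.
Local Notation f := (map_obj phi).
Local Notation ds g := (mjac (@src R _) g).
Local Notation dt g := (mjac (@tgt R _) g).

Lemma normal_mapE (v : tangent x) :
  normal_map phi (\pi_(quotv (orbit_tangent x)) v) =
  \pi_(quotv (orbit_tangent (f x))) (v *m mjac f x : tangent (f x)).
Proof.
rewrite /normal_map; apply/normal_eq; rewrite mdiffE -mulmxBl.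
by apply: map_orbit_mx; exact: normal_repr.
Qed.

Lemma normal_map_linear : linear (normal_map phi (x := x)).
Proof.
move=> a; elim/quotW => v; elim/quotW => w.
have E : a *: \pi_(quotv (orbit_tangent x)) v + \pi_(quotv (orbit_tangent x)) w =
   \pi_(quotv (orbit_tangent x)) (a *: v + w).
  by rewrite quotv_piD; congr (_ + _); exact: esym (quotv_piZ _ _ _).
rewrite E !normal_mapE.
have E' (b c : tangent (f x)) :
   a *: \pi_(quotv (orbit_tangent (f x))) b + \pi_(quotv (orbit_tangent (f x))) c =
   \pi_(quotv (orbit_tangent (f x))) (a *: b + c).
  by rewrite quotv_piD; congr (_ + _); exact: esym (quotv_piZ _ _ _).
rewrite E'; congr (\pi_(quotv (orbit_tangent (f x))) _).
by rewrite mulmxDl -scalemxAl.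
Qed.

Definition normal_surj := forall w : 'rV_(obj_dim G'),
  exists v : 'rV_(obj_dim G), (w - v *m mjac f x <= orbit_mx (f x))%MS.
Definition normal_inj := forall v : 'rV_(obj_dim G),
  (v *m mjac f x <= orbit_mx (f x))%MS -> (v <= orbit_mx x)%MS.

Lemma normal_map_bij :
  bijective (normal_map phi (x := x)) <-> normal_surj /\ normal_inj.
Proof.
split=> [[h hK Kh]|[su inj]].
  split=> [w|v vO].
    have := Kh (\pi_(quotv (orbit_tangent (f x))) (w : tangent (f x))).
    elim/quotW: (h _) => v; rewrite normal_mapE => /esym/normal_eq; by exists v.
  have := can_inj hK (x1 := \pi_(quotv (orbit_tangent x)) (v : tangent x))
    (x2 := \pi_(quotv (orbit_tangent x)) (0 : tangent x)).
  rewrite !normal_mapE mul0mx => H; have /normal_eq : 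
    \pi_(quotv (orbit_tangent x)) (v : tangent x) =
    \pi_(quotv (orbit_tangent x)) (0 : tangent x).
    by apply: H; apply/normal_eq; rewrite subr0.
  by rewrite subr0.
have onto q : exists p, normal_map phi (x := x) p = q.
  elim/quotW: q => w; have [v vw] := su w.
  exists (\pi_(quotv (orbit_tangent x)) (v : tangent x)).
  by rewrite normal_mapE; apply/esym/normal_eq.
have [h hE] := choice onto; exists h => // q.
have := hE (normal_map phi q); elim/quotW: q => v; elim/quotW: (h _) => w.
rewrite !normal_mapE => /normal_eq; rewrite -mulmxBl => /inj wv.
exact/normal_eq.
Qed.

(** The derivative of [phi] sends a lift of [v] at [g] to a lift of the image of [v] at the image of
    [g]. *)
Lemma normal_map_equivariant g (q : orbit_normal x) : isotropy x g ->
  normal_map phi (normal_action x g q) =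
  normal_action (f x) (map_arr phi g) (normal_map phi q).
Proof.
elim/quotW: q => v [gx gx'].
have [a aE] := (row_full_surjP _).1 (src_full g) v.
have sF : src (map_arr phi g) = f x by rewrite map_src gx.
have tF : tgt (map_arr phi g) = f x by rewrite map_tgt gx'.
rewrite (normal_actionE (a := a) gx gx'); last by rewrite aE subrr sub0mx.
rewrite !normal_mapE (normal_actionE (a := a *m mjac (map_arr phi) g) sF tF).
  congr (\pi_(quotv (orbit_tangent (f x))) _).
  by rewrite -[RHS]mulmxA map_tgt_jac gx' mulmxA.
by rewrite -mulmxA map_src_jac gx mulmxA aE subrr sub0mx.
Qed.

End normal_map.

(** * Orbit spaces *)

Section orbit_space.
Variables (R : realType) (G : lie_groupoid R).

Lemma to_orbit_eq (x y : obj G) : to_orbit x = to_orbit y <-> Defs.orbit x y.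
Proof.
split=> [/eqmodP/asboolP//|xy]; apply/eqmodP; exact/asboolP.
Qed.

Lemma to_orbitP (x y : obj G) :
  to_orbit x = to_orbit y <-> exists g : arr G, src g = x /\ tgt g = y.
Proof.
apply: iff_trans (to_orbit_eq x y) _.
by split=> [[g gx gy]|[g [gx gy]]]; exists g.
Qed.

Lemma of_orbitK (q : orbit_space G) : to_orbit (of_orbit q) = q.
Proof. exact: (@reprK _ {eq_quot (@orbit_rel R G)} q). Qed.

Lemma to_orbit_continuous : continuous (@to_orbit R G).
Proof. exact: (@pi_continuous _ {eq_quot (@orbit_rel R G)}). Qed.

Lemma orbit_space_continuous (Z : topologicalType) (h : orbit_space G -> Z) :
  continuous (h \o @to_orbit R G) -> continuous h.
Proof. by move=> ch; apply/(quotient_continuous h). Qed.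

End orbit_space.

Section orbit_map.
Variables (R : realType) (G G' : lie_groupoid R) (phi : groupoid_map G G').
Local Notation F := (map_arr phi).
Local Notation f := (map_obj phi).

Lemma orbit_map_to_orbit x : orbit_map phi (to_orbit x) = to_orbit (f x).
Proof.
have /to_orbitP[g [gx gy]] := of_orbitK (to_orbit x).
by apply/to_orbitP; exists (F g); rewrite map_src map_tgt gx gy.
Qed.

(** The third hypothesis is continuity of the inverse stated on objects: the orbits met by the image
    of a neighbourhood of [x] fill a neighbourhood of [x']. *)
Lemma orbit_map_homeo :
  (forall x y, to_orbit (f x) = to_orbit (f y) -> to_orbit x = to_orbit y) ->
  (forall x', exists x, to_orbit (f x) = to_orbit x') ->
  (forall x x' U, to_orbit (f x) = to_orbit x' -> nbhs x U ->
     \forall y' \near x', exists2 y, U y & to_orbit (f y) = to_orbit y') ->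
  homeomorphism (orbit_map phi).
Proof.
move=> inj onto op; split.
  apply: orbit_space_continuous.
  have -> : orbit_map phi \o @to_orbit R G = @to_orbit R G' \o f.
    by apply/funext => x; exact: orbit_map_to_orbit.
  move=> x; apply: continuous_comp; first by case: (map_obj_at phi x).
  exact: to_orbit_continuous.
have [h hE] := choice onto.
pose k (q : orbit_space G') := to_orbit (h (of_orbit q)).
have kE x : k (to_orbit (f x)) = to_orbit x.
  by apply: inj; rewrite hE of_orbitK.
exists k; last first.
  split=> q; first by rewrite -[q]of_orbitK orbit_map_to_orbit kE.
  by rewrite /k orbit_map_to_orbit hE of_orbitK.
apply: orbit_space_continuous => x' W nW.
have kx' : to_orbit (f (h x')) = to_orbit x' by exact: hE.
have nU : nbhs (h x') (@to_orbit R G @^-1` W).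
  apply: to_orbit_continuous; move: nW; rewrite /= -kx' kE; exact.
apply: filterS (op _ _ _ kx' nU) => y' [y Wy yy'].
by rewrite /= -yy' kE.
Qed.

Lemma homeo_orbit_inj : homeomorphism (orbit_map phi) ->
  forall x y, to_orbit (f x) = to_orbit (f y) -> to_orbit x = to_orbit y.
Proof.
move=> [_ [k _ [kK _]]] x y; rewrite -!orbit_map_to_orbit.
by move=> /(can_inj kK).
Qed.

Lemma homeo_orbit_onto : homeomorphism (orbit_map phi) ->
  forall x', exists x, to_orbit (f x) = to_orbit x'.
Proof.
move=> [_ [k _ [_ Kk]]] x'; exists (of_orbit (k (to_orbit x'))).
by rewrite -orbit_map_to_orbit of_orbitK Kk.
Qed.

End orbit_map.

Section anchor.
Variables (R : realType) (G : lie_groupoid R).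

Lemma anchor_at (g : arr G) : smooth_at (@anchor R G) g.
Proof. by apply: smooth_at_pair; [exact: tgt_at|exact: src_at]. Qed.

Lemma anchor_jac (g : arr G) (v : 'rV_(arr_dim G)) :
  v *m mjac (@anchor R G) g =
  row_mx (v *m mjac (@tgt R G) g) (v *m mjac (@src R G) g).
Proof. by rewrite -mul_mx_row -mjac_pair; [|exact: tgt_at|exact: src_at]. Qed.

Variables (G' : lie_groupoid R) (phi : groupoid_map G G').
Local Notation f := (map_obj phi).

Definition map_obj2 (p : prod_manifold (obj G) (obj G)) :
  prod_manifold (obj G') (obj G') := (f p.1, f p.2).

Let map_fst (p : prod_manifold (obj G) (obj G)) :=
  smooth_at_comp (smooth_at_fst p) (map_obj_at phi p.1).
Let map_snd (p : prod_manifold (obj G) (obj G)) :=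
  smooth_at_comp (smooth_at_snd p) (map_obj_at phi p.2).

Lemma map_obj2_at p : smooth_at map_obj2 p.
Proof. exact: (smooth_at_pair (map_fst p) (map_snd p)). Qed.

Lemma map_obj2_jac p (v : 'rV_(obj_dim G + obj_dim G)) :
  v *m mjac map_obj2 p =
  row_mx (lsubmx v *m mjac f p.1) (rsubmx v *m mjac f p.2).
Proof.
have E : mjac map_obj2 p = _ := mjac_pair (map_fst p) (map_snd p).
rewrite E.
rewrite (mjac_comp (smooth_at_fst p) (map_obj_at phi p.1)).
rewrite (mjac_comp (smooth_at_snd p) (map_obj_at phi p.2)).
by rewrite mul_mx_row !mulmxA mjac_fst mjac_snd.
Qed.

End anchor.

(** * Morita maps *)

Section morita_to_iso.
Variables (R : realType) (G G' : lie_groupoid R) (phi : groupoid_map G G').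
Local Notation F := (map_arr phi).
Local Notation f := (map_obj phi).
Local Notation ds g := (mjac (@src R _) g).
Local Notation dt g := (mjac (@tgt R _) g).

Lemma fully_faithful_orbit_inj : fully_faithful phi ->
  forall x y, to_orbit (f x) = to_orbit (f y) -> to_orbit x = to_orbit y.
Proof.
move=> /good_pullbackP[_ _ [_ _ onto _] _ _] x y /to_orbitP[g' [gx gy]].
have [|g _ [gt gs]] := onto g' (y, x); first by rewrite /anchor gx gy.
by apply/to_orbitP; exists g.
Qed.

(** If the image of [v] is the target derivative of some [a] in the source kernel at the unit, then
    [a] and [(v, 0)] are compatible; exactness gives an arrow vector over [(v, 0)], so [v] is
    tangent to the orbit. *)
Lemma fully_faithful_normal_inj x : fully_faithful phi -> normal_inj phi x.
Proof.
move=> /good_pullbackP[_ _ _ _ ex] v /kermx_mulP[a a0 av].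
have e0 := map_unit phi x.
have [|w _ wv] := (ex (gunit x) (a : 'rV_(arr_dim G')) (row_mx v 0)).1.
  rewrite e0 anchor_jac (map_obj2_jac phi) row_mxKl row_mxKr mul0mx a0 av.
  by rewrite /= tgt_gunit.
move: wv; rewrite anchor_jac => /eq_row_mx[wt ws].
by apply/kermx_mulP; exists w.
Qed.

(** At the point of [Q] given by the unit and [x], the submersion lifts [w] to a vector [a] at the
    unit whose source derivative is the image of some [v]. Subtracting from [a] the unit section of
    that image leaves a source-kernel vector with target [w] minus the image of [v]. *)
Lemma essentially_surjective_normal_surj x :
  essentially_surjective phi -> normal_surj phi x.
Proof.
move=> [k [Q [q1 [q2 [Qpb /submersionP[sQ fQ] _]]]]].
have /good_pullbackP[s1 s2 [q12 _ onto _] _ ex] := Qpb.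
have [z z1 z2] := onto (gunit (f x)) x (src_gunit (f x)).
move=> w; have [v vw] := (row_full_surjP _).1 (fQ z) w.
have E := mjac_comp (s1 z) (tgt_at (q1 z)).
have {}vw : v *m mjac q1 z *m dt (gunit (f x)) = w.
  by rewrite -z1 -mulmxA -E.
have vs : v *m mjac q1 z *m ds (gunit (f x)) = v *m mjac q2 z *m mjac f x.
  by rewrite -z1 -[in RHS]z2; apply/(ex z); exists v.
exists (v *m mjac q2 z); rewrite -vs; set a := v *m mjac q1 z in vw vs *.
have Es := mjac_comp (gunit_at (f x)) (src_at (gunit (f x))).
have Et := mjac_comp (gunit_at (f x)) (tgt_at (gunit (f x))).
have idE (h : arr G' -> obj G') (hu : h \o @gunit R G' = id) :
    mjac (h \o @gunit R G') (f x) = 1%:M by rewrite hu mjac_id.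
have su : @src R G' \o @gunit R G' = id.
  by apply/funext => y; rewrite /= src_gunit.
have tu : @tgt R G' \o @gunit R G' = id.
  by apply/funext => y; rewrite /= tgt_gunit.
rewrite (idE _ su) in Es; rewrite (idE _ tu) in Et.
apply/kermx_mulP; exists (a - a *m ds (gunit (f x)) *m mjac (@gunit R G') (f x)).
  by rewrite mulmxBl -(mulmxA _ (mjac _ (f x))) -Es mulmx1 subrr.
by rewrite mulmxBl -(mulmxA _ (mjac _ (f x))) -Et mulmx1 vw.
Qed.

Lemma essentially_surjective_open : essentially_surjective phi ->
  forall x x' U, to_orbit (f x) = to_orbit x' -> nbhs x U ->
     \forall y' \near x', exists2 y, U y & to_orbit (f y) = to_orbit y'.
Proof.
move=> [k [Q [q1 [q2 [Qpb /submersionP[sQ fQ] _]]]]] x x' U.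
have /good_pullbackP[s1 s2 [q12 _ onto _] _ ex] := Qpb.
move=> /to_orbitP[g [gx gy]] nU; have [z z1 z2] := onto g x gx.
have nz : nbhs z (q2 @^-1` U) by apply: (s2 z).1; rewrite z2.
have := submersion_open (sQ z) (fQ z) nz; rewrite /= z1 gy.
apply: filterS => y' [z' Uz' z'y]; exists (q2 z') => //.
by apply/to_orbitP; exists (q1 z').
Qed.

Lemma fully_faithful_isotropy_iso x : fully_faithful phi -> isotropy_iso phi x.
Proof.
move=> /good_pullbackP[sF sa [_ inj onto open] jinj _].
have lift g' : exists g, isotropy (f x) g' -> isotropy x g /\ F g = g'.
  have [[g's g't]|no] := pselect (isotropy (f x) g'); last by exists (gunit x).
  have [|g gF [gt gs]] := onto g' (x, x); first by rewrite /anchor g's g't.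
  by exists g.
have [psi psiP] := choice lift.
have Finj g h : isotropy x g -> isotropy x h -> F g = F h -> g = h.
  by move=> [gs gt] [hs ht] gh; apply: inj => //; rewrite /anchor gs gt hs ht.
have Fx g : isotropy x g -> isotropy (f x) (F g).
  by move=> [gs gt]; rewrite /isotropy /= map_src map_tgt gs gt.
split.
- split=> [g /Fx//|g h /set_mem gx /set_mem hx|g' g'x]; first exact: Finj.
  by have [gx gE] := psiP _ g'x; exists (psi g').
- move=> g h /set_mem[gs gt] /set_mem[hs ht]; apply: map_mul.
  by rewrite gs ht.
- move=> g gx; exists setT, F; split=> //; first exact: openT.
  exact: map_arr_smooth.
exists psi => [g' g'x|g gx]; last first.
  by have [px pF] := psiP _ (Fx g gx); exact: Finj.
have [g0x g0F] := psiP _ g'x; set g0 := psi g' in g0x g0F.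
pose e g : prod_manifold (arr G') (prod_manifold (obj G) (obj G)) :=
  (F g, anchor g).
have se : smooth_at e g0 by exact: (smooth_at_pair (sF g0) (sa g0)).
have e1 : row_free (mjac e g0).
  have E : mjac e g0 = _ := mjac_pair (sF g0) (sa g0).
  rewrite E; apply/row_free_injP => v; rewrite mul_mx_row -row_mx0.
  by move=> /eq_row_mx[]; exact: jinj.
have [l [sl lE]] := immersion_retraction se e1.
(* The arrows of the isotropy group at [x] share the anchor value [(x, x)], so inserting it as a
   constant gives a map on all arrows of [G'], and [l \o i] can extend [psi]. *)
pose i (h' : arr G') : prod_manifold (arr G') (prod_manifold (obj G) (obj G)) :=
  (h', (x, x) : prod_manifold (obj G) (obj G)).
have si : smooth_at i g'.
  exact: (smooth_at_pair (smooth_at_id g')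
    (smooth_at_cst ((x, x) : prod_manifold (obj G) (obj G)) g')).
have ig' : i g' = e g0.
  by rewrite /i /e /anchor g0F; case: g0x => -> ->.
have sli : smooth_at (l \o i) g' by apply: smooth_at_comp => //; rewrite ig'.
(* The neighbourhood condition puts the preimage of [h'] close to [g0], where [l] is known to invert
   [e]. *)
have npsi : \forall h' \near g', isotropy (f x) h' -> l (i h') = psi h'.
  have := open _ _ lE; rewrite -/(e g0) -ig' => nop.
  apply: filterS (near_continuous si.1 nop) => h' Hh [h's h't].
  have [|q lq [qF qa]] := Hh; first by rewrite /anchor /= h's h't.
  have [px pF] := psiP h' (conj h's h't).
  have qx : isotropy x q by case: qa.
  rewrite -(Finj q (psi h') qx px); last by rewrite qF pF.
  by rewrite -[RHS]lq /e /i qF qa.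
have : \forall h' \near g', (isotropy (f x) h' -> l (i h') = psi h') /\
    smooth_at (l \o i) h' by apply: filterS2 npsi (smooth_at_near sli).
move=> /near_open[U [oU Ug'] UP]; exists U, (l \o i); split=> //.
  by apply: (smooth_inP _ oU).2 => h' /UP[].
by move=> h' [h'x /UP[H _]]; exact: H.
Qed.

Theorem morita_normal_rep_iso : morita phi ->
  homeomorphism (orbit_map phi) /\ forall x : obj G, normal_rep_iso phi x.
Proof.
move=> [ff es]; split=> [|x].
  apply: orbit_map_homeo.
  - exact: fully_faithful_orbit_inj.
  - move=> x'; have [k [Q [q1 [q2 [/good_pullbackP[_ _ [q12 _ _ _] _ _] _ onto]]]]] := es.
    have [z zx'] := onto x'; exists (q2 z); apply/to_orbitP; exists (q1 z).
    by rewrite q12.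
  - exact: essentially_surjective_open.
split.
- exact: fully_faithful_isotropy_iso.
- exact: normal_map_linear.
- apply/normal_map_bij; split; first exact: essentially_surjective_normal_surj.
  exact: fully_faithful_normal_inj.
- by move=> g q gx; exact: normal_map_equivariant.
Qed.

End morita_to_iso.

(** * From the two conditions to a Morita map *)

Section iso_to_morita.
Variables (R : realType) (G G' : lie_groupoid R) (phi : groupoid_map G G').
Local Notation F := (map_arr phi).
Local Notation f := (map_obj phi).
Local Notation ds g := (mjac (@src R _) g).
Local Notation dt g := (mjac (@tgt R _) g).
Hypothesis homeo : homeomorphism (orbit_map phi).
Hypothesis iso : forall x, normal_rep_iso phi x.

Let iso_isotropy x : isotropy_iso phi x. Proof. by have [] := iso x. Qed.
Let surj x : normal_surj phi x.
Proof. by have [_ _ /normal_map_bij[]] := iso x. Qed.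
Let inj x : normal_inj phi x.
Proof. by have [_ _ /normal_map_bij[]] := iso x. Qed.

Let ker_inj g (v : 'rV_(arr_dim G)) :
  (v <= isotropy_mx g)%MS -> v *m mjac F g = 0 -> v = 0.
Proof. by apply: isotropy_map_inj => w; exact: isotropy_iso_inj. Qed.

Let ker_onto g (w : 'rV_(arr_dim G')) : (w <= isotropy_mx (F g))%MS ->
  exists2 v : 'rV_(arr_dim G), (v <= isotropy_mx g)%MS & v *m mjac F g = w.
Proof.
apply: isotropy_map_onto => [v|u]; first exact: ker_inj.
exact: isotropy_iso_onto.
Qed.

(** The product of the inverse of [h] with [g] is an isotropy arrow that [F] sends to a unit. *)
Lemma iso_arrow_inj g h : F g = F h -> anchor g = anchor h -> g = h.
Proof.
move=> gh [gt gs]; have [[_ Finj _] _ _ _] := iso_isotropy (src g).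
have sg : src (ginv h) = tgt g by rewrite src_ginv gt.
have kx : isotropy (src g) (gmul (ginv h) g).
  by rewrite /isotropy /= src_gmul// tgt_gmul// tgt_ginv gs.
have ux : isotropy (src g) (gunit (src g)).
  by rewrite /isotropy /= src_gunit tgt_gunit.
have E : gmul (ginv h) g = gunit (src g).
  apply: Finj; rewrite ?inE//.
  by rewrite map_mul// map_inv gh gmulV map_unit map_src -gs.
have := gmulKg (g := ginv h) (h := g) sg; rewrite ginvK E gs => <-.
exact: gmul_gunit.
Qed.

(** Injectivity on orbits gives some arrow [k] from [x] to [y]; its image differs from [g'] by an
    isotropy arrow, which lifts. *)
Lemma iso_arrow_onto (g' : arr G') (x y : obj G) :
  tgt g' = f y -> src g' = f x -> exists g, [/\ F g = g', tgt g = y & src g = x].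
Proof.
move=> gt gs.
have /to_orbitP[k [ks kt]] : to_orbit x = to_orbit y.
  by apply: (homeo_orbit_inj homeo); apply/to_orbitP; exists g'.
have sk : src (F (ginv k)) = tgt g' by rewrite map_src src_ginv kt.
have [[_ _ Fonto] _ _ _] := iso_isotropy x.
have [|l [ls lt] lE] := Fonto (gmul (F (ginv k)) g').
  by rewrite /isotropy /= src_gmul// tgt_gmul// gs map_tgt tgt_ginv ks.
have kl : src k = tgt l by rewrite ks lt.
exists (gmul k l); split; last by rewrite src_gmul.
  rewrite map_mul// lE map_inv.
  have := @gmulKg _ _ (ginv (F k)) g'; rewrite ginvK; apply.
  by rewrite src_ginv map_tgt kt.
by rewrite tgt_gmul.
Qed.

(** A lift [z] of [vs] is corrected twice: normal injectivity allows a source-kernel correction [b]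
    that makes the target [vt], and surjectivity on the common kernels a further [c] that makes the
    image [a]. *)
Lemma iso_tangent_onto g (a : 'rV_(arr_dim G')) (vt vs : 'rV_(obj_dim G)) :
  a *m dt (F g) = vt *m mjac f (tgt g) -> a *m ds (F g) = vs *m mjac f (src g) ->
  exists v : 'rV_(arr_dim G), [/\ v *m mjac F g = a, v *m dt g = vt & v *m ds g = vs].
Proof.
move=> at_ as_; have [z zs] := (row_full_surjP _).1 (src_full g) vs.
have : (z *m dt g - vt <= orbit_mx (tgt g))%MS.
  apply: inj; rewrite mulmxBl -at_ -mulmxA -map_tgt_jac mulmxA -mulmxBl.
  rewrite -map_tgt orbit_mx_tgt; apply/kermx_mulP; exists (z *m mjac F g - a) => //.
  by rewrite mulmxBl as_ -mulmxA map_src_jac mulmxA zs subrr.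
rewrite orbit_mx_tgt => /kermx_mulP[b bs bt].
have Hs : (z - b) *m ds g = vs by rewrite mulmxBl zs bs subr0.
have Ht : (z - b) *m dt g = vt by rewrite mulmxBl bt opprB addrC subrK.
have [|c ck cF] := @ker_onto g (a - (z - b) *m mjac F g).
  apply/isotropy_mxP; split.
    by rewrite mulmxBl -(mulmxA _ (mjac F g)) map_src_jac mulmxA Hs as_ subrr.
  by rewrite mulmxBl -(mulmxA _ (mjac F g)) map_tgt_jac mulmxA Ht at_ subrr.
have [cs ct] := (isotropy_mxP _ _).1 ck.
exists (z - b + c); rewrite !(mulmxDl _ c) ct cs cF Hs Ht !addr0; split=> //.
by rewrite addrC subrK.
Qed.

(** Transversality of the anchor of [G'] and [phi] on pairs of objects: the source map reaches [w2],
    and normal surjectivity at the target absorbs the remaining error. *)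
Lemma iso_transverse g (w1 w2 : 'rV_(obj_dim G')) :
  exists (a : 'rV_(arr_dim G')) (v : 'rV_(obj_dim G)),
    a *m dt (F g) - v *m mjac f (tgt g) = w1 /\ a *m ds (F g) = w2.
Proof.
have [z zs] := (row_full_surjP _).1 (src_full (F g)) w2.
have [v] := surj (tgt g) (w1 - z *m dt (F g)).
rewrite -map_tgt orbit_mx_tgt => /kermx_mulP[b bs bt].
exists (z + b), (- v); rewrite !mulmxDl bs bt addr0 mulNmx opprK; split=> //.
by apply/rowP => i; rewrite !mxE; ring.
Qed.

Lemma iso_fully_faithful : fully_faithful phi.
Proof.
have anchorE g : anchor (F g) = map_obj2 phi (anchor g).
  by rewrite /anchor /map_obj2 /= map_src map_tgt.
have tangent_onto g (a : 'rV_(arr_dim G')) (w : 'rV_(obj_dim G + obj_dim G)) :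
    a *m mjac (@anchor R G') (F g) = w *m mjac (map_obj2 phi) (anchor g) ->
    exists2 v : 'rV_(arr_dim G), v *m mjac F g = a & v *m mjac (@anchor R G) g = w.
  rewrite anchor_jac map_obj2_jac => /eq_row_mx[at_ as_].
  have [v [vF vt vs]] := iso_tangent_onto at_ as_; exists v => //.
  by rewrite anchor_jac vt vs hsubmxK.
apply/good_pullbackP; split.
- by move=> g; exact: map_arr_at.
- by move=> g; exact: anchor_at.
- split.
  + exact: anchorE.
  + exact: iso_arrow_inj.
  + move=> g' [y x] /= [gt gs]; have [g [gF gy gx]] := iso_arrow_onto gt gs.
    by exists g; rewrite // /anchor gy gx.
  + move=> g; apply: (@fibre_product_onto _ _ _ _ _ _ _ _ _ (@anchor R G')
      (map_obj2 phi) F (@anchor R G) g).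
    * exact: map_arr_at.
    * exact: anchor_at.
    * exact: anchor_at.
    * exact: (map_obj2_at phi).
    * exact: anchorE.
    * move=> w; have [a [v [at_ as_]]] := iso_transverse g (lsubmx w) (rsubmx w).
      exists a, (row_mx v 0); rewrite anchor_jac (map_obj2_jac phi).
      rewrite row_mxKl row_mxKr mul0mx as_ opp_row_mx add_row_mx oppr0 addr0.
      by rewrite /= at_ hsubmxK.
    * exact: tangent_onto.
- move=> g v vF; rewrite anchor_jac -row_mx0 => /eq_row_mx[vt vs].
  by apply: (ker_inj (g := g)) => //; exact/isotropy_mxP.
- move=> g a w; split; first exact: tangent_onto.
  move=> [v <- <-]; rewrite -!mulmxA.
  have E1 := mjac_comp (map_arr_at phi g) (anchor_at (F g)).
  have E2 := mjac_comp (anchor_at g) (map_obj2_at phi (anchor g)).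
  have fE : @anchor R G' \o F = map_obj2 phi \o @anchor R G.
    by apply/funext => h; exact: anchorE.
  by rewrite -E1 -[in RHS]E2 fE.
Qed.

Lemma iso_essentially_surjective : essentially_surjective phi.
Proof.
have [k [Q [q1 [q2 Qpb]]]] :=
  good_pullback_exists (src_submersion G') (map_obj_smooth phi).
exists k, Q, q1, q2; split=> //; last first.
  move=> x'; have [x /to_orbitP[g [gx gy]]] := homeo_orbit_onto homeo x'.
  have /good_pullbackP[_ _ [_ _ onto _] _ _] := Qpb.
  by have [z z1 z2] := onto g x gx; exists z; rewrite z1.
have /good_pullbackP[s1 s2 [q12 _ _ _] _ ex] := Qpb.
have sQ z : smooth_at (@tgt R G' \o q1) z.
  by apply: smooth_at_comp; [exact: s1|exact: tgt_at].
apply/submersionP; split=> // z; apply/row_full_surjP => w.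
have [a aw] := (row_full_surjP _).1 (tgt_full (q1 z)) w.
(* Normal surjectivity corrects [a] by a vector of the target kernel, so that its source derivative
   comes from [v] while its target derivative stays [w]. *)
have [v] := surj (q2 z) (a *m ds (q1 z)).
rewrite -q12 orbit_mx_src => /kermx_mulP[b bt bs].
have [|u u1 u2] := (ex z (a - b) v).1.
  by rewrite mulmxBl bs opprB addrC subrK.
exists u; have E : mjac (fun z => tgt (q1 z)) z = _ := mjac_comp (s1 z) (tgt_at (q1 z)).
by rewrite E mulmxA u1 mulmxBl bt subr0.
Qed.

End iso_to_morita.

Theorem theorem4p3p1 (R : realType) (G G' : lie_groupoid R)
    (phi : groupoid_map G G') :
  morita phi <->
  (homeomorphism (orbit_map phi) /\ forall x : obj G, normal_rep_iso phi x).
Proof.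
split; first exact: morita_normal_rep_iso.
move=> [homeo iso]; split; first exact: iso_fully_faithful.
exact: iso_essentially_surjective.
Qed.
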